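(* Let $\varphi:\mathbb D\to\mathbb D$ be holomorphic and let $\sigma\in\partial\mathbb D$. Then the following conditions are pairwise equivalent: (a) $\displaystyle\int_0^1\big(1-D_h\varphi(r\sigma)\big)\,\lambda_{\mathbb D}(r\sigma)\,dr<+\infty$. (b) $\displaystyle\angle\lim_{z,w\to\sigma}\big(\mathrm k_{\mathbb D}(z,w)-\mathrm k_{\mathbb D}(\varphi(z),\varphi(w))\big)=0$. (c) $\displaystyle\angle\lim_{z,w\to\sigma}\frac{|\langle k_z^\varphi,k_w^\varphi\rangle_\varphi|}{\|k_z^\varphi\|_\varphi\,\|k_w^\varphi\|_\varphi}=1$. (d) $\varphi$ is conformal at $\sigma$ in the strong sense.
   Context: $\mathbb D=\{z\in\mathbb C:|z|<1\}$. $\lambda_{\mathbb D}(z)=\frac{2}{1-|z|^2}$ is the hyperbolic density, and the hyperbolic distance is $\mathrm k_{\mathbb D}(z,w)=\log\frac{1+\varrho_{\mathbb D}(z,w)}{1-\varrho_{\mathbb D}(z,w)}$, where $\varrho_{\mathbb D}(z,w)=\left|\frac{z-w}{1-\overline w z}\right|$. For holomorphic $\varphi:\mathbb D\to\mathbb D$ the hyperbolic distortion is $D_h\varphi(z)=(1-|z|^2)\frac{|\varphi'(z)|}{1-|\varphi(z)|^2}$. For $\sigma\in\partial\mathbb D$ and $M>1$ let $S_M=\{z\in\mathbb D:|z-\sigma|<M(1-|z|)\}$ (Stolz region with vertex $\sigma$). $\angle\lim_{z\to\sigma}f(z)=\ell$ means that for every $M>1$, $f(z)\to\ell$ as $z\to\sigma$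 with $z\in S_M$; $\angle\lim_{z,w\to\sigma}f(z,w)=\ell$ means that for every $M>1$, $f(z,w)\to\ell$ as $z\to\sigma$ and $w\to\sigma$ with $z,w\in S_M$. For holomorphic $\varphi:\mathbb D\to\mathbb D$, the function $k^\varphi(z,w)=k^\varphi_w(z):=\frac{1-\overline{\varphi(w)}\varphi(z)}{1-\overline w z}$, $z,w\in\mathbb D$, is positive definite; the de Branges–Rovnyak space $\mathcal H(\varphi)$ is the unique reproducing kernel Hilbert space of (holomorphic) functions on $\mathbb D$ with reproducing kernel $k^\varphi$, i.e. $k_w^\varphi\in\mathcal H(\varphi)$ and $f(w)=\langle f,k_w^\varphi\rangle_\varphi$ for all $f\in\mathcal H(\varphi)$, $w\in\mathbb D$. Here $\langle\cdot,\cdot\rangle_\varphi$ and $\|\cdot\|_\varphi$ are the inner product and norm of $\mathcal H(\varphi)$. $\varphi$ is called conformal at $\sigma$ in the strong sense if there exists $\omega\in\partial\mathbb D$ such that the angular limit $\angle\lim_{z\to\sigma}\frac{\varphi(z)-\omega}{z-\sigma}$ exists and is finite. *)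

(* Defs.v *)
From Stdlib Require Import Reals List.
From Coquelicot Require Import Coquelicot.
Open Scope R_scope.

Definition disc : Type := {z : C | Cmod z < 1}.
Definition disc_val (z : disc) : C := proj1_sig z.
Coercion disc_val : disc >-> C.

(* A self-map of the disc is represented by a total function on C whose values
   outside the disc are irrelevant: all notions below only evaluate it (or its
   derivative) at points of the disc. *)
Definition holomorphic_self_map (phi : C -> C) : Prop :=
  forall z : C, Cmod z < 1 ->
    ex_derive (K := C_AbsRing) (V := C_NormedModule) phi z /\ Cmod (phi z) < 1.

Definition hyp_density (z : C) : R := 2 / (1 - Cmod z ^ 2).

Definition pseudo_hyp_dist (z w : C) : R :=
  Cmod ((z - w) / (1 - Cconj w * z))%C.

Definition hyp_dist (z w : C) : R :=
  ln ((1 + pseudo_hyp_dist z w) / (1 - pseudo_hyp_dist z w)).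

Definition hyp_distortion (phi : C -> C) (z : C) : R :=
  (1 - Cmod z ^ 2) * (Cmod (C_derive phi z) / (1 - Cmod (phi z) ^ 2)).

Definition stolz (sigma : C) (M : R) (z : C) : Prop :=
  Cmod z < 1 /\ Cmod (z - sigma)%C < M * (1 - Cmod z).

Definition stolz_filter (sigma : C) (M : R) : (C -> Prop) -> Prop :=
  within (stolz sigma M) (locally (T := C_UniformSpace) sigma).

Definition angular_lim {V : UniformSpace} (f : C -> V) (sigma : C) (l : V) :
    Prop :=
  forall M : R, 1 < M -> filterlim f (stolz_filter sigma M) (locally l).

Definition angular_lim2 {V : UniformSpace} (f : C -> C -> V) (sigma : C)
    (l : V) : Prop :=
  forall M : R, 1 < M ->
    filterlim (fun p : C * C => f (fst p) (snd p))
      (filter_prod (stolz_filter sigma M) (stolz_filter sigma M)) (locally l).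

Definition inner_norm {X : Type} (inner : (X -> C) -> (X -> C) -> C)
    (f : X -> C) : R :=
  sqrt (Re (inner f f)).

(* [inner] is only meaningful on pairs of functions satisfying [mem]; it is
   linear in the first argument. *)
Record rkhs (X : Type) (K : X -> X -> C) : Type := {
  mem : (X -> C) -> Prop;
  inner : (X -> C) -> (X -> C) -> C;
  mem_zero : mem (fun _ => RtoC 0);
  mem_plus : forall f g, mem f -> mem g -> mem (fun x => f x + g x)%C;
  mem_scal : forall (a : C) f, mem f -> mem (fun x => a * f x)%C;
  inner_plus_l : forall f g h, mem f -> mem g -> mem h ->
    inner (fun x => f x + g x)%C h = (inner f h + inner g h)%C;
  inner_scal_l : forall (a : C) f g, mem f -> mem g ->
    inner (fun x => a * f x)%C g = (a * inner f g)%C;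
  inner_conj : forall f g, mem f -> mem g -> inner g f = Cconj (inner f g);
  inner_nonneg : forall f, mem f -> 0 <= Re (inner f f);
  inner_definite : forall f, mem f ->
    inner f f = RtoC 0 -> f = (fun _ => RtoC 0);
  complete : forall u : nat -> X -> C,
    (forall n, mem (u n)) ->
    (forall eps : R, 0 < eps -> exists N : nat, forall n m : nat,
       (N <= n)%nat -> (N <= m)%nat ->
       inner_norm inner (fun x => u n x - u m x)%C < eps) ->
    exists f, mem f /\
      is_lim_seq (fun n => inner_norm inner (fun x => u n x - f x)%C) 0;
  kernel_mem : forall w, mem (fun x => K x w);
  reproducing : forall f w, mem f -> inner f (fun x => K x w) = f w
}.

Arguments mem {X K} _ _.
Arguments inner {X K} _ _ _.

Definition rkhs_norm {X : Type} {K : X -> X -> C} (H : rkhs X K) (f : X -> C) :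
    R :=
  inner_norm (inner H) f.

Definition dbr_kernel (phi : C -> C) (z w : C) : C :=
  ((1 - Cconj (phi w) * phi z) / (1 - Cconj w * z))%C.

Definition dbr_space (phi : C -> C) : Type :=
  rkhs disc (fun z w : disc => dbr_kernel phi z w).

(* The kernel function at [w], as a function on the disc; it is defined for
   every complex [w] so that limits in [w] can be taken in C. *)
Definition dbr_kernel_at (phi : C -> C) (w : C) : disc -> C :=
  fun z => dbr_kernel phi z w.

(* The integrand is continuous on [0,1) and nonnegative (Schwarz-Pick), so that
   finiteness of the integral is convergence of the improper integral at 1. *)
Definition distortion_integral_finite (phi : C -> C) (sigma : C) : Prop :=
  ex_RInt_gen
    (fun r : R => (1 - hyp_distortion phi (RtoC r * sigma)%C)
                  * hyp_density (RtoC r * sigma)%C)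
    (at_point 0) (at_left 1).

Definition hyp_dist_preserved_at (phi : C -> C) (sigma : C) : Prop :=
  angular_lim2 (fun z w => hyp_dist z w - hyp_dist (phi z) (phi w)) sigma 0.

Definition kernels_aligned_at (phi : C -> C) (H : dbr_space phi) (sigma : C) :
    Prop :=
  angular_lim2
    (fun z w =>
       Cmod (inner H (dbr_kernel_at phi z) (dbr_kernel_at phi w))
       / (rkhs_norm H (dbr_kernel_at phi z)
          * rkhs_norm H (dbr_kernel_at phi w)))
    sigma 1.

Definition strongly_conformal_at (phi : C -> C) (sigma : C) : Prop :=
  exists omega : C, Cmod omega = 1 /\
    exists l : C,
      angular_lim (V := C_UniformSpace)
        (fun z => (phi z - omega) / (z - sigma))%C sigma l.

(* Main.v *)
Require Import Defs.
From Stdlib Require Import Reals List Lra Psatz.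
From Coquelicot Require Import Coquelicot.
Import ListNotations.
Open Scope R_scope.

(** All four conditions are equivalent to boundedness of
    [(1 - |phi (r sigma)|) / (1 - r)] as [r] tends to [1] ([radially_julia]).

    Since [cosh (k / 2) ^ 2 = 1 / (1 - rho ^ 2)], the normalized modulus of the
    kernel at [(z, w)] is [cosh (k(phi z, phi w) / 2) / cosh (k(z, w) / 2)];
    by Schwarz-Pick this quotient tends to [1] exactly when the difference of
    the two distances tends to [0], so (b) and (c) agree pointwise; fixing [w]
    gives the radial bound.

    Boundedness of the integral gives the radial bound as follows: after moving
    a base point to [0], Dieudonne's lemma yields a differential inequality
    for [sinh (d / 2) ^ 2 / sinh (k / 2) ^ 2], where [k] and [d] are the distances
    travelled by the radius and by its image; along the radius this quotient
    loses at most twice the integral, hence stays away from [0] if the base point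
    is close enough to [sigma].

    Conversely, the radial bound gives a radial limit [omega] and Julia's
    inequality [c Re Z <= Re F] for the Cayley transforms [Z] of [z] and [F] of
    [phi z]; with the best [c], Schwarz-Pick in the half-plane for [F - c Z] shows
    [F / Z -> c] nontangentially.  This gives (d) and (c) by algebra, and the
    integrand of (a) is at most the derivative of [ln (Re Z / Re F)].

    The Schwarz lemma for merely differentiable functions comes from Goursat's
    bisection, applied directly to the contraction of a circle to a point [a] of
    its disc, which gives Cauchy's formula. *)

(** * Continuity and differentiability over the complex numbers *)

(** Holomorphy is given only as differentiability at each point, while the integrand of (a) contains
    the derivative, whose continuity must be known before it can be integrated. Cauchy's formula
    supplies it, and this is one reason for starting from Goursat.

    The delicate implication is the one from (a). The differential inequality for the quotient of
    [sinh] squares carries a factor [1 / x], so it cannot be started at the base point, where the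
    quotient equals the square of the distortion. The hyperbolic density has infinite mass near
    [sigma], so a finite integral forces base points arbitrarily close to [sigma] with distortion
    close to 1. Schwarz-Pick then carries the lower bound from 0 to [1 / 2], and the inequality is
    integrated only from there on.

    The auxiliary functions (the quotient [g] of the Schwarz lemma, [F - c Z], [1 - conj (g 0) * g])
    may touch the boundary of the disc or half-plane. Schwarz-Pick is therefore needed for closed
    targets; it follows from the open case by shrinking or shifting the function. *)

Notation Ccontinuous := (continuous (T := C_UniformSpace) (U := C_UniformSpace)).

Lemma continuous_pair {T : UniformSpace} (f g : T -> R) (x : T) :
  continuous f x -> continuous g x ->
  continuous (U := C_UniformSpace) (fun t => (f t, g t) : C) x.
Proof.
  intros Hf Hg P [e He].
  assert (Hf' := Hf _ (locally_ball (T := R_UniformSpace) (f x) e)).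
  assert (Hg' := Hg _ (locally_ball (T := R_UniformSpace) (g x) e)).
  unfold filtermap in *. apply (filter_imp (fun t => ball (f x) e (f t) /\ ball (g x) e (g t))).
  - intros t [H1 H2]; apply He; split; assumption.
  - apply filter_and; assumption.
Qed.

Lemma continuous_Re {T : UniformSpace} (f : T -> C) (x : T) :
  continuous (U := C_UniformSpace) f x -> continuous (fun t => Re (f t)) x.
Proof.
  intros Hf. apply (continuous_comp (V := C_UniformSpace) f fst); [exact Hf|].
  apply (continuous_fst (U := R_UniformSpace) (V := R_UniformSpace)).
Qed.

Lemma continuous_Im {T : UniformSpace} (f : T -> C) (x : T) :
  continuous (U := C_UniformSpace) f x -> continuous (fun t => Im (f t)) x.
Proof.
  intros Hf. apply (continuous_comp (V := C_UniformSpace) f snd); [exact Hf|].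
  apply (continuous_snd (U := R_UniformSpace) (V := R_UniformSpace)).
Qed.

Lemma continuous_Cplus {T : UniformSpace} (f g : T -> C) (x : T) :
  continuous (U := C_UniformSpace) f x -> continuous (U := C_UniformSpace) g x ->
  continuous (U := C_UniformSpace) (fun t => (f t + g t)%C) x.
Proof.
  intros Hf Hg.
  apply (continuous_pair (fun t => Re (f t) + Re (g t)) (fun t => Im (f t) + Im (g t)));
    apply (continuous_plus (V := R_NormedModule));
    [apply continuous_Re | apply continuous_Re | apply continuous_Im | apply continuous_Im];
    assumption.
Qed.

Lemma continuous_Copp {T : UniformSpace} (f : T -> C) (x : T) :
  continuous (U := C_UniformSpace) f x ->
  continuous (U := C_UniformSpace) (fun t => (- f t)%C) x.
Proof.
  intros Hf.
  apply (continuous_pair (fun t => - Re (f t)) (fun t => - Im (f t)));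
    apply (continuous_opp (V := R_NormedModule));
    [apply continuous_Re | apply continuous_Im]; assumption.
Qed.

Lemma continuous_Cminus {T : UniformSpace} (f g : T -> C) (x : T) :
  continuous (U := C_UniformSpace) f x -> continuous (U := C_UniformSpace) g x ->
  continuous (U := C_UniformSpace) (fun t => (f t - g t)%C) x.
Proof. intros Hf Hg. apply continuous_Cplus, continuous_Copp; assumption. Qed.

Lemma continuous_Rmult {T : UniformSpace} (f g : T -> R) (x : T) :
  continuous f x -> continuous g x -> continuous (fun t => f t * g t) x.
Proof. intros Hf Hg. apply (continuous_mult (K := R_AbsRing)); assumption. Qed.

Lemma continuous_Cmult {T : UniformSpace} (f g : T -> C) (x : T) :
  continuous (U := C_UniformSpace) f x -> continuous (U := C_UniformSpace) g x ->
  continuous (U := C_UniformSpace) (fun t => (f t * g t)%C) x.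
Proof.
  intros Hf Hg.
  apply (continuous_pair (fun t => Re (f t) * Re (g t) - Im (f t) * Im (g t))
                         (fun t => Re (f t) * Im (g t) + Im (f t) * Re (g t)));
    [apply (continuous_minus (V := R_NormedModule)) | apply (continuous_plus (V := R_NormedModule))];
    apply continuous_Rmult;
    [apply continuous_Re | apply continuous_Re | apply continuous_Im | apply continuous_Im
    |apply continuous_Re | apply continuous_Im | apply continuous_Im | apply continuous_Re];
    assumption.
Qed.

Lemma continuous_sqr {T : UniformSpace} (f : T -> R) (x : T) :
  continuous f x -> continuous (fun t => f t ^ 2) x.
Proof.
  intros Hf. simpl. apply continuous_Rmult; [exact Hf|].
  apply continuous_Rmult; [exact Hf | apply continuous_const].
Qed.

Lemma continuous_sqr_norm {T : UniformSpace} (f : T -> C) (x : T) :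
  continuous (U := C_UniformSpace) f x ->
  continuous (fun t => Re (f t) ^ 2 + Im (f t) ^ 2) x.
Proof.
  intros Hf. apply (continuous_plus (V := R_NormedModule)); apply continuous_sqr;
    [apply continuous_Re | apply continuous_Im]; exact Hf.
Qed.

Lemma Csum_sqr_pos (z : C) : z <> RtoC 0 -> 0 < fst z ^ 2 + snd z ^ 2.
Proof.
  intros Hz. apply Cmod_gt_0 in Hz. unfold Cmod in Hz.
  apply Rnot_le_lt; intro H. rewrite sqrt_neg_0 in Hz; lra.
Qed.

Lemma continuous_Cinv {T : UniformSpace} (f : T -> C) (x : T) :
  continuous (U := C_UniformSpace) f x -> f x <> RtoC 0 ->
  continuous (U := C_UniformSpace) (fun t => (/ f t)%C) x.
Proof.
  intros Hf Hx.
  assert (Hn := Csum_sqr_pos _ Hx).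
  assert (Hd : continuous (fun t => / (Re (f t) ^ 2 + Im (f t) ^ 2)) x).
  { apply (continuous_comp (fun t => Re (f t) ^ 2 + Im (f t) ^ 2) Rinv).
    - apply continuous_sqr_norm, Hf.
    - apply continuity_pt_filterlim, continuity_pt_inv.
      + apply derivable_continuous_pt, derivable_pt_id.
      + unfold Re, Im, id. lra. }
  apply (continuous_pair (fun t => Re (f t) * / (Re (f t) ^ 2 + Im (f t) ^ 2))
                         (fun t => (- Im (f t)) * / (Re (f t) ^ 2 + Im (f t) ^ 2)));
    apply continuous_Rmult; trivial.
  - apply continuous_Re; assumption.
  - apply (continuous_opp (V := R_NormedModule)), continuous_Im; assumption.
Qed.

Lemma continuous_Cmod {T : UniformSpace} (f : T -> C) (x : T) :
  continuous (U := C_UniformSpace) f x -> continuous (fun t => Cmod (f t)) x.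
Proof.
  intros Hf. apply (continuous_comp (fun t => Re (f t) ^ 2 + Im (f t) ^ 2) sqrt).
  - apply continuous_sqr_norm, Hf.
  - apply continuous_sqrt.
Qed.

Lemma continuous_RtoC {T : UniformSpace} (f : T -> R) (x : T) :
  continuous f x -> continuous (U := C_UniformSpace) (fun t => RtoC (f t)) x.
Proof. intros Hf. apply continuous_pair; [exact Hf | apply continuous_const]. Qed.

Lemma continuous_C_ext {T : UniformSpace} (f g : T -> C) (x : T) :
  (forall t, f t = g t) ->
  continuous (U := C_UniformSpace) f x -> continuous (U := C_UniformSpace) g x.
Proof. intros E. apply continuous_ext. exact E. Qed.

(** The uniform structure on C is that of a product, so its balls are squares; the factor [sqrt 2]
    compares them with discs. *)
Lemma locally_C_iff (z : C) (P : C -> Prop) :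
  locally (T := C_UniformSpace) z P <->
  exists d, 0 < d /\ forall w, Cmod (w - z) < d -> P w.
Proof.
  split.
  - intros [e He]. exists e; split; [apply cond_pos|].
    intros w Hw. apply He. apply C_NormedModule_mixin_compat1. exact Hw.
  - intros [d [Hd H]].
    assert (Hd2 : 0 < d / sqrt 2) by (apply Rdiv_lt_0_compat; [|apply sqrt_lt_R0]; lra).
    exists (mkposreal _ Hd2). intros w Hw. apply H.
    assert (Hs := C_NormedModule_mixin_compat2 z w (mkposreal _ Hd2) Hw).
    simpl in Hs. replace (sqrt 2 * (d / sqrt 2)) with d in Hs. exact Hs.
    field. apply Rgt_not_eq, sqrt_lt_R0; lra.
Qed.

Lemma continuous_C_iff {T : UniformSpace} (f : T -> C) (x : T) :
  continuous (U := C_UniformSpace) f x <->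
  forall eps, 0 < eps -> locally x (fun t => Cmod (f t - f x) < eps).
Proof.
  split.
  - intros H eps He. apply (H (fun w => Cmod (w - f x) < eps)).
    apply locally_C_iff. exists eps; auto.
  - intros H P HP. apply locally_C_iff in HP. destruct HP as [d [Hd HP]].
    unfold filtermap. generalize (H d Hd). apply filter_imp. auto.
Qed.

Lemma Ccontinuous_iff (f : C -> C) (z : C) :
  Ccontinuous f z <->
  forall eps, 0 < eps -> exists d, 0 < d /\
    forall w, Cmod (w - z) < d -> Cmod (f w - f z) < eps.
Proof.
  rewrite continuous_C_iff. split; intros H eps He.
  - apply locally_C_iff, H, He.
  - apply locally_C_iff, H, He.
Qed.

(* Caratheodory's form of complex differentiability, with derivative [l]. *)
Definition Cderiv (f : C -> C) (z l : C) : Prop :=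
  exists q : C -> C, Ccontinuous q z /\ q z = l /\
    forall w, f w = (f z + q w * (w - z))%C.

Definition Cdiffable (f : C -> C) (z : C) : Prop := exists l, Cderiv f z l.

Lemma Cminus_eq_0 (a b : C) : (a - b)%C = RtoC 0 -> a = b.
Proof. intro H. replace a with ((a - b) + b)%C by ring. rewrite H. ring. Qed.

Lemma Cminus_neq_0 (a b : C) : a <> b -> (a - b)%C <> RtoC 0.
Proof. intros H E. apply H, Cminus_eq_0, E. Qed.

Lemma Cderiv_of_bound (f : C -> C) (z l : C) :
  (forall eps, 0 < eps -> exists d, 0 < d /\ forall w, Cmod (w - z) < d ->
     Cmod (f w - f z - l * (w - z)) <= eps * Cmod (w - z)) ->
  Cderiv f z l.
Proof.
  intros H.
  exists (fun w => if Ceq_dec w z then l else ((f w - f z) / (w - z))%C).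
  split; [|split].
  - apply Ccontinuous_iff. intros eps He.
    destruct (H (eps / 2) ltac:(lra)) as [d [Hd Hw]].
    exists d; split; trivial. intros w Hwd.
    destruct (Ceq_dec z z) as [_|n]; [|now elim n].
    destruct (Ceq_dec w z) as [E|E].
    + unfold Cminus. rewrite Cplus_opp_r, Cmod_0. lra.
    + assert (Hn := Cminus_neq_0 _ _ E).
      replace ((f w - f z) / (w - z) - l)%C
        with ((f w - f z - l * (w - z)) / (w - z))%C by (field; exact Hn).
      rewrite Cmod_div by exact Hn.
      assert (Hp := proj1 (Cmod_gt_0 _) Hn).
      apply Rle_lt_trans with (eps / 2); [|lra].
      apply Rle_div_l; [lra|]. apply Hw, Hwd.
  - destruct (Ceq_dec z z) as [_|n]; [reflexivity|now elim n].
  - intros w. destruct (Ceq_dec w z) as [E|E].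
    + rewrite E. ring.
    + field. apply Cminus_neq_0, E.
Qed.

Lemma Cderiv_bound (f : C -> C) (z l : C) : Cderiv f z l ->
  forall eps, 0 < eps -> exists d, 0 < d /\ forall w, Cmod (w - z) < d ->
     Cmod (f w - f z - l * (w - z)) <= eps * Cmod (w - z).
Proof.
  intros [q [Hq [Hl Hf]]] eps He.
  destruct (proj1 (Ccontinuous_iff _ _) Hq eps He) as [d [Hd Hw]].
  exists d; split; trivial. intros w Hwd.
  rewrite (Hf w). replace (f z + q w * (w - z) - f z - l * (w - z))%C with ((q w - q z) * (w - z))%C.
  - rewrite Cmod_mult. apply Rmult_le_compat_r; [apply Cmod_ge_0|]. apply Rlt_le, Hw, Hwd.
  - rewrite Hl. ring.
Qed.

Lemma is_derive_Cderiv (f : C -> C) (z l : C) :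
  is_derive (K := C_AbsRing) (V := C_NormedModule) f z l <-> Cderiv f z l.
Proof.
  split.
  - intros [_ H]. apply Cderiv_of_bound. intros eps He.
    specialize (H z (fun P HP => HP) (mkposreal eps He)).
    (* [locally_C] passes from the uniform structure given by the modulus to the product one. *)
    apply (proj2 (locally_C _ _)) in H.
    apply locally_C_iff in H. destruct H as [d [Hd H]].
    exists d; split; trivial. intros w Hw. specialize (H w Hw).
    rewrite Cmult_comm. exact H.
  - intros H. split; [apply is_linear_scal_l|].
    intros x Hx. apply (is_filter_lim_locally_unique (K := C_AbsRing) (V := AbsRing_NormedModule C_AbsRing)) in Hx. subst x.
    intros eps. apply (proj1 (locally_C _ _)). apply locally_C_iff.
    destruct (Cderiv_bound _ _ _ H eps (cond_pos eps)) as [d [Hd Hw]].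
    exists d; split; trivial. intros w Hwd. specialize (Hw w Hwd).
    rewrite (Cmult_comm l) in Hw. exact Hw.
Qed.

Lemma Cderiv_unique f z l m : Cderiv f z l -> Cderiv f z m -> l = m.
Proof.
  intros H1 H2. apply is_derive_Cderiv in H1. apply is_derive_Cderiv in H2.
  rewrite <- (is_C_derive_unique f z l) by exact H1.
  apply is_C_derive_unique. exact H2.
Qed.

Lemma Cderiv_continuous f z l : Cderiv f z l -> Ccontinuous f z.
Proof.
  intros [q [Hq [Hl Hf]]].
  apply (continuous_C_ext (fun w => (f z + q w * (w - z))%C)).
  - intro w; symmetry; apply Hf.
  - apply continuous_Cplus; [apply continuous_const|].
    apply continuous_Cmult; [exact Hq|].
    apply continuous_Cminus; [apply continuous_id | apply continuous_const].
Qed.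

Lemma Cdiffable_continuous f z : Cdiffable f z -> Ccontinuous f z.
Proof. intros [l H]. eapply Cderiv_continuous, H. Qed.

Lemma Cderiv_const c z : Cderiv (fun _ => c) z (RtoC 0).
Proof.
  exists (fun _ => RtoC 0). split; [apply continuous_const|]. split; [reflexivity|].
  intros; ring.
Qed.

Lemma Cderiv_id z : Cderiv (fun w => w) z (RtoC 1).
Proof.
  exists (fun _ => RtoC 1). split; [apply continuous_const|]. split; [reflexivity|].
  intros; ring.
Qed.

Lemma Cderiv_plus f g z l m : Cderiv f z l -> Cderiv g z m ->
  Cderiv (fun w => (f w + g w)%C) z (l + m)%C.
Proof.
  intros [q [Hq [Hl Hf]]] [p [Hp [Hm Hg]]].
  exists (fun w => (q w + p w)%C). split; [apply continuous_Cplus; assumption|].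
  split; [now rewrite Hl, Hm|]. intros w. rewrite (Hf w), (Hg w). ring.
Qed.

Lemma Cderiv_opp f z l : Cderiv f z l -> Cderiv (fun w => (- f w)%C) z (- l)%C.
Proof.
  intros [q [Hq [Hl Hf]]].
  exists (fun w => (- q w)%C). split; [apply continuous_Copp; assumption|].
  split; [now rewrite Hl|]. intros w. rewrite (Hf w). ring.
Qed.

Lemma Cderiv_minus f g z l m : Cderiv f z l -> Cderiv g z m ->
  Cderiv (fun w => (f w - g w)%C) z (l - m)%C.
Proof. intros Hf Hg. apply Cderiv_plus, Cderiv_opp; assumption. Qed.

Lemma Cderiv_mult f g z l m : Cderiv f z l -> Cderiv g z m ->
  Cderiv (fun w => (f w * g w)%C) z (l * g z + f z * m)%C.
Proof.
  intros Df Dg. assert (Cg := Cderiv_continuous _ _ _ Dg).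
  destruct Df as [q [Hq [Hl Hf]]]. destruct Dg as [p [Hp [Hm Hg]]].
  exists (fun w => (q w * g w + f z * p w)%C). split.
  - apply continuous_Cplus; apply continuous_Cmult; trivial. apply continuous_const.
  - split; [now rewrite Hl, Hm|]. intros w. rewrite (Hf w), (Hg w). ring.
Qed.

(** The natural slope [- q w / (f w * f z)] is correct only where [f w] is nonzero, whereas [Cderiv]
    asks for an identity at every point; hence the detour through the local bound. *)
Lemma Cderiv_inv f z l : Cderiv f z l -> f z <> RtoC 0 ->
  Cderiv (fun w => (/ f w)%C) z (- l / (f z * f z))%C.
Proof.
  intros Df Hz. assert (Cf := Cderiv_continuous _ _ _ Df).
  destruct Df as [q [Hq [Hl Hf]]].
  assert (Hn := proj1 (Cmod_gt_0 _) Hz).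
  destruct (proj1 (Ccontinuous_iff _ _) Cf (Cmod (f z)) Hn) as [d [Hd Hw]].
  set (p := (fun w => - q w / (f w * f z))%C).
  assert (Hp : Ccontinuous p z).
  { apply continuous_Cmult; [apply continuous_Copp, Hq|].
    apply continuous_Cinv; [|now apply Cmult_neq_0].
    apply continuous_Cmult; [exact Cf | apply continuous_const]. }
  apply Cderiv_of_bound. intros eps He.
  destruct (proj1 (Ccontinuous_iff _ _) Hp eps He) as [d' [Hd' Hw']].
  exists (Rmin d d'). split; [apply Rmin_pos; trivial|].
  intros w Hwd.
  assert (H1 := Hw w (Rlt_le_trans _ _ _ Hwd (Rmin_l _ _))).
  assert (H2 := Hw' w (Rlt_le_trans _ _ _ Hwd (Rmin_r _ _))).
  assert (Hfw : f w <> RtoC 0).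
  { intro E. rewrite E in H1. unfold Cminus in H1. rewrite Cplus_0_l, Cmod_opp in H1. lra. }
  replace (/ f w - / f z - - l / (f z * f z) * (w - z))%C with ((p w - p z) * (w - z))%C.
  - rewrite Cmod_mult. apply Rmult_le_compat_r; [apply Cmod_ge_0 | lra].
  - unfold p. rewrite Hl.
    assert (E : (q w * (w - z) = f w - f z)%C) by (rewrite (Hf w); ring).
    replace (- q w / (f w * f z))%C with (- (q w) * (/ (f w * f z)))%C by reflexivity.
    transitivity ((- (q w * (w - z)) * (/ (f w * f z)) + l / (f z * f z) * (w - z)))%C.
    + field. split; trivial.
    + rewrite E. field. split; trivial.
Qed.

Lemma Cderiv_comp f g z l m : Cderiv g z m -> Cderiv f (g z) l ->
  Cderiv (fun w => f (g w)) z (l * m)%C.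
Proof.
  intros Dg [q [Hq [Hl Hf]]]. assert (Cg := Cderiv_continuous _ _ _ Dg).
  destruct Dg as [p [Hp [Hm Hg]]].
  exists (fun w => (q (g w) * p w)%C). split; [|split].
  - apply continuous_Cmult; trivial.
    apply (continuous_comp (U := C_UniformSpace) (V := C_UniformSpace) (W := C_UniformSpace) g q); trivial.
  - now rewrite Hl, Hm.
  - intros w. rewrite (Hf (g w)). rewrite (Hg w) at 2. ring.
Qed.

Lemma Cderiv_ext_loc f g z l d : 0 < d -> (forall w, Cmod (w - z) < d -> f w = g w) ->
  Cderiv f z l -> Cderiv g z l.
Proof.
  intros Hd E H. apply Cderiv_of_bound. intros eps He.
  destruct (Cderiv_bound _ _ _ H eps He) as [d' [Hd' Hw]].
  exists (Rmin d d'). split; [apply Rmin_pos; trivial|].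
  intros w Hwd. rewrite <- (E w), <- (E z).
  - apply Hw. apply Rlt_le_trans with (1 := Hwd), Rmin_r.
  - unfold Cminus. rewrite Cplus_opp_r, Cmod_0. exact Hd.
  - apply Rlt_le_trans with (1 := Hwd), Rmin_l.
Qed.

Lemma Cderiv_ext f g z l : (forall w, f w = g w) -> Cderiv f z l -> Cderiv g z l.
Proof. intros E. apply Cderiv_ext_loc with 1; auto with real. Qed.

Lemma Cdiffable_plus f g z : Cdiffable f z -> Cdiffable g z -> Cdiffable (fun w => (f w + g w)%C) z.
Proof. intros [l Hl] [m Hm]. eexists; apply Cderiv_plus; eassumption. Qed.
Lemma Cdiffable_minus f g z : Cdiffable f z -> Cdiffable g z -> Cdiffable (fun w => (f w - g w)%C) z.
Proof. intros [l Hl] [m Hm]. eexists; apply Cderiv_minus; eassumption. Qed.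
Lemma Cdiffable_mult f g z : Cdiffable f z -> Cdiffable g z -> Cdiffable (fun w => (f w * g w)%C) z.
Proof. intros [l Hl] [m Hm]. eexists; apply Cderiv_mult; eassumption. Qed.
Lemma Cdiffable_div f g z : Cdiffable f z -> Cdiffable g z -> g z <> RtoC 0 -> Cdiffable (fun w => (f w / g w)%C) z.
Proof.
  intros [l Hl] [m Hm] Hz. eexists. apply Cderiv_mult; [eassumption|].
  apply Cderiv_inv; eassumption.
Qed.
Lemma Cdiffable_const c z : Cdiffable (fun _ => c) z.
Proof. eexists; apply Cderiv_const. Qed.
Lemma Cdiffable_id z : Cdiffable (fun w => w) z.
Proof. eexists; apply Cderiv_id. Qed.
Lemma Cdiffable_comp f g z : Cdiffable g z -> Cdiffable f (g z) -> Cdiffable (fun w => f (g w)) z.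
Proof. intros [l Hl] [m Hm]. eexists; eapply Cderiv_comp; eassumption. Qed.
Lemma Cdiffable_pow f n z : Cdiffable f z -> Cdiffable (fun w => (f w ^ n)%C) z.
Proof.
  intros H. induction n; simpl; [apply Cdiffable_const|]. apply Cdiffable_mult; assumption.
Qed.

Lemma Cderiv_Re_real (f : C -> C) (t : R) (l : C) : Cderiv f (RtoC t) l ->
  is_derive (fun s : R => Re (f (RtoC s))) t (Re l).
Proof.
  intros H. apply is_derive_Reals. intros eps He.
  destruct (Cderiv_bound _ _ _ H (eps / 2) ltac:(lra)) as [d [Hd Hw]].
  exists (mkposreal d Hd). intros h Hh Hhd. simpl in Hhd.
  specialize (Hw (RtoC (t + h))).
  replace (RtoC (t + h) - RtoC t)%C with (RtoC h) in Hw by (rewrite RtoC_plus; ring).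
  rewrite Cmod_R in Hw. specialize (Hw Hhd).
  assert (Hp := Rabs_pos_lt h Hh).
  replace ((Re (f (t + h)) - Re (f t)) / h - Re l)
    with (Re (f (RtoC (t + h)) - f (RtoC t) - l * RtoC h)%C / h).
  - unfold Rdiv. rewrite Rabs_mult, Rabs_inv.
    apply (Rmult_lt_reg_r (Rabs h)); trivial.
    rewrite Rmult_assoc, Rinv_l, Rmult_1_r by lra.
    eapply Rle_lt_trans; [apply re_le_Cmod|]. eapply Rle_lt_trans; [exact Hw|]. nra.
  - unfold Re, Cminus, Cmult, Copp, Cplus, RtoC; simpl. field. exact Hh.
Qed.

Lemma Cderiv_Im_real (f : C -> C) (t : R) (l : C) : Cderiv f (RtoC t) l ->
  is_derive (fun s : R => Im (f (RtoC s))) t (Im l).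
Proof.
  intros H.
  assert (H' : Cderiv (fun w => (- Ci * f w)%C) (RtoC t) (RtoC 0 * f (RtoC t) + - Ci * l)%C)
    by (apply (Cderiv_mult (fun _ => (- Ci)%C)); [apply Cderiv_const | exact H]).
  apply Cderiv_Re_real in H'.
  replace (Im l) with (Re (RtoC 0 * f (RtoC t) + - Ci * l)%C)
    by (unfold Re, Im, Cmult, Copp, Cplus, RtoC, Ci; simpl; ring).
  eapply is_derive_ext; [|exact H'].
  intro s. unfold Re, Im, Cmult, Copp, Cplus, RtoC, Ci; simpl. ring.
Qed.

Lemma RtoC_neq_0 (x : R) : x <> 0 -> RtoC x <> RtoC 0.
Proof. intros H E. apply H. injection E; trivial. Qed.

(** * Bisection of rectangles *)

Lemma nested_intervals (u v : nat -> R) :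
  (forall n, u n <= u (S n)) -> (forall n, v (S n) <= v n) ->
  (forall n, u n <= v n) -> exists x, forall n, u n <= x <= v n.
Proof.
  intros Hu Hv Huv.
  assert (Mu : forall n k, u n <= u (n + k)%nat).
  { intros n k; induction k; [rewrite Nat.add_0_r; lra|].
    rewrite Nat.add_succ_r. generalize (Hu (n + k)%nat); lra. }
  assert (Mv : forall n k, v (n + k)%nat <= v n).
  { intros n k; induction k; [rewrite Nat.add_0_r; lra|].
    rewrite Nat.add_succ_r. generalize (Hv (n + k)%nat); lra. }
  assert (H : forall n m, u n <= v m).
  { intros n m. generalize (Mu n m) (Mv m n) (Huv (n + m)%nat).
    rewrite (Nat.add_comm m n). lra. }
  destruct (completeness (fun x => exists n, x = u n)) as [x [Hx1 Hx2]].
  - exists (v O). intros y [n ->]. apply H.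
  - exists (u O), O. reflexivity.
  - exists x. intros n. split.
    + apply Hx1. exists n; reflexivity.
    + apply Hx2. intros y [m ->]. apply H.
Qed.

Section Bisection.

Variable Phi : R -> R -> R -> R -> C.
Variables a b c d : R.
Hypothesis Hab : a < b.
Hypothesis Hcd : c < d.
Hypothesis add_x : forall x1 x2 x3 y1 y2, a <= x1 <= x2 -> x2 <= x3 <= b ->
  c <= y1 <= y2 -> y2 <= d -> Phi x1 x3 y1 y2 = (Phi x1 x2 y1 y2 + Phi x2 x3 y1 y2)%C.
Hypothesis add_y : forall x1 x2 y1 y2 y3, a <= x1 <= x2 -> x2 <= b ->
  c <= y1 <= y2 -> y2 <= y3 <= d -> Phi x1 x2 y1 y3 = (Phi x1 x2 y1 y2 + Phi x1 x2 y2 y3)%C.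
Hypothesis local_small : forall x y, a <= x <= b -> c <= y <= d ->
  forall eps, 0 < eps -> exists delta, 0 < delta /\
  forall x1 x2 y1 y2, a <= x1 <= x -> x <= x2 <= b -> c <= y1 <= y -> y <= y2 <= d ->
    x2 - x1 < delta -> y2 - y1 < delta ->
    Cmod (Phi x1 x2 y1 y2) <= eps * ((x2 - x1) + (y2 - y1)) ^ 2.

Let kappa := Cmod (Phi a b c d) / ((b - a) * (d - c)).

(** The ratio of modulus to area is at least that of the whole rectangle. If a heavy rectangle is
    cut in two, additivity and the triangle inequality leave at least one half heavy. *)
Let heavy x1 x2 y1 y2 := kappa * ((x2 - x1) * (y2 - y1)) <= Cmod (Phi x1 x2 y1 y2).

Definition half_x (q : (R * R) * (R * R)) : (R * R) * (R * R) :=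
  let '((x1, x2), (y1, y2)) := q in
  let m := (x1 + x2) / 2 in
  if Rle_dec (kappa * ((m - x1) * (y2 - y1))) (Cmod (Phi x1 m y1 y2))
  then ((x1, m), (y1, y2)) else ((m, x2), (y1, y2)).

Definition half_y (q : (R * R) * (R * R)) : (R * R) * (R * R) :=
  let '((x1, x2), (y1, y2)) := q in
  let m := (y1 + y2) / 2 in
  if Rle_dec (kappa * ((x2 - x1) * (m - y1))) (Cmod (Phi x1 x2 y1 m))
  then ((x1, x2), (y1, m)) else ((x1, x2), (m, y2)).

Fixpoint bisect (n : nat) : (R * R) * (R * R) :=
  match n with O => ((a, b), (c, d)) | S k => half_y (half_x (bisect k)) end.

Let good (q : (R * R) * (R * R)) (n : nat) :=
  let '((x1, x2), (y1, y2)) := q in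
  a <= x1 /\ x2 <= b /\ c <= y1 /\ y2 <= d /\
  x2 - x1 = (b - a) / 2 ^ n /\ y2 - y1 = (d - c) / 2 ^ n /\ heavy x1 x2 y1 y2.

Lemma bisect_step (q : (R * R) * (R * R)) (n : nat) : good q n ->
  good (half_y (half_x q)) (S n) /\
  fst (fst q) <= fst (fst (half_y (half_x q))) /\
  snd (fst (half_y (half_x q))) <= snd (fst q) /\
  fst (snd q) <= fst (snd (half_y (half_x q))) /\
  snd (snd (half_y (half_x q))) <= snd (snd q).
Proof.
  destruct q as [[x1 x2] [y1 y2]]. simpl. intros [H1 [H2 [H3 [H4 [H5 [H6 H7]]]]]].
  assert (Hp : 0 < 2 ^ n) by (apply pow_lt; lra).
  assert (Hx : 0 < x2 - x1) by (rewrite H5; apply Rdiv_lt_0_compat; lra).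
  assert (Hy : 0 < y2 - y1) by (rewrite H6; apply Rdiv_lt_0_compat; lra).
  assert (E5 : (x2 - x1) / 2 = (b - a) / (2 * 2 ^ n)) by (rewrite H5; field; lra).
  assert (E6 : (y2 - y1) / 2 = (d - c) / (2 * 2 ^ n)) by (rewrite H6; field; lra).
  assert (S1 : forall u1 u2, a <= u1 <= u2 -> u2 <= b -> heavy u1 u2 y1 y2 ->
     ~ heavy u1 u2 y1 ((y1 + y2) / 2) -> heavy u1 u2 ((y1 + y2) / 2) y2).
  { unfold heavy. intros u1 u2 Hu1 Hu2 G1 G2.
    rewrite (add_y u1 u2 y1 ((y1 + y2) / 2) y2) in G1 by lra.
    assert (T := Cmod_triangle (Phi u1 u2 y1 ((y1 + y2) / 2)) (Phi u1 u2 ((y1 + y2) / 2) y2)).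
    apply Rnot_le_lt in G2. nra. }
  assert (S2 : ~ heavy x1 ((x1 + x2) / 2) y1 y2 -> heavy ((x1 + x2) / 2) x2 y1 y2).
  { unfold heavy in *. intros G2.
    rewrite (add_x x1 ((x1 + x2) / 2) x2 y1 y2) in H7 by lra.
    assert (T := Cmod_triangle (Phi x1 ((x1 + x2) / 2) y1 y2) (Phi ((x1 + x2) / 2) x2 y1 y2)).
    apply Rnot_le_lt in G2. nra. }
  unfold heavy in *. unfold half_x.
  destruct (Rle_dec (kappa * (((x1 + x2) / 2 - x1) * (y2 - y1))) (Cmod (Phi x1 ((x1 + x2) / 2) y1 y2))) as [K|K].
  - unfold half_y; match goal with |- context [Rle_dec ?u ?v] => destruct (Rle_dec u v) as [K'|K'] end; simpl; repeat split; try lra; trivial.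
    apply S1; trivial; lra.
  - specialize (S2 K).
    unfold half_y; match goal with |- context [Rle_dec ?u ?v] => destruct (Rle_dec u v) as [K'|K'] end; simpl; repeat split; try lra; trivial.
    apply S1; trivial; lra.
Qed.

Lemma bisect_good (n : nat) : good (bisect n) n.
Proof.
  induction n.
  - simpl. unfold heavy, kappa. repeat split; try lra; try field.
    right. field. split; lra.
  - apply bisect_step, IHn.
Qed.

(** Goursat's argument for an additive rectangle function. Halving both sides keeps the shape, so
    area stays proportional to the square of the half-perimeter. Heavy nested rectangles then
    contradict [local_small] at their common point. *)
Lemma additive_rect_zero : Phi a b c d = RtoC 0.
Proof.
  apply Cmod_eq_0. apply Rle_antisym; [|apply Cmod_ge_0].
  apply Rnot_lt_le. intro Hpos.
  assert (Hk : 0 < kappa) by (unfold kappa; apply Rdiv_lt_0_compat; nra).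
  assert (G := bisect_good).
  assert (St := fun n => proj2 (bisect_step (bisect n) n (G n))).
  assert (Hpow : forall n, 0 < 2 ^ n) by (intro; apply pow_lt; lra).
  assert (Hin : forall n, fst (fst (bisect n)) <= snd (fst (bisect n)) /\
                          fst (snd (bisect n)) <= snd (snd (bisect n))).
  { intro n. generalize (G n). destruct (bisect n) as [[x1 x2] [y1 y2]]. simpl.
    intros [_ [_ [_ [_ [E1 [E2 _]]]]]].
    assert (0 < (b - a) / 2 ^ n) by (apply Rdiv_lt_0_compat; [lra | apply Hpow]).
    assert (0 < (d - c) / 2 ^ n) by (apply Rdiv_lt_0_compat; [lra | apply Hpow]).
    lra. }
  destruct (nested_intervals (fun n => fst (fst (bisect n))) (fun n => snd (fst (bisect n))))
    as [x Hx]; try (intro n; simpl; apply St); try (intro n; apply Hin).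
  destruct (nested_intervals (fun n => fst (snd (bisect n))) (fun n => snd (snd (bisect n))))
    as [y Hy]; try (intro n; simpl; apply St); try (intro n; apply Hin).
  set (L := (b - a) + (d - c)).
  assert (HL : 0 < L) by (unfold L; lra).
  (* With this epsilon, the local bound on the rectangle of step [n], of half-perimeter [L / 2 ^ n],
     is half of what heaviness demands. *)
  assert (He : 0 < kappa * ((b - a) * (d - c)) / (2 * L ^ 2)).
  { apply Rdiv_lt_0_compat; [|assert (0 < L ^ 2) by (apply pow_lt; lra); lra].
    apply Rmult_lt_0_compat; trivial. nra. }
  assert (H0 := Hx O). assert (H0' := Hy O). simpl in H0, H0'.
  destruct (local_small x y H0 H0' _ He) as [delta [Hd Hs]].
  destruct (Pow_x_infinity 2 ltac:(rewrite Rabs_right; lra) (L / delta + 1)) as [n Hn].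
  specialize (Hn n (le_n n)). rewrite Rabs_right in Hn by (apply Rle_ge, Rlt_le, Hpow).
  assert (Hpn := Hpow n).
  assert (Hl : L / 2 ^ n < delta).
  { apply Rlt_div_l; trivial. apply (Rmult_lt_reg_r (/ delta)); [apply Rinv_0_lt_compat; lra|].
    replace (delta * 2 ^ n * / delta) with (2 ^ n) by (field; lra).
    unfold Rdiv in Hn. lra. }
  specialize (Hx n). specialize (Hy n). specialize (G n).
  destruct (bisect n) as [[x1 x2] [y1 y2]]. simpl in Hx, Hy, G.
  destruct G as [G1 [G2 [G3 [G4 [G5 [G6 G7]]]]]].
  assert (A1 : 0 < (b - a) / 2 ^ n) by (apply Rdiv_lt_0_compat; lra).
  assert (A2 : 0 < (d - c) / 2 ^ n) by (apply Rdiv_lt_0_compat; lra).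
  assert (A3 : (x2 - x1) + (y2 - y1) = L / 2 ^ n) by (rewrite G5, G6; unfold L; field; lra).
  specialize (Hs x1 x2 y1 y2 ltac:(lra) ltac:(lra) ltac:(lra) ltac:(lra) ltac:(lra) ltac:(lra)).
  unfold heavy in G7. rewrite A3 in Hs. rewrite G5, G6 in G7.
  replace (kappa * ((b - a) * (d - c)) / (2 * L ^ 2) * (L / 2 ^ n) ^ 2)
    with (kappa * ((b - a) / 2 ^ n * ((d - c) / 2 ^ n)) / 2) in Hs by (field; lra).
  assert (0 < kappa * ((b - a) / 2 ^ n * ((d - c) / 2 ^ n))).
  { apply Rmult_lt_0_compat; trivial. apply Rmult_lt_0_compat; trivial. }
  lra.
Qed.

End Bisection.

(** * Cauchy's integral formula *)

Definition CInt (f : R -> C) (a b : R) : C := RInt (V := C_R_CompleteNormedModule) f a b.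
Notation ex_CInt := (ex_RInt (V := C_R_NormedModule)).
Notation is_CInt := (is_RInt (V := C_R_NormedModule)).
Notation Rcontinuous f x := (continuous (T := R_UniformSpace) (U := C_UniformSpace) f x).

Lemma ex_CInt_continuous (f : R -> C) a b : a <= b ->
  (forall x, a <= x <= b -> Rcontinuous f x) -> ex_CInt f a b.
Proof.
  intros Hab H. apply (ex_RInt_continuous (V := C_R_CompleteNormedModule)).
  rewrite Rmin_left, Rmax_right by trivial. exact H.
Qed.

Lemma CInt_correct f a b : ex_CInt f a b -> is_CInt f a b (CInt f a b).
Proof. apply (RInt_correct (V := C_R_CompleteNormedModule)). Qed.

Lemma is_CInt_unique f a b l : is_CInt f a b l -> CInt f a b = l.
Proof. apply (is_RInt_unique (V := C_R_CompleteNormedModule)). Qed.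

Lemma is_CInt_pair (f : R -> C) a b l1 l2 :
  is_RInt (fun t => Re (f t)) a b l1 -> is_RInt (fun t => Im (f t)) a b l2 ->
  is_CInt f a b (l1, l2).
Proof. apply (is_RInt_fct_extend_pair (U := R_NormedModule) (V := R_NormedModule)). Qed.

Lemma is_CInt_Re (f : R -> C) a b l : is_CInt f a b l ->
  is_RInt (fun t => Re (f t)) a b (Re l).
Proof. apply (is_RInt_fct_extend_fst (U := R_NormedModule) (V := R_NormedModule)). Qed.

Lemma is_CInt_Im (f : R -> C) a b l : is_CInt f a b l ->
  is_RInt (fun t => Im (f t)) a b (Im l).
Proof. apply (is_RInt_fct_extend_snd (U := R_NormedModule) (V := R_NormedModule)). Qed.

Lemma CInt_ext (f g : R -> C) a b : (forall x, f x = g x :> C) -> CInt f a b = CInt g a b.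
Proof. intro E. apply (RInt_ext (V := C_R_CompleteNormedModule)). intros; apply E. Qed.

Lemma CInt_ext_in (f g : R -> C) a b : a <= b -> (forall x, a <= x <= b -> f x = g x :> C) -> CInt f a b = CInt g a b.
Proof.
  intros Hab E. apply (RInt_ext (V := C_R_CompleteNormedModule)).
  rewrite Rmin_left, Rmax_right by trivial. intros; apply E; lra.
Qed.

Lemma CInt_plus (f g : R -> C) a b : ex_CInt f a b -> ex_CInt g a b ->
  CInt (fun x => (f x + g x)%C) a b = (CInt f a b + CInt g a b)%C.
Proof. apply (RInt_plus (V := C_R_CompleteNormedModule)). Qed.

Lemma CInt_minus (f g : R -> C) a b : ex_CInt f a b -> ex_CInt g a b ->
  CInt (fun x => (f x - g x)%C) a b = (CInt f a b - CInt g a b)%C.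
Proof. apply (RInt_minus (V := C_R_CompleteNormedModule)). Qed.

Lemma CInt_const (c : C) a b : CInt (fun _ => c) a b = (RtoC (b - a) * c)%C.
Proof.
  apply is_CInt_unique.
  replace (RtoC (b - a) * c)%C with (scal (V := C_R_NormedModule) (b - a) c).
  - apply (is_RInt_const (V := C_R_NormedModule)).
  - unfold scal; simpl. unfold prod_scal, scal; simpl. unfold mult; simpl.
    unfold Cmult, RtoC; simpl. f_equal; ring.
Qed.

(** The integral lives in C as a real normed space, where [c] is not a scalar; hence the passage
    through real and imaginary parts. *)
Lemma is_CInt_scal (c : C) (f : R -> C) a b (l : C) : is_CInt f a b l -> is_CInt (fun x => (c * f x)%C) a b (c * l)%C.
Proof.
  intros H. assert (H1 := is_CInt_Re _ _ _ _ H). assert (H2 := is_CInt_Im _ _ _ _ H).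
  apply is_CInt_pair.
  - apply (is_RInt_minus (V := R_NormedModule) (fun t => Re c * Re (f t)) (fun t => Im c * Im (f t)));
      apply (is_RInt_scal (V := R_NormedModule)); assumption.
  - apply (is_RInt_plus (V := R_NormedModule) (fun t => Re c * Im (f t)) (fun t => Im c * Re (f t)));
      apply (is_RInt_scal (V := R_NormedModule)); assumption.
Qed.

Lemma CInt_scal (c : C) (f : R -> C) a b : ex_CInt f a b ->
  CInt (fun x => (c * f x)%C) a b = (c * CInt f a b)%C.
Proof. intros H. apply is_CInt_unique, is_CInt_scal, CInt_correct, H. Qed.

Lemma CInt_conj (f : R -> C) a b : ex_CInt f a b ->
  CInt (fun x => Cconj (f x)) a b = Cconj (CInt f a b).
Proof.
  intros H. apply CInt_correct in H. apply is_CInt_unique, is_CInt_pair.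
  - apply (is_CInt_Re _ _ _ _ H).
  - apply (is_RInt_opp (V := R_NormedModule)), (is_CInt_Im _ _ _ _ H).
Qed.

Lemma Cmod_norm_R (z : C) : Cmod z = norm (V := C_R_NormedModule) z.
Proof.
  unfold Cmod. rewrite <- (pow2_abs (fst z)), <- (pow2_abs (snd z)). reflexivity.
Qed.

Lemma CInt_bound (f : R -> C) a b M : a <= b -> ex_CInt f a b ->
  (forall x, a <= x <= b -> Cmod (f x) <= M) -> Cmod (CInt f a b) <= (b - a) * M.
Proof.
  intros Hab Hf HM. rewrite Cmod_norm_R.
  apply (norm_RInt_le_const (V := C_R_NormedModule) f a b (CInt f a b) M Hab);
    [|apply CInt_correct, Hf].
  intros x Hx. rewrite <- Cmod_norm_R. apply HM, Hx.
Qed.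

Lemma CInt_Chasles (f : R -> C) a b c : ex_CInt f a b -> ex_CInt f b c ->
  (CInt f a b + CInt f b c)%C = CInt f a c.
Proof. apply (RInt_Chasles (V := C_R_CompleteNormedModule)). Qed.

Lemma Cmod_le_abs (z : C) : Cmod z <= Rabs (Re z) + Rabs (Im z).
Proof.
  unfold Cmod. apply Rsqr_incr_0_var.
  - rewrite Rsqr_sqrt by nra. unfold Re, Im, Rsqr.
    assert (H1 := Rabs_pos (fst z)). assert (H2 := Rabs_pos (snd z)).
    rewrite <- (pow2_abs (fst z)), <- (pow2_abs (snd z)). nra.
  - generalize (Rabs_pos (Re z)) (Rabs_pos (Im z)); lra.
Qed.

Lemma continuous_Rcomp (g : R -> C) (f : C -> C) (x : R) :
  Rcontinuous g x -> Ccontinuous f (g x) -> Rcontinuous (fun t => f (g t)) x.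
Proof. apply (continuous_comp (U := R_UniformSpace) (V := C_UniformSpace) (W := C_UniformSpace)). Qed.

(** * The circle and its contraction to an interior point *)

Definition circ (r th : R) : C := (r * cos th, r * sin th).

Lemma Cmod_circ r th : 0 <= r -> Cmod (circ r th) = r.
Proof.
  intros Hr. unfold Cmod, circ; simpl.
  replace (_ + _) with (r * r) by (assert (E := sin2_cos2 th); unfold Rsqr in E; nra).
  apply sqrt_square, Hr.
Qed.

Lemma continuous_circ r th : Rcontinuous (circ r) th.
Proof.
  apply continuous_pair; apply continuous_Rmult;
    [apply continuous_const | apply continuous_cos | apply continuous_const | apply continuous_sin].
Qed.

Lemma lipschitz_of_derive_bound (f df : R -> R) : (forall x, is_derive f x (df x)) ->
  (forall x, Rabs (df x) <= 1) -> forall x y, Rabs (f y - f x) <= Rabs (y - x).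
Proof.
  intros Hd Hb x y.
  destruct (MVT_gen f x y df) as [c [_ E]].
  - intros; apply Hd.
  - intros z _. apply continuity_pt_filterlim, (ex_derive_continuous (V := R_NormedModule)).
    exists (df z); apply Hd.
  - rewrite E, Rabs_mult. generalize (Hb c) (Rabs_pos (y - x)). nra.
Qed.

Lemma circ_lipschitz r x y : 0 <= r -> Cmod (circ r y - circ r x)%C <= 2 * r * Rabs (y - x).
Proof.
  intros Hr. eapply Rle_trans; [apply Cmod_le_abs|].
  unfold circ, Re, Im; simpl.
  replace (r * cos y + - (r * cos x)) with (r * (cos y - cos x)) by ring.
  replace (r * sin y + - (r * sin x)) with (r * (sin y - sin x)) by ring.
  rewrite !Rabs_mult, (Rabs_right r) by lra.
  assert (H1 : Rabs (cos y - cos x) <= Rabs (y - x)).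
  { apply (lipschitz_of_derive_bound cos (fun t => - sin t)).
    - intro t. auto_derive; trivial; ring.
    - intro t. rewrite Rabs_Ropp. apply Rabs_le. apply SIN_bound. }
  assert (H2 : Rabs (sin y - sin x) <= Rabs (y - x)).
  { apply (lipschitz_of_derive_bound sin cos).
    - intro t. auto_derive; trivial; ring.
    - intro t. apply Rabs_le. apply COS_bound. }
  nra.
Qed.

Lemma CInt_circ r th1 th2 : CInt (circ r) th1 th2 = (- Ci * (circ r th2 - circ r th1))%C.
Proof.
  apply is_CInt_unique.
  replace (- Ci * (circ r th2 - circ r th1))%C
    with ((r * sin th2 - r * sin th1, - (r * cos th2) - - (r * cos th1)) : C)
    by (unfold circ, Ci, Cmult, Cminus, Cplus, Copp; simpl; f_equal; ring).
  apply is_CInt_pair.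
  - apply (is_RInt_derive (V := R_CompleteNormedModule) (fun t => r * sin t) (fun t => r * cos t)).
    + intros; auto_derive; trivial; ring.
    + intros. apply continuous_Rmult; [apply continuous_const | apply continuous_cos].
  - apply (is_RInt_derive (V := R_CompleteNormedModule) (fun t => - (r * cos t)) (fun t => r * sin t)).
    + intros; auto_derive; trivial; ring.
    + intros. apply continuous_Rmult; [apply continuous_const | apply continuous_sin].
Qed.

Lemma Ci2 : (Ci * Ci)%C = RtoC (-1).
Proof. unfold Ci, Cmult, RtoC; simpl. f_equal; ring. Qed.

Section Cauchy.

Variables (a : C) (r : R).
Hypothesis Ha : Cmod a < r.

Let v th := (circ r th - a)%C.
(** For [z = a + t * v th] one has [dz / (z - a) = dt / t + i * k th * dth]: the angular part does
    not depend on [t]. *)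
Let k th := (circ r th / v th)%C.
Let H t th := (a + RtoC t * v th)%C.

Let Hr : 0 < r.
Proof. generalize (Cmod_ge_0 a); lra. Qed.

Lemma Cmod_circ_minus_ge th : r - Cmod a <= Cmod (circ r th - a)%C.
Proof.
  assert (T := Cmod_triangle (circ r th - a) a).
  replace (circ r th - a + a)%C with (circ r th) in T by ring.
  rewrite Cmod_circ in T; lra.
Qed.

Lemma circ_minus_neq_0 th : (circ r th - a)%C <> RtoC 0.
Proof.
  intro E. assert (T := Cmod_circ_minus_ge th). rewrite E, Cmod_0 in T. lra.
Qed.

Lemma Cmod_circ_minus_le th : Cmod (circ r th - a)%C <= 2 * r.
Proof.
  eapply Rle_trans; [apply Cmod_triangle|]. rewrite Cmod_opp, Cmod_circ; lra.
Qed.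

Let k_bound th : Cmod (k th) <= r / (r - Cmod a).
Proof.
  unfold k, v. rewrite Cmod_div by apply circ_minus_neq_0. rewrite Cmod_circ by lra.
  apply Rmult_le_compat_l; [lra|]. apply Rinv_le_contravar; [lra | apply Cmod_circ_minus_ge].
Qed.

Let k_cont th : Rcontinuous k th.
Proof.
  apply continuous_Cmult; [apply continuous_circ|].
  apply continuous_Cinv; [|apply circ_minus_neq_0].
  apply continuous_Cminus; [apply continuous_circ | apply continuous_const].
Qed.

Let H_in t th : 0 <= t <= 1 -> Cmod (H t th) <= r.
Proof.
  intros Ht. unfold H, v.
  replace (a + RtoC t * (circ r th - a))%C with (RtoC (1 - t) * a + RtoC t * circ r th)%C
    by (rewrite RtoC_minus; ring).
  eapply Rle_trans; [apply Cmod_triangle|]. rewrite !Cmod_mult, !Cmod_R, Cmod_circ by lra.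
  rewrite !Rabs_right by lra. nra.
Qed.

Let H_cont_t t th : Rcontinuous (fun t => H t th) t.
Proof.
  apply continuous_Cplus; [apply continuous_const|].
  apply continuous_Cmult; [|apply continuous_const].
  apply continuous_RtoC, continuous_id.
Qed.

Let H_cont_th t th : Rcontinuous (fun th => H t th) th.
Proof.
  apply continuous_Cplus; [apply continuous_const|].
  apply continuous_Cmult; [apply continuous_const|].
  apply continuous_Cminus; [apply continuous_circ | apply continuous_const].
Qed.

Let H_lip t th t' th' : 0 <= t <= 1 ->
  Cmod (H t' th' - H t th)%C <= 2 * r * (Rabs (t' - t) + Rabs (th' - th)).
Proof.
  intros Ht. unfold H.
  replace (a + RtoC t' * v th' - (a + RtoC t * v th))%C
    with (RtoC (t' - t) * v th' + RtoC t * (circ r th' - circ r th))%C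
    by (unfold v; rewrite RtoC_minus; ring).
  eapply Rle_trans; [apply Cmod_triangle|]. rewrite !Cmod_mult, !Cmod_R.
  rewrite (Rabs_right t) by lra.
  assert (T1 := Cmod_circ_minus_le th'). fold (v th') in T1.
  assert (T2 := circ_lipschitz r th th' ltac:(lra)).
  generalize (Rabs_pos (t' - t)) (Rabs_pos (th' - th)) (Cmod_ge_0 (circ r th' - circ r th)); nra.
Qed.

(* The integral of [f z dz / (z - a)] along the boundary of the image of
   [[t1,t2] x [th1,th2]] under [H], which contracts the circle to [a]. *)
Let Phi (f : C -> C) t1 t2 th1 th2 :=
  (CInt (fun t => (f (H t th1) - f (H t th2)) / RtoC t) t1 t2
   + Ci * CInt (fun th => (f (H t2 th) - f (H t1 th)) * k th) th1 th2)%C.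

Definition ccont_on (f : C -> C) := forall z, Cmod z <= r -> Ccontinuous f z.

Let int1 f t1 t2 th1 th2 : ccont_on f -> 0 < t1 -> t1 <= t2 -> t2 <= 1 ->
  ex_CInt (fun t => ((f (H t th1) - f (H t th2)) / RtoC t)%C) t1 t2.
Proof.
  intros Hf H1 H2 H3. apply ex_CInt_continuous; trivial. intros t Ht.
  apply continuous_Cmult.
  - apply continuous_Cminus;
      [apply (continuous_Rcomp (fun t => H t th1)) | apply (continuous_Rcomp (fun t => H t th2))];
      [apply H_cont_t | apply Hf, H_in; lra | apply H_cont_t | apply Hf, H_in; lra].
  - apply continuous_Cinv; [apply continuous_RtoC, continuous_id|].
    apply RtoC_neq_0; lra.
Qed.

Let int2 f t1 t2 th1 th2 : ccont_on f -> 0 <= t1 <= 1 -> 0 <= t2 <= 1 -> th1 <= th2 ->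
  ex_CInt (fun th => ((f (H t2 th) - f (H t1 th)) * k th)%C) th1 th2.
Proof.
  intros Hf H1 H2 H3. apply ex_CInt_continuous; trivial. intros t Ht.
  apply continuous_Cmult; [|apply k_cont].
  apply continuous_Cminus;
    [apply (continuous_Rcomp (fun th => H t2 th)) | apply (continuous_Rcomp (fun th => H t1 th))];
    [apply H_cont_th | apply Hf, H_in; lra | apply H_cont_th | apply Hf, H_in; lra].
Qed.

Let Phi_plus f g t1 t2 th1 th2 : ccont_on f -> ccont_on g -> 0 < t1 -> t1 <= t2 -> t2 <= 1 ->
  th1 <= th2 ->
  Phi (fun z => (f z + g z)%C) t1 t2 th1 th2 = (Phi f t1 t2 th1 th2 + Phi g t1 t2 th1 th2)%C.
Proof.
  intros Hf Hg H1 H2 H3 H4. unfold Phi.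
  rewrite (CInt_ext (fun t => ((f (H t th1) + g (H t th1) - (f (H t th2) + g (H t th2))) / RtoC t)%C)
     (fun t => ((f (H t th1) - f (H t th2)) / RtoC t + (g (H t th1) - g (H t th2)) / RtoC t)%C))
    by (intros; unfold Cdiv; ring).
  rewrite (CInt_ext (fun th => ((f (H t2 th) + g (H t2 th) - (f (H t1 th) + g (H t1 th))) * k th)%C)
     (fun th => ((f (H t2 th) - f (H t1 th)) * k th + (g (H t2 th) - g (H t1 th)) * k th)%C))
    by (intros; ring).
  assert (I1 := fun u Hu => int1 u t1 t2 th1 th2 Hu H1 H2 H3).
  assert (I2 := fun u Hu => int2 u t1 t2 th1 th2 Hu ltac:(lra) ltac:(lra) H4).
  rewrite (CInt_plus _ _ t1 t2 (I1 f Hf) (I1 g Hg)), (CInt_plus _ _ th1 th2 (I2 f Hf) (I2 g Hg)).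
  ring.
Qed.

(** Differences of an affine function along [H] contain the factors [t] or [v th], which cancel the
    singular denominators. The two explicit integrals then cancel because [Ci * Ci = -1]. This
    permits subtracting the tangent map of [f] in [Phi_zero]. *)
Let Phi_affine al be t1 t2 th1 th2 : 0 < t1 -> t1 <= t2 -> t2 <= 1 -> th1 <= th2 ->
  Phi (fun z => (al + be * z)%C) t1 t2 th1 th2 = RtoC 0.
Proof.
  intros H1 H2 H3 H4. unfold Phi.
  rewrite (CInt_ext_in _ (fun t => (be * (v th1 - v th2))%C) t1 t2); trivial.
  2:{ intros t Ht. unfold H. field. apply RtoC_neq_0; lra. }
  rewrite (CInt_ext _ (fun th => (be * RtoC (t2 - t1) * circ r th)%C) th1 th2).
  2:{ intros th. unfold H, k. rewrite RtoC_minus. field. apply circ_minus_neq_0. }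
  rewrite CInt_const, CInt_scal by (apply ex_CInt_continuous; trivial; intros; apply continuous_circ).
  rewrite CInt_circ. unfold v.
  transitivity (RtoC (t2 - t1) * be * (circ r th1 - circ r th2) * (1 + Ci * Ci))%C; [ring|].
  rewrite Ci2. ring.
Qed.

Let Phi_bound f t1 t2 th1 th2 M : ccont_on f -> 0 < t1 -> t1 <= t2 -> t2 <= 1 -> th1 <= th2 -> 0 <= M ->
  (forall t th, t1 <= t <= t2 -> th1 <= th <= th2 -> Cmod (f (H t th)) <= M) ->
  Cmod (Phi f t1 t2 th1 th2) <= (2 / t1 * M) * (t2 - t1) + 2 * (r / (r - Cmod a)) * M * (th2 - th1).
Proof.
  intros Hf H1 H2 H3 H4 HM0 HM. unfold Phi.
  eapply Rle_trans; [apply Cmod_triangle|]. rewrite Cmod_mult, Cmod_Ci, Rmult_1_l.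
  apply Rplus_le_compat.
  - rewrite Rmult_comm. apply CInt_bound; trivial. now apply int1.
    intros t Ht. rewrite Cmod_div by (apply RtoC_neq_0; lra).
    rewrite Cmod_R, Rabs_right by lra.
    apply Rle_trans with (2 * M / t).
    + apply Rmult_le_compat_r; [apply Rlt_le, Rinv_0_lt_compat; lra|].
      eapply Rle_trans; [apply Cmod_triangle|]. rewrite Cmod_opp.
      generalize (HM t th1 Ht ltac:(lra)) (HM t th2 Ht ltac:(lra)). lra.
    + unfold Rdiv. assert (/ t <= / t1) by (apply Rinv_le_contravar; lra).
      assert (0 < / t) by (apply Rinv_0_lt_compat; lra). nra.
  - rewrite (Rmult_comm _ (th2 - th1)). apply CInt_bound; trivial. apply int2; trivial; lra.
    intros th Hth. rewrite Cmod_mult.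
    assert (T : Cmod (f (H t2 th) - f (H t1 th)) <= 2 * M).
    { eapply Rle_trans; [apply Cmod_triangle|]. rewrite Cmod_opp.
      generalize (HM t1 th ltac:(lra) Hth) (HM t2 th ltac:(lra) Hth). lra. }
    assert (T2 := k_bound th).
    generalize (Cmod_ge_0 (k th)) (Cmod_ge_0 (f (H t2 th) - f (H t1 th))). nra.
Qed.

Variable f : C -> C.
Hypothesis Hf : forall z, Cmod z <= r -> Cdiffable f z.

Let fcont : ccont_on f.
Proof. intros z Hz. apply Cdiffable_continuous, Hf, Hz. Qed.

(** Near a parameter point, replace [f] by its remainder [rho] after the tangent map. On a rectangle
    of half-perimeter [s] the remainder is a small multiple of [s], and integrating over sides of
    length at most [s] gives the quadratic smallness required by the bisection. The cut at [t0]
    keeps [dt / t] bounded. *)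
Let Phi_zero t0 : 0 < t0 -> t0 < 1 -> Phi f t0 1 0 (2 * PI) = RtoC 0.
Proof.
  intros Ht0 Ht1. apply additive_rect_zero; trivial.
  - generalize PI_RGT_0; lra.
  - intros t1 t2 t3 th1 th2 A1 A2 A3 A4. unfold Phi.
    rewrite <- (CInt_Chasles _ t1 t2 t3) by (apply int1; trivial; lra).
    rewrite (CInt_ext (fun th => ((f (H t3 th) - f (H t1 th)) * k th)%C)
      (fun th => ((f (H t2 th) - f (H t1 th)) * k th + (f (H t3 th) - f (H t2 th)) * k th)%C))
      by (intros; ring).
    rewrite CInt_plus by (apply int2; trivial; lra). ring.
  - intros t1 t2 th1 th2 th3 A1 A2 A3 A4. unfold Phi.
    rewrite <- (CInt_Chasles _ th1 th2 th3) by (apply int2; trivial; lra).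
    rewrite (CInt_ext (fun t => ((f (H t th1) - f (H t th3)) / RtoC t)%C)
      (fun t => ((f (H t th1) - f (H t th2)) / RtoC t + (f (H t th2) - f (H t th3)) / RtoC t)%C))
      by (intros; unfold Cdiv; ring).
    rewrite CInt_plus by (apply int1; trivial; lra). ring.
  - intros t th A1 A2 eps Heps.
    set (p := H t th).
    destruct (Hf p ltac:(apply H_in; lra)) as [l Hl].
    (* [K] dominates the sum of both coefficients of [Phi_bound] on every rectangle with
       [t >= t0]. *)
    set (K := 2 / t0 + 2 * (r / (r - Cmod a))).
    assert (Hq : 0 < r / (r - Cmod a)) by (apply Rdiv_lt_0_compat; lra).
    assert (Hq2 : 0 < 2 / t0) by (apply Rdiv_lt_0_compat; lra).
    assert (HK : 0 < K) by (unfold K; lra).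
    destruct (Cderiv_bound _ _ _ Hl (eps / (2 * r * K))) as [d [Hd Hb]].
    { apply Rdiv_lt_0_compat; trivial. apply Rmult_lt_0_compat; lra. }
    (* Sides shorter than this give [2 * r * s < d], so by [H_lip] the image of the rectangle stays
       within [d] of [p]. *)
    exists (d / (4 * r)). split; [apply Rdiv_lt_0_compat; lra|].
    intros x1 x2 y1 y2 B1 B2 B3 B4 B5 B6.
    set (rho := (fun z => f z - f p - l * (z - p))%C).
    set (s := x2 - x1 + (y2 - y1)).
    assert (Hs : 2 * r * s < d).
    { unfold s. assert (E : 2 * r * (d / (4 * r) + d / (4 * r)) = d) by (field; lra). nra. }
    assert (Crho : ccont_on rho).
    { intros z Hz. apply continuous_Cminus.
      - apply continuous_Cminus; [apply fcont, Hz | apply continuous_const].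
      - apply continuous_Cmult; [apply continuous_const|].
        apply continuous_Cminus; [apply continuous_id | apply continuous_const]. }
    assert (E : Phi f x1 x2 y1 y2 = Phi rho x1 x2 y1 y2).
    { transitivity (Phi (fun z => (rho z + ((f p - l * p) + l * z))%C) x1 x2 y1 y2).
      - unfold Phi. f_equal; [|f_equal]; apply CInt_ext; intros; unfold rho; f_equal; ring.
      - rewrite Phi_plus; try lra; trivial.
        + rewrite Phi_affine by lra. ring.
        + intros z _. apply continuous_Cplus; [apply continuous_const|].
          apply continuous_Cmult; [apply continuous_const | apply continuous_id]. }
    rewrite E.
    assert (Hs0 : 0 <= s) by (unfold s; lra).
    assert (HM : forall t' th', x1 <= t' <= x2 -> y1 <= th' <= y2 -> Cmod (rho (H t' th')) <= eps / K * s).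
    { intros t' th' C1 C2.
      assert (L : Cmod (H t' th' - p)%C <= 2 * r * s).
      { eapply Rle_trans; [apply H_lip; lra|]. apply Rmult_le_compat_l; [lra|].
        unfold s. apply Rplus_le_compat; apply Rabs_le; lra. }
      eapply Rle_trans; [apply Hb; lra|].
      apply Rle_trans with (eps / (2 * r * K) * (2 * r * s)).
      - apply Rmult_le_compat_l; trivial. apply Rlt_le, Rdiv_lt_0_compat; trivial.
        apply Rmult_lt_0_compat; lra.
      - right. field. lra. }
    assert (He : 0 < eps / K) by (apply Rdiv_lt_0_compat; lra).
    assert (HM0 : 0 <= eps / K * s) by nra.
    eapply Rle_trans; [apply (Phi_bound rho x1 x2 y1 y2 _ Crho ltac:(lra) ltac:(lra) ltac:(lra) ltac:(lra) HM0 HM)|].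
    assert (Hi : 2 / x1 <= 2 / t0).
    { apply Rmult_le_compat_l; [lra|]. apply Rinv_le_contravar; lra. }
    apply Rle_trans with (K * (eps / K * s) * s).
    + set (M := eps / K * s) in *. unfold K.
      assert (0 <= 2 / x1) by (apply Rlt_le, Rdiv_lt_0_compat; lra).
      assert (W1 : 2 / x1 * M * (x2 - x1) <= 2 / t0 * M * s).
      { apply Rmult_le_compat; try nra. unfold s; lra. }
      assert (W2 : 2 * (r / (r - Cmod a)) * M * (y2 - y1) <= 2 * (r / (r - Cmod a)) * M * s).
      { apply Rmult_le_compat_l; [nra|]. unfold s; lra. }
      lra.
    + right. field. lra.
Qed.

Lemma ex_CInt_cauchy (g : C -> C) : ccont_on g ->
  ex_CInt (fun th => (g (circ r th) * (circ r th / (circ r th - a)))%C) 0 (2 * PI).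
Proof.
  intros Hg. apply ex_CInt_continuous; [generalize PI_RGT_0; lra|]. intros th _.
  apply continuous_Cmult; [|apply k_cont].
  apply (continuous_Rcomp (circ r) g).
  - apply continuous_circ.
  - apply Hg. rewrite Cmod_circ; lra.
Qed.

(** Vanishing of [Phi] on the full strip equates the integral over the circle with the one over its
    contraction [H t0], taken with the same kernel [k]. Continuity of [f] at [a] then replaces
    [f (H t0 th)] by [f a] as [t0] becomes small. *)
Lemma cauchy_formula_unnormalized :
  CInt (fun th => (f (circ r th) * (circ r th / (circ r th - a)))%C) 0 (2 * PI)
  = (f a * CInt (fun th => (circ r th / (circ r th - a))%C) 0 (2 * PI))%C.
Proof.
  assert (HPI := PI_RGT_0).
  assert (Hk : ex_CInt k 0 (2 * PI)) by (apply ex_CInt_continuous; [lra | intros; apply k_cont]).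
  rewrite <- CInt_scal by exact Hk.
  apply Cminus_eq_0, Cmod_eq_0, Rle_antisym; [|apply Cmod_ge_0].
  apply le_epsilon. intros eps Heps. rewrite Rplus_0_l.
  assert (Hq : 0 < r / (r - Cmod a)) by (apply Rdiv_lt_0_compat; lra).
  destruct (proj1 (Ccontinuous_iff _ _) (fcont a ltac:(lra)) (eps / (2 * PI * (r / (r - Cmod a))))) as [d [Hd Hw]].
  { apply Rdiv_lt_0_compat; trivial. apply Rmult_lt_0_compat; lra. }
  (* Since [v] has modulus at most [2 * r], the contracted curve lies within [d / 2] of [a]. *)
  set (t0 := Rmin (1 / 2) (d / (4 * r))).
  assert (Hdr : 0 < d / (4 * r)) by (apply Rdiv_lt_0_compat; lra).
  assert (Ht0 : 0 < t0) by (apply Rmin_pos; lra).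
  assert (Ht1 : t0 <= 1 / 2) by apply Rmin_l.
  assert (Ht2 : t0 <= d / (4 * r)) by apply Rmin_r.
  assert (Z := Phi_zero t0 Ht0 ltac:(lra)). unfold Phi in Z.
  (* The sides at angles 0 and [2 * PI] have the same image, so the radial integrand vanishes. *)
  rewrite (CInt_ext _ (fun _ => RtoC 0) t0 1) in Z.
  2:{ intro t. unfold H, v, circ. rewrite cos_0, sin_0, cos_2PI, sin_2PI. unfold Cdiv. ring. }
  rewrite CInt_const in Z.
  assert (Z' : CInt (fun th => ((f (H 1 th) - f (H t0 th)) * k th)%C) 0 (2 * PI) = RtoC 0).
  { match goal with |- ?x = _ => set (J := x) end. fold J in Z.
    transitivity (- (Ci * Ci) * J)%C.
    - rewrite Ci2. ring.
    - transitivity (- Ci * (RtoC (1 - t0) * 0 + Ci * J))%C; [ring|]. rewrite Z. ring. }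
  assert (E1 : ex_CInt (fun th => (f (H t0 th) * k th)%C) 0 (2 * PI)).
  { apply ex_CInt_continuous; [lra|]. intros th _. apply continuous_Cmult; [|apply k_cont].
    apply (continuous_Rcomp (fun th => H t0 th) f).
    - apply H_cont_th.
    - apply fcont, H_in; lra. }
  assert (E2 : ex_CInt (fun th => (f a * k th)%C) 0 (2 * PI)).
  { eexists. apply is_CInt_scal, CInt_correct, Hk. }
  rewrite (CInt_ext _ (fun th => (f (circ r th) * k th - f (H t0 th) * k th)%C)) in Z'.
  2:{ intro th. unfold H at 1, v. replace (a + RtoC 1 * (circ r th - a))%C with (circ r th) by ring. ring. }
  rewrite CInt_minus in Z' by (trivial; apply (ex_CInt_cauchy f fcont)).
  apply Cminus_eq_0 in Z'. unfold k in Z' at 1. unfold v in Z'. rewrite Z'.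
  fold v. change (Cmod (CInt (fun th => (f (H t0 th) * k th)%C) 0 (2 * PI) - CInt (fun th => (f a * k th)%C) 0 (2 * PI))%C <= eps).
  rewrite <- CInt_minus by trivial.
  replace eps with ((2 * PI - 0) * (eps / (2 * PI * (r / (r - Cmod a))) * (r / (r - Cmod a)))) by (field; repeat split; lra).
  apply CInt_bound; [lra| |].
  - eexists. apply (is_RInt_minus (V := C_R_NormedModule)); apply CInt_correct; assumption.
  - intros th _. replace (f (H t0 th) * k th - f a * k th)%C with ((f (H t0 th) - f a) * k th)%C by ring.
    rewrite Cmod_mult. apply Rmult_le_compat; try apply Cmod_ge_0; [|apply k_bound].
    apply Rlt_le, Hw. unfold H. replace (a + RtoC t0 * v th - a)%C with (RtoC t0 * v th)%C by ring.
    rewrite Cmod_mult, Cmod_R, Rabs_right by lra.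
    assert (T := Cmod_circ_minus_le th). fold (v th) in T.
    assert (t0 * (2 * r) <= d / 2).
    { apply Rle_trans with (d / (4 * r) * (2 * r)); [nra | right; field; lra]. }
    nra.
Qed.

End Cauchy.

Lemma Cmult_conj_Cmod (z : C) : (z * Cconj z)%C = RtoC (Cmod z ^ 2).
Proof. rewrite <- Cmod2_conj. rewrite RtoC_pow. reflexivity. Qed.

(* On the circle, the conjugate of the kernel is [1 / (1 - conj a * z / r ^ 2)],
   which is holomorphic in [z]: apply the formula above to it with [a = 0]. *)
Lemma CInt_cauchy_kernel (a : C) (r : R) : Cmod a < r ->
  CInt (fun th => (circ r th / (circ r th - a))%C) 0 (2 * PI) = RtoC (2 * PI).
Proof.
  intros Ha. assert (H0 := Cmod_ge_0 a). assert (Hr : 0 < r) by lra.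
  set (h := fun z : C => (1 / (1 - Cconj a * z / RtoC (r ^ 2)))%C).
  assert (Hr2 : RtoC (r ^ 2) <> RtoC 0) by (apply RtoC_neq_0; nra).
  assert (Hn : forall z, Cmod z <= r -> (1 - Cconj a * z / RtoC (r ^ 2))%C <> RtoC 0).
  { intros z Hz E. apply Cminus_eq_0 in E. apply (f_equal Cmod) in E.
    rewrite Cmod_1, Cmod_div, Cmod_mult, Cmod_conj, Cmod_R, Rabs_right in E by (trivial; nra).
    assert (Cmod a * Cmod z / r ^ 2 < 1).
    { apply Rlt_div_l; [nra|]. generalize (Cmod_ge_0 z). nra. }
    lra. }
  assert (Hd : forall z, Cmod z <= r -> Cdiffable h z).
  { intros z Hz. apply Cdiffable_div; [apply Cdiffable_const | | apply Hn, Hz].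
    apply Cdiffable_minus; [apply Cdiffable_const|].
    apply Cdiffable_div; [|apply Cdiffable_const|trivial].
    apply Cdiffable_mult; [apply Cdiffable_const | apply Cdiffable_id]. }
  assert (F := cauchy_formula_unnormalized (RtoC 0) r ltac:(rewrite Cmod_0; lra) h Hd).
  assert (Hc : forall th, circ r th <> RtoC 0).
  { intros th E. apply (f_equal Cmod) in E. rewrite Cmod_circ, Cmod_0 in E; lra. }
  assert (Hex : ex_CInt (fun th => (circ r th / (circ r th - a))%C) 0 (2 * PI)).
  { eapply ex_RInt_ext; [|apply (ex_CInt_cauchy a r Ha (fun _ => RtoC 1))].
    - intros; apply Cmult_1_l.
    - intros z _. apply continuous_const. }
  rewrite <- (Cconj_conj (CInt _ _ _)). rewrite <- CInt_conj by trivial.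
  rewrite (CInt_ext _ (fun th => (h (circ r th) * (circ r th / (circ r th - 0)))%C)).
  - rewrite F. rewrite (CInt_ext _ (fun _ => RtoC 1)).
    + rewrite CInt_const. unfold h. replace (1 - Cconj a * 0 / RtoC (r ^ 2))%C with (RtoC 1) by (field; trivial).
      replace (1 / 1 * (RtoC (2 * PI - 0) * 1))%C with (RtoC (2 * PI)).
      * unfold Cconj, RtoC; simpl. f_equal; ring.
      * rewrite Rminus_0_r. field.
    + intro th. replace (circ r th - 0)%C with (circ r th) by ring. apply Cinv_r, Hc.
  - intro th. specialize (Hc th).
    assert (Hm := circ_minus_neq_0 a r Ha th).
    rewrite Cdiv_conj by trivial. rewrite Cminus_conj. unfold h.
    assert (E : RtoC (r ^ 2) = (circ r th * Cconj (circ r th))%C).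
    { rewrite Cmult_conj_Cmod, Cmod_circ by lra. reflexivity. }
    assert (Hm' : (Cconj (circ r th) - Cconj a)%C <> RtoC 0).
    { rewrite <- Cminus_conj. intro E'. apply (f_equal Cconj) in E'. rewrite Cconj_conj in E'.
      apply Hm. rewrite E'. unfold Cconj, RtoC; simpl. f_equal; ring. }
    assert (Hc' : Cconj (circ r th) <> RtoC 0).
    { intro E'. apply Hr2. rewrite E, E'. ring. }
    rewrite E. field. repeat split; trivial.
Qed.

Lemma cauchy_formula (f : C -> C) (a : C) (r : R) : Cmod a < r ->
  (forall z, Cmod z <= r -> Cdiffable f z) ->
  CInt (fun th => (f (circ r th) * (circ r th / (circ r th - a)))%C) 0 (2 * PI)
  = (RtoC (2 * PI) * f a)%C.
Proof.
  intros Ha Hf. rewrite cauchy_formula_unnormalized by trivial.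
  rewrite CInt_cauchy_kernel by trivial. ring.
Qed.

(** * Removable singularities and the Schwarz lemma *)

Definition hol (f : C -> C) : Prop := forall z, Cmod z < 1 -> Cdiffable f z.

Lemma hol_continuous f z : hol f -> Cmod z < 1 -> Ccontinuous f z.
Proof. intros H Hz. apply Cdiffable_continuous, H, Hz. Qed.

(** * Cauchy transforms and regularity of derivatives *)

Definition cauchy_transform (u : R -> C) (r : R) (b : C) : C :=
  CInt (fun th => (u th / (circ r th - b))%C) 0 (2 * PI).

Lemma two_PI_pos : 0 < 2 * PI.
Proof. generalize PI_RGT_0; lra. Qed.

Lemma continuous_circ_minus r b th : Rcontinuous (fun th => (circ r th - b)%C) th.
Proof. apply continuous_Cminus; [apply continuous_circ | apply continuous_const]. Qed.

Lemma ex_cauchy_transform u r b : (forall th, Rcontinuous u th) -> Cmod b < r ->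
  ex_CInt (fun th => (u th / (circ r th - b))%C) 0 (2 * PI).
Proof.
  intros Hu Hb. apply ex_CInt_continuous; [generalize two_PI_pos; lra|]. intros th _.
  apply continuous_Cmult; [apply Hu|].
  apply continuous_Cinv; [apply continuous_circ_minus | apply circ_minus_neq_0, Hb].
Qed.

Definition cauchy_transform_deriv (u : R -> C) (r : R) (b : C) : C :=
  CInt (fun th => (u th / ((circ r th - b) * (circ r th - b)))%C) 0 (2 * PI).

(** Differentiation under the integral sign with an explicit quadratic remainder. That [K] is
    uniform in [a] and [b] is what yields a Lipschitz derivative in [derivative_lipschitz]. *)
Lemma cauchy_transform_remainder u r rho M :
  (forall th, Rcontinuous u th) -> (forall th, Cmod (u th) <= M) -> rho < r ->
  exists K, 0 < K /\ forall a b, Cmod a <= rho -> Cmod b <= rho ->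
  Cmod (cauchy_transform u r b - cauchy_transform u r a
        - cauchy_transform_deriv u r a * (b - a)) <= K * Cmod (b - a) ^ 2.
Proof.
  intros Hu HM Hr. assert (HM0 := Rle_trans _ _ _ (Cmod_ge_0 _) (HM 0)).
  assert (Hpi := two_PI_pos).
  assert (Hk : 0 < / (r - rho) ^ 3) by (apply Rinv_0_lt_compat, pow_lt; lra).
  (* [M + 1] instead of [M] keeps the constant positive when [M = 0]. *)
  exists (2 * PI * ((M + 1) * / (r - rho) ^ 3)). split; [apply Rmult_lt_0_compat; trivial; nra|].
  intros a b Ha Hb.
  assert (Ea := ex_cauchy_transform u r a Hu ltac:(lra)).
  assert (Eb := ex_cauchy_transform u r b Hu ltac:(lra)).
  assert (Na := circ_minus_neq_0 a r ltac:(lra)).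
  assert (Nb := circ_minus_neq_0 b r ltac:(lra)).
  assert (Ed : ex_CInt (fun th => (u th / ((circ r th - a) * (circ r th - a)))%C) 0 (2 * PI)).
  { apply ex_CInt_continuous; [lra|]. intros th _.
    apply continuous_Cmult; [apply Hu|].
    apply continuous_Cinv; [|apply Cmult_neq_0; apply Na].
    apply continuous_Cmult; apply continuous_circ_minus. }
  unfold cauchy_transform, cauchy_transform_deriv.
  rewrite (Cmult_comm _ (b - a)), <- (CInt_scal (b - a)%C) by exact Ed.
  rewrite <- CInt_minus by trivial.
  assert (Es : ex_CInt (fun th => ((b - a) * (u th / ((circ r th - a) * (circ r th - a))))%C) 0 (2 * PI))
    by (eexists; apply is_CInt_scal, CInt_correct, Ed).
  assert (Em : ex_CInt (fun th => (u th / (circ r th - b) - u th / (circ r th - a))%C) 0 (2 * PI))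
    by (eexists; apply (is_RInt_minus (V := C_R_NormedModule)); apply CInt_correct; eassumption).
  rewrite <- CInt_minus by trivial.
  replace (2 * PI * ((M + 1) * / (r - rho) ^ 3) * Cmod (b - a) ^ 2)
    with ((2 * PI - 0) * ((M + 1) * Cmod (b - a) ^ 2 * / (r - rho) ^ 3)) by ring.
  apply CInt_bound; [lra | |].
  - eexists. apply (is_RInt_minus (V := C_R_NormedModule)); apply CInt_correct; eassumption.
  - intros th _. specialize (Na th). specialize (Nb th).
    replace (u th / (circ r th - b) - u th / (circ r th - a) - (b - a) * (u th / ((circ r th - a) * (circ r th - a))))%C
      with (u th * ((b - a) * (b - a)) * / ((circ r th - b) * ((circ r th - a) * (circ r th - a))))%C
      by (field; split; trivial).
    rewrite !Cmod_mult, Cmod_inv, !Cmod_mult by (repeat apply Cmult_neq_0; trivial).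
    assert (Ga := Cmod_circ_minus_ge a r ltac:(lra) th).
    assert (Gb := Cmod_circ_minus_ge b r ltac:(lra) th).
    assert (HP : (r - rho) ^ 3 <= Cmod (circ r th - b) * (Cmod (circ r th - a) * Cmod (circ r th - a))).
    { simpl. rewrite Rmult_1_r. repeat apply Rmult_le_compat; try lra; nra. }
    apply Rmult_le_compat.
    + apply Rmult_le_pos; [apply Cmod_ge_0|]. apply Rle_0_sqr.
    + apply Rlt_le, Rinv_0_lt_compat. eapply Rlt_le_trans; [|exact HP]. apply pow_lt; lra.
    + replace (Cmod (b - a) * Cmod (b - a)) with (Cmod (b - a) ^ 2) by ring.
      apply Rmult_le_compat_r; [apply pow2_ge_0|]. specialize (HM th). lra.
    + apply Rinv_le_contravar; trivial. apply pow_lt; lra.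
Qed.

Lemma Cderiv_of_remainder (F D : C -> C) a rho K : Cmod a < rho ->
  (forall b, Cmod b <= rho -> Cmod (F b - F a - D a * (b - a)) <= K * Cmod (b - a) ^ 2) -> 0 < K ->
  Cderiv F a (D a).
Proof.
  intros Ha H HK. apply Cderiv_of_bound. intros eps He.
  exists (Rmin (rho - Cmod a) (eps / K)). split; [apply Rmin_pos; [lra | apply Rdiv_lt_0_compat; trivial]|].
  intros w Hw.
  assert (H1 := Rlt_le_trans _ _ _ Hw (Rmin_l _ _)). assert (H2 := Rlt_le_trans _ _ _ Hw (Rmin_r _ _)).
  eapply Rle_trans; [apply H|].
  - replace w with ((w - a) + a)%C by ring. eapply Rle_trans; [apply Cmod_triangle|]. lra.
  - simpl. rewrite Rmult_1_r, <- Rmult_assoc. apply Rmult_le_compat_r; [apply Cmod_ge_0|].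
    apply Rlt_le in H2. apply Rle_trans with (K * (eps / K)).
    + apply Rmult_le_compat_l; lra.
    + right. field. lra.
Qed.

Lemma Cderiv_cauchy_transform u r a M :
  (forall th, Rcontinuous u th) -> (forall th, Cmod (u th) <= M) -> Cmod a < r ->
  Cderiv (cauchy_transform u r) a (cauchy_transform_deriv u r a).
Proof.
  intros Hu HM Ha. set (rho := (Cmod a + r) / 2).
  destruct (cauchy_transform_remainder u r rho M Hu HM ltac:(unfold rho; lra)) as [K [HK H]].
  apply (Cderiv_of_remainder (cauchy_transform u r) (cauchy_transform_deriv u r) a rho K); trivial.
  - unfold rho; lra.
  - intros b Hb. apply H; unfold rho in *; lra.
Qed.

Lemma hol_on_circle f r th : hol f -> 0 <= r < 1 -> Rcontinuous (fun th => f (circ r th)) th.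
Proof.
  intros Hf Hr. apply (continuous_Rcomp (circ r)); [apply continuous_circ|].
  apply hol_continuous; trivial. rewrite Cmod_circ; lra.
Qed.

Lemma cauchy_transform_eq f r b : hol f -> Cmod b < r -> r < 1 ->
  (RtoC (2 * PI) * f b)%C = cauchy_transform (fun th => (f (circ r th) * circ r th)%C) r b.
Proof.
  intros Hf Hb Hr. rewrite <- (cauchy_formula f b r Hb).
  - apply CInt_ext. intros. unfold Cdiv. ring.
  - intros z Hz. apply Hf. lra.
Qed.

(** Add the remainder estimates for the pairs [(a, b)] and [(b, a)]: the values of the transform
    cancel and only [(l - m) * (a - b)] is left. The lemma serves to make the distortion integrand
    continuous. *)
Lemma derivative_lipschitz f rho : hol f -> (forall z, Cmod z < 1 -> Cmod (f z) <= 1) -> rho < 1 ->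
  exists K, 0 < K /\ forall a b l m, Cmod a < rho -> Cmod b < rho ->
    Cderiv f a l -> Cderiv f b m -> Cmod (l - m) <= K * Cmod (a - b).
Proof.
  intros Hf Hb Hr.
  destruct (Rle_lt_dec rho 0) as [Hz|Hz].
  { exists 1. split; [lra|]. intros a b l m Ha. generalize (Cmod_ge_0 a). lra. }
  set (r := (rho + 1) / 2). assert (Hr1 : rho < r) by (unfold r; lra). assert (Hr2 : r < 1) by (unfold r; lra).
  set (u := fun th => (f (circ r th) * circ r th)%C).
  assert (Hu : forall th, Rcontinuous u th).
  { intros. apply continuous_Cmult; [apply hol_on_circle; trivial; lra | apply continuous_circ]. }
  assert (HM : forall th, Cmod (u th) <= 1).
  { intros. unfold u. rewrite Cmod_mult, Cmod_circ by lra.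
    assert (T := Hb (circ r th) ltac:(rewrite Cmod_circ; lra)). generalize (Cmod_ge_0 (f (circ r th))). nra. }
  destruct (cauchy_transform_remainder u r rho 1 Hu HM Hr1) as [K [HK H]].
  assert (Hpi := two_PI_pos).
  assert (HD : forall a l, Cmod a < rho -> Cderiv f a l -> (RtoC (2 * PI) * l)%C = cauchy_transform_deriv u r a).
  { intros a l Ha Hl. apply (Cderiv_unique (cauchy_transform u r) a).
    - apply (Cderiv_ext_loc (fun z => (RtoC (2 * PI) * f z)%C) _ _ _ (r - Cmod a)); [lra| |].
      + intros w Hw. apply cauchy_transform_eq; trivial.
        replace w with ((w - a) + a)%C by ring. eapply Rle_lt_trans; [apply Cmod_triangle|]. lra.
      + replace (RtoC (2 * PI) * l)%C with (RtoC 0 * f a + RtoC (2 * PI) * l)%C by ring.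
        apply (Cderiv_mult (fun _ => RtoC (2 * PI))); [apply Cderiv_const | exact Hl].
    - apply Cderiv_cauchy_transform with 1; trivial; lra. }
  exists (2 * K / (2 * PI)). split; [apply Rdiv_lt_0_compat; lra|].
  intros a b l m Ha Hb' Hl Hm.
  assert (G1 := H a b ltac:(lra) ltac:(lra)). assert (G2 := H b a ltac:(lra) ltac:(lra)).
  rewrite <- (HD a l) in G1 by trivial. rewrite <- (HD b m) in G2 by trivial.
  rewrite (Rmult_comm (2 * K / (2 * PI))).
  destruct (Ceq_dec a b) as [E|E].
  { subst b. rewrite (Cderiv_unique _ _ _ _ Hl Hm). replace (m - m)%C with (RtoC 0) by ring.
    replace (a - a)%C with (RtoC 0) by ring. rewrite Cmod_0. lra. }
  assert (Hab := proj1 (Cmod_gt_0 _) (Cminus_neq_0 _ _ E)).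
  replace (Cmod (b - a)) with (Cmod (a - b)) in G1 by (rewrite <- Cmod_opp; f_equal; ring).
  assert (T : Cmod (RtoC (2 * PI) * (l - m) * (a - b)) <= 2 * K * Cmod (a - b) ^ 2).
  { replace (RtoC (2 * PI) * (l - m) * (a - b))%C with
      ((cauchy_transform u r b - cauchy_transform u r a - RtoC (2 * PI) * l * (b - a)) +
       (cauchy_transform u r a - cauchy_transform u r b - RtoC (2 * PI) * m * (a - b)))%C by ring.
    eapply Rle_trans; [apply Cmod_triangle|]. lra. }
  rewrite !Cmod_mult, Cmod_R, Rabs_right in T by lra.
  apply (Rmult_le_reg_r (Cmod (a - b))); trivial.
  apply (Rmult_le_reg_l (2 * PI)); trivial.
  replace (2 * PI * (Cmod (a - b) * (2 * K / (2 * PI)) * Cmod (a - b))) with (2 * K * Cmod (a - b) ^ 2) by (field; lra).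
  lra.
Qed.

(** The singularity of [f z / z] at 0 is removed by an explicit formula. From
    [zeta / (zeta - b) = 1 + b / (zeta - b)], Cauchy's formula splits into the mean of [f], which is
    [f 0 = 0], and [b] times a Cauchy transform. That transform is differentiable at 0. *)
Lemma hol_divide f : hol f -> (forall z, Cmod z < 1 -> Cmod (f z) <= 1) -> f (RtoC 0) = RtoC 0 ->
  exists g, hol g /\ forall z, f z = (z * g z)%C.
Proof.
  intros Hf Hb H0.
  assert (Hpi := two_PI_pos). assert (Hpi' := RtoC_neq_0 _ (Rgt_not_eq _ _ Hpi)).
  set (r := 1 / 2).
  set (u := fun th => f (circ r th)).
  assert (Hu : forall th, Rcontinuous u th) by (intros; apply hol_on_circle; trivial; unfold r; lra).
  assert (HM : forall th, Cmod (u th) <= 1) by (intros; apply Hb; rewrite Cmod_circ; unfold r; lra).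
  set (G := fun b => (cauchy_transform u r b / RtoC (2 * PI))%C).
  assert (Z : CInt u 0 (2 * PI) = RtoC 0).
  { assert (T := cauchy_formula f (RtoC 0) r ltac:(rewrite Cmod_0; unfold r; lra)
      ltac:(intros z Hz; apply Hf; unfold r in Hz; lra)).
    rewrite H0, Cmult_0_r in T. rewrite <- T. apply CInt_ext. intro th.
    assert (N := circ_minus_neq_0 (RtoC 0) r ltac:(rewrite Cmod_0; unfold r; lra) th).
    replace (circ r th - 0)%C with (circ r th) in * by ring.
    unfold u. field. exact N. }
  assert (HG : forall b, Cmod b < r -> f b = (b * G b)%C).
  { intros b Hbr. unfold G.
    assert (E : (RtoC (2 * PI) * f b)%C = (b * cauchy_transform u r b)%C).
    { rewrite (cauchy_transform_eq f r b) by (trivial; unfold r; lra).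
      unfold cauchy_transform. rewrite <- CInt_scal by (apply ex_cauchy_transform; trivial).
      apply Cminus_eq_0. rewrite <- Z. rewrite <- CInt_minus.
      - apply CInt_ext. intro th. assert (N := circ_minus_neq_0 b r Hbr th).
        unfold u. field. exact N.
      - apply (ex_cauchy_transform (fun th => (f (circ r th) * circ r th)%C)); trivial.
        intros; apply continuous_Cmult; [apply Hu | apply continuous_circ].
      - eexists. apply is_CInt_scal, CInt_correct, ex_cauchy_transform; trivial. }
    replace (b * (cauchy_transform u r b / RtoC (2 * PI)))%C with ((b * cauchy_transform u r b) / RtoC (2 * PI))%C
      by (field; exact Hpi').
    rewrite <- E. field. exact Hpi'. }
  exists (fun z => if Ceq_dec z (RtoC 0) then G z else (f z / z)%C). split.
  - intros z Hz.
    destruct (Ceq_dec z (RtoC 0)) as [E|E].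
    + subst z. eexists. apply (Cderiv_ext_loc G) with r.
      * unfold r; lra.
      * intros w Hw. destruct (Ceq_dec w (RtoC 0)) as [E|E]; trivial.
        rewrite HG. field; exact E.
        replace (w - 0)%C with w in Hw by ring. exact Hw.
      * apply Cderiv_mult; [|apply Cderiv_const].
        apply Cderiv_cauchy_transform with 1; trivial. rewrite Cmod_0. unfold r; lra.
    + destruct (Cdiffable_div f (fun w => w) z (Hf z Hz) (Cdiffable_id z) E) as [l Hl].
      exists l. apply (Cderiv_ext_loc (fun w => (f w / w)%C) _ z l (Cmod z)); [apply Cmod_gt_0, E| |exact Hl].
      intros w Hw. destruct (Ceq_dec w (RtoC 0)) as [E'|E']; trivial.
      subst w. exfalso. replace (0 - z)%C with (- z)%C in Hw by ring. rewrite Cmod_opp in Hw. lra.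
  - intros z. destruct (Ceq_dec z (RtoC 0)) as [E|E].
    + subst z. rewrite H0. ring.
    + field. exact E.
Qed.

Lemma pow_bounded_le_1 (x K : R) : 0 <= x -> (forall n, x ^ n <= K) -> x <= 1.
Proof.
  intros Hx H. apply Rnot_lt_le. intro Hlt.
  destruct (Pow_x_infinity x ltac:(rewrite Rabs_right; lra) (K + 1)) as [n Hn].
  specialize (Hn n (le_n n)). rewrite Rabs_right in Hn by (apply Rle_ge, pow_le, Hx).
  specialize (H n). lra.
Qed.

(* Landau's trick: Cauchy's formula for [g ^ n] bounds [Cmod (g a) ^ n] by
   [M ^ n] times a constant independent of [n]. *)
Lemma maximum_modulus g r a M : hol g -> Cmod a < r -> r < 1 -> 0 < M ->
  (forall z, Cmod z = r -> Cmod (g z) <= M) -> Cmod (g a) <= M.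
Proof.
  intros Hg Ha Hr HM H. assert (Ha0 := Cmod_ge_0 a). assert (Hpi := two_PI_pos).
  assert (X : Cmod (g a) / M <= 1).
  { apply pow_bounded_le_1 with (r / (r - Cmod a)).
    - apply Rmult_le_pos; [apply Cmod_ge_0 | apply Rlt_le, Rinv_0_lt_compat, HM].
    - intro n.
      assert (Hn : forall z, Cmod z <= r -> Cdiffable (fun z => (g z ^ n)%C) z).
      { intros z Hz. apply Cdiffable_pow, Hg. lra. }
      assert (F := cauchy_formula (fun z => (g z ^ n)%C) a r Ha Hn).
      assert (B : Cmod (RtoC (2 * PI) * g a ^ n) <= (2 * PI - 0) * (M ^ n * (r / (r - Cmod a)))).
      { rewrite <- F. apply CInt_bound; [lra| |].
        - apply (ex_CInt_cauchy a r Ha (fun z => (g z ^ n)%C)).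
          intros z Hz. apply Cdiffable_continuous, Hn, Hz.
        - intros th _. rewrite Cmod_mult, Cmod_pow.
          rewrite Cmod_div by (apply circ_minus_neq_0, Ha). rewrite (Cmod_circ r th) by lra.
          apply Rmult_le_compat.
          + apply pow_le, Cmod_ge_0.
          + apply Rmult_le_pos; [lra|]. apply Rlt_le, Rinv_0_lt_compat.
            generalize (Cmod_circ_minus_ge a r Ha th). lra.
          + apply pow_incr. split; [apply Cmod_ge_0 | apply H, Cmod_circ; lra].
          + apply Rmult_le_compat_l; [lra|]. apply Rinv_le_contravar; [lra | apply Cmod_circ_minus_ge, Ha]. }
      rewrite Cmod_mult, Cmod_pow, Cmod_R, Rabs_right in B by lra.
      unfold Rdiv at 1. rewrite Rpow_mult_distr, pow_inv.
      assert (HMn : 0 < M ^ n) by (apply pow_lt, HM).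
      apply (Rmult_le_reg_r (M ^ n)); trivial. rewrite Rmult_assoc, Rinv_l, Rmult_1_r by lra.
      apply (Rmult_le_reg_l (2 * PI)); trivial. lra. }
  apply (Rmult_le_compat_r M) in X; [|lra]. unfold Rdiv in X. rewrite Rmult_assoc, Rinv_l in X by lra. lra.
Qed.

Lemma schwarz f : hol f -> (forall z, Cmod z < 1 -> Cmod (f z) <= 1) -> f (RtoC 0) = RtoC 0 ->
  exists g, hol g /\ (forall z, f z = (z * g z)%C) /\ forall z, Cmod z < 1 -> Cmod (g z) <= 1.
Proof.
  intros Hf Hb H0. destruct (hol_divide f Hf Hb H0) as [g [Hg E]].
  exists g. repeat split; trivial. intros a Ha. assert (Ha0 := Cmod_ge_0 a).
  assert (K : forall r, Cmod a < r < 1 -> r * Cmod (g a) <= 1).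
  { intros r Hr. assert (B : Cmod (g a) <= / r).
    { apply maximum_modulus with r; trivial; try lra. apply Rinv_0_lt_compat; lra.
      intros z Hz. apply (Rmult_le_reg_l r); [lra|]. rewrite Rinv_r by lra.
      rewrite <- Hz at 1. rewrite <- Cmod_mult, <- E. apply Hb; lra. }
    apply (Rmult_le_compat_l r) in B; [|lra]. rewrite Rinv_r in B; lra. }
  assert (Hg0 := Cmod_ge_0 (g a)).
  apply Rnot_lt_le. intro Hlt.
  (* A radius below 1 exceeding both [Cmod a] and [/ Cmod (g a)], which contradicts [K]. *)
  set (r := Rmax ((Cmod a + 1) / 2) ((1 + / Cmod (g a)) / 2)).
  assert (I : / Cmod (g a) < 1) by (rewrite <- Rinv_1; apply Rinv_lt_contravar; lra).
  assert (Hr1 := Rmax_l ((Cmod a + 1) / 2) ((1 + / Cmod (g a)) / 2)).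
  assert (Hr2 := Rmax_r ((Cmod a + 1) / 2) ((1 + / Cmod (g a)) / 2)).
  assert (Hr3 : r < 1) by (apply Rmax_lub_lt; lra).
  fold r in Hr1, Hr2. specialize (K r ltac:(lra)).
  assert (/ Cmod (g a) * Cmod (g a) = 1) by (apply Rinv_l; lra). nra.
Qed.

(** * The Schwarz-Pick lemma *)

Definition mob (a z : C) : C := ((z - a) / (1 - Cconj a * z))%C.

Lemma mob_denominator a z : Cmod a < 1 -> Cmod z <= 1 -> (1 - Cconj a * z)%C <> RtoC 0.
Proof.
  intros Ha Hz E. apply Cminus_eq_0 in E. apply (f_equal Cmod) in E.
  rewrite Cmod_1, Cmod_mult, Cmod_conj in E.
  generalize (Cmod_ge_0 a) (Cmod_ge_0 z). nra.
Qed.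

(** This identity turns every bound on [Cmod (mob a z)] into one on the quantities [1 - |.|^2] and
    the kernel denominators; Schwarz-Pick is used below mostly in such forms. *)
Lemma mob_identity a z :
  Cmod (1 - Cconj a * z) ^ 2 - Cmod (z - a) ^ 2 = (1 - Cmod a ^ 2) * (1 - Cmod z ^ 2).
Proof.
  rewrite !Cmod2_alt. destruct a as [a1 a2], z as [z1 z2].
  unfold Re, Im; simpl. ring.
Qed.

Lemma Cmod_mob a z : Cmod a < 1 -> Cmod z <= 1 ->
  1 - Cmod (mob a z) ^ 2 = (1 - Cmod a ^ 2) * (1 - Cmod z ^ 2) / Cmod (1 - Cconj a * z) ^ 2.
Proof.
  intros Ha Hz. assert (N := mob_denominator a z Ha Hz). assert (P := proj1 (Cmod_gt_0 _) N).
  unfold mob. rewrite Cmod_div by exact N. rewrite <- mob_identity. field. lra.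
Qed.

Lemma sqr_lt_1 x : 0 <= x -> x < 1 -> 0 < 1 - x ^ 2.
Proof. intros. nra. Qed.

Lemma mob_lt_1 a z : Cmod a < 1 -> Cmod z < 1 -> Cmod (mob a z) < 1.
Proof.
  intros Ha Hz. assert (E := Cmod_mob a z Ha ltac:(lra)).
  assert (N := mob_denominator a z Ha ltac:(lra)). assert (P := proj1 (Cmod_gt_0 _) N).
  assert (0 < (1 - Cmod a ^ 2) * (1 - Cmod z ^ 2) / Cmod (1 - Cconj a * z) ^ 2).
  { apply Rdiv_lt_0_compat; [|apply pow_lt, P].
    apply Rmult_lt_0_compat; apply sqr_lt_1; trivial; apply Cmod_ge_0. }
  generalize (Cmod_ge_0 (mob a z)). nra.
Qed.

Lemma one_minus_conj_self a : Cmod a < 1 -> (1 - Cconj a * a)%C <> RtoC 0.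
Proof. intros Ha. apply mob_denominator; lra. Qed.

Lemma mob_opp_mob a z : Cmod a < 1 -> Cmod z < 1 -> mob (- a) (mob a z) = z.
Proof.
  intros Ha Hz.
  assert (N := mob_denominator a z Ha ltac:(lra)).
  assert (N2 := mob_denominator (- a)%C (mob a z) ltac:(rewrite Cmod_opp; lra)
     (Rlt_le _ _ (mob_lt_1 a z Ha Hz))).
  unfold mob in *. rewrite Copp_conj in *.
  assert (N3 := one_minus_conj_self a Ha).
  field. split; trivial.
  intro E. apply N3. rewrite <- E. ring.
Qed.

Lemma mob_self a : mob a a = RtoC 0.
Proof. unfold mob, Cdiv. replace (a - a)%C with (RtoC 0) by ring. ring. Qed.

Lemma mob_opp_0 a : mob (- a) (RtoC 0) = a.
Proof.
  unfold mob. replace (1 - Cconj (- a) * 0)%C with (RtoC 1) by ring.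
  replace (0 - - a)%C with a by ring. field.
Qed.

Lemma Cderiv_mob a z : Cmod a < 1 -> Cmod z < 1 ->
  Cderiv (mob a) z (RtoC (1 - Cmod a ^ 2) / ((1 - Cconj a * z) * (1 - Cconj a * z)))%C.
Proof.
  intros Ha Hz. assert (N := mob_denominator a z Ha ltac:(lra)).
  replace (RtoC (1 - Cmod a ^ 2) / ((1 - Cconj a * z) * (1 - Cconj a * z)))%C
    with ((1 - 0) * / (1 - Cconj a * z) + (z - a) * (- (0 - (0 * z + Cconj a * 1)) / ((1 - Cconj a * z) * (1 - Cconj a * z))))%C.
  - apply (Cderiv_mult (fun z => (z - a)%C) (fun z => (/ (1 - Cconj a * z))%C)).
    + apply Cderiv_minus; [apply Cderiv_id | apply Cderiv_const].
    + apply (Cderiv_inv (fun z => (1 - Cconj a * z)%C)); trivial.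
      apply Cderiv_minus; [apply Cderiv_const|].
      apply (Cderiv_mult (fun _ => Cconj a) (fun z => z)); [apply Cderiv_const | apply Cderiv_id].
  - rewrite RtoC_minus, <- Cmult_conj_Cmod. field. exact N.
Qed.

Lemma hol_mob_conjugate (phi : C -> C) p q : hol phi -> (forall z, Cmod z < 1 -> Cmod (phi z) < 1) ->
  Cmod p < 1 -> Cmod q < 1 -> hol (fun z => mob q (phi (mob p z))).
Proof.
  intros H1 H2 Hp Hq z Hz.
  assert (Hm := mob_lt_1 p z Hp Hz).
  apply (Cdiffable_comp (mob q) (fun z => phi (mob p z))).
  - apply Cdiffable_comp; [|apply H1, Hm]. eexists; apply Cderiv_mob; trivial.
  - eexists; apply Cderiv_mob; trivial. apply H2, Hm.
Qed.

Section SchwarzPick.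

Variable phi : C -> C.
Hypothesis Hphi : hol phi.
Hypothesis Hself : forall z, Cmod z < 1 -> Cmod (phi z) < 1.

(** Schwarz for the map conjugated to fix 0. The quotient [g] is kept in the conclusion because
    [Cmod (g 0)] is the hyperbolic distortion of [phi] at [w], and the integral condition is later
    studied through [g]. *)
Lemma schwarz_pick_normalized w : Cmod w < 1 ->
  exists g, hol g /\ (forall z, Cmod z < 1 -> Cmod (g z) <= 1) /\
   forall z, mob (phi w) (phi (mob (- w) z)) = (z * g z)%C.
Proof.
  intros Hw. assert (Hw' : Cmod (- w)%C < 1) by (rewrite Cmod_opp; exact Hw).
  destruct (schwarz (fun z => mob (phi w) (phi (mob (- w) z)))) as [g [Hg [E B]]].
  - apply hol_mob_conjugate; auto.
  - intros z Hz. apply Rlt_le, mob_lt_1; auto. apply Hself, mob_lt_1; auto.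
  - rewrite mob_opp_0. apply mob_self.
  - exists g; auto.
Qed.

Lemma schwarz_pick z w : Cmod z < 1 -> Cmod w < 1 ->
  Cmod (mob (phi w) (phi z)) <= Cmod (mob w z).
Proof.
  intros Hz Hw. destruct (schwarz_pick_normalized w Hw) as [g [_ [Bg E]]].
  specialize (E (mob w z)). rewrite mob_opp_mob in E by trivial.
  rewrite E, Cmod_mult. specialize (Bg (mob w z) (mob_lt_1 w z Hw Hz)).
  generalize (Cmod_ge_0 (mob w z)). nra.
Qed.

(** The form without the kernel denominators: if [A / V <= B / U], then
    [A^2 * (U^2 - B^2) <= B^2 * (V^2 - A^2)], and [mob_identity] evaluates the two differences. *)
Lemma schwarz_pick_sqr z w : Cmod z < 1 -> Cmod w < 1 ->
  Cmod (phi z - phi w) ^ 2 * ((1 - Cmod z ^ 2) * (1 - Cmod w ^ 2))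
  <= Cmod (z - w) ^ 2 * ((1 - Cmod (phi z) ^ 2) * (1 - Cmod (phi w) ^ 2)).
Proof.
  intros Hz Hw. assert (S := schwarz_pick z w Hz Hw).
  assert (Iz := mob_identity w z). assert (If := mob_identity (phi w) (phi z)).
  assert (Nz := mob_denominator w z Hw ltac:(lra)).
  assert (Nf := mob_denominator (phi w) (phi z) (Hself _ Hw) (Rlt_le _ _ (Hself _ Hz))).
  unfold mob in S. rewrite !Cmod_div in S by trivial.
  apply Cmod_gt_0 in Nz. apply Cmod_gt_0 in Nf.
  set (A := Cmod (phi z - phi w)) in *. set (B := Cmod (z - w)) in *.
  set (U := Cmod (1 - Cconj w * z)) in *. set (V := Cmod (1 - Cconj (phi w) * phi z)) in *.
  assert (HA : 0 <= A) by apply Cmod_ge_0. assert (HB : 0 <= B) by apply Cmod_ge_0.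
  assert (S' : A * U <= B * V).
  { apply (Rmult_le_compat_r (U * V)) in S; [|nra].
    replace (A / V * (U * V)) with (A * U) in S by (field; lra).
    replace (B / U * (U * V)) with (B * V) in S by (field; lra). exact S. }
  rewrite (Rmult_comm (1 - Cmod z ^ 2)), (Rmult_comm (1 - Cmod (phi z) ^ 2)), <- Iz, <- If.
  assert (0 <= A * U) by nra. assert ((A * U) ^ 2 <= (B * V) ^ 2) by (apply pow_incr; lra). nra.
Qed.

Lemma schwarz_pick_deriv_strict w l : Cmod w < 1 -> Cderiv phi w l ->
  Cmod l * (1 - Cmod w ^ 2) <= 1 - Cmod (phi w) ^ 2.
Proof.
  intros Hw Hl. destruct (schwarz_pick_normalized w Hw) as [g [Hg [Bg E]]].
  assert (Hw' : Cmod (- w)%C < 1) by (rewrite Cmod_opp; exact Hw).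
  assert (H0 : Cmod (RtoC 0) < 1) by (rewrite Cmod_0; lra).
  destruct (Hg (RtoC 0) H0) as [m Hm].
  assert (D1 : Cderiv (fun z => (z * g z)%C) (RtoC 0) (1 * g (RtoC 0) + 0 * m)%C)
    by (apply (Cderiv_mult (fun z => z) g); [apply Cderiv_id | exact Hm]).
  assert (D2 := Cderiv_mob (- w)%C (RtoC 0) Hw' H0).
  assert (D3 : Cderiv phi (mob (- w) (RtoC 0)) l) by (rewrite mob_opp_0; exact Hl).
  assert (D4 := Cderiv_comp phi (mob (- w)%C) _ _ _ D2 D3).
  assert (Hf := Hself w Hw).
  assert (D5 := Cderiv_mob (phi w) (phi (mob (- w)%C (RtoC 0))) Hf ltac:(rewrite mob_opp_0; exact Hf)).
  assert (D6 := Cderiv_comp (mob (phi w)) (fun z => phi (mob (- w)%C z)) _ _ _ D4 D5).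
  apply (Cderiv_ext _ _ _ _ E) in D6.
  (* The derivative at 0 of [z * g z] is [g 0], and the chain rule expresses it through [l]. *)
  assert (U := Cderiv_unique _ _ _ _ D1 D6). clear D1 D2 D3 D4 D5 D6.
  rewrite mob_opp_0 in U.
  assert (B0 := Bg (RtoC 0) H0).
  replace (1 * g 0 + 0 * m)%C with (g (RtoC 0)) in U by ring. rewrite U in B0.
  rewrite (Cmult_comm _ (phi w)), Cmult_conj_Cmod in B0.
  assert (Pw := sqr_lt_1 _ (Cmod_ge_0 w) Hw). assert (Pf := sqr_lt_1 _ (Cmod_ge_0 (phi w)) Hf).
  rewrite Cmod_opp in B0.
  replace (1 - RtoC (Cmod (phi w) ^ 2))%C with (RtoC (1 - Cmod (phi w) ^ 2)) in B0 by (rewrite RtoC_minus; reflexivity).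
  replace (1 - Cconj (- w) * 0)%C with (RtoC 1) in B0 by ring.
  assert (Nf := RtoC_neq_0 _ (Rgt_not_eq _ _ Pf)).
  replace (RtoC (1 - Cmod (phi w) ^ 2) / (RtoC (1 - Cmod (phi w) ^ 2) * RtoC (1 - Cmod (phi w) ^ 2))
          * (l * (RtoC (1 - Cmod w ^ 2) / (1 * 1))))%C
    with (l * RtoC (1 - Cmod w ^ 2) / RtoC (1 - Cmod (phi w) ^ 2))%C in B0 by (field; exact Nf).
  rewrite Cmod_div, Cmod_mult, !Cmod_R, !Rabs_right in B0 by (trivial; lra).
  apply Rle_div_l in B0; lra.
Qed.

End SchwarzPick.

(** [g] may take values on the unit circle, so the strict version is applied to [t * g] and [t]
    tends to 1. *)
Lemma schwarz_pick_deriv g w l : hol g -> (forall z, Cmod z < 1 -> Cmod (g z) <= 1) ->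
  Cmod w < 1 -> Cderiv g w l -> Cmod l * (1 - Cmod w ^ 2) <= 1 - Cmod (g w) ^ 2.
Proof.
  intros Hg Hb Hw Hl.
  set (A := Cmod l * (1 - Cmod w ^ 2)). set (B := Cmod (g w) ^ 2).
  assert (HA : 0 <= A).
  { apply Rmult_le_pos; [apply Cmod_ge_0|]. apply Rlt_le, sqr_lt_1; trivial; apply Cmod_ge_0. }
  assert (HB : 0 <= B) by apply pow2_ge_0.
  assert (K : forall t, 0 < t < 1 -> t * A <= 1 - t ^ 2 * B).
  { intros t Ht.
    assert (D : Cderiv (fun z => (RtoC t * g z)%C) w (0 * g w + RtoC t * l)%C)
      by (apply (Cderiv_mult (fun _ => RtoC t) g); [apply Cderiv_const | exact Hl]).
    apply schwarz_pick_deriv_strict in D; trivial.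
    - replace (0 * g w + RtoC t * l)%C with (RtoC t * l)%C in D by ring.
      rewrite !Cmod_mult, Cmod_R, Rabs_right in D by lra. unfold A, B. nra.
    - intros z Hz. apply Cdiffable_mult; [apply Cdiffable_const | apply Hg, Hz].
    - intros z Hz. rewrite Cmod_mult, Cmod_R, Rabs_right by lra.
      specialize (Hb z Hz). generalize (Cmod_ge_0 (g z)). nra. }
  apply Rnot_lt_le. intro Hlt.
  (* Passing from [t = 1] to [t = 1 - d] lowers [t * A + t^2 * B] by at most [d * (A + 2 * B)],
     which is half of the supposed excess over 1. *)
  set (d := (A + B - 1) / (2 * (A + B + B))).
  assert (Hd0 : 0 < A + B + B) by lra.
  assert (Hd1 : 0 < d) by (apply Rdiv_lt_0_compat; lra).
  assert (Hd3 : d * (2 * (A + B + B)) = A + B - 1) by (unfold d; field; lra).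
  assert (Hd2 : d < 1) by nra.
  specialize (K (1 - d) ltac:(lra)). nra.
Qed.

(** Schwarz-Pick for the disc map [h = (G - 1) / (G + 1)], for which
    [1 - |h|^2 = 4 * Re G / |G + 1|^2]; the factors [|G + 1|] cancel. *)
Lemma half_plane_schwarz_pick_strict G z w : hol G -> (forall z, Cmod z < 1 -> 0 < Re (G z)) ->
  Cmod z < 1 -> Cmod w < 1 ->
  Cmod (G z - G w) ^ 2 * ((1 - Cmod z ^ 2) * (1 - Cmod w ^ 2))
  <= 4 * Cmod (z - w) ^ 2 * (Re (G z) * Re (G w)).
Proof.
  intros HG Hpos Hz Hw.
  set (h := fun z => ((G z - 1) / (G z + 1))%C).
  assert (N : forall z, Cmod z < 1 -> (G z + 1)%C <> RtoC 0).
  { intros u Hu E. apply (f_equal Re) in E. rewrite re_plus in E. simpl in E. specialize (Hpos u Hu). unfold Re in *. lra. }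
  assert (P : forall z, Cmod z < 1 -> 0 < Cmod (G z + 1)) by (intros u Hu; apply Cmod_gt_0, N, Hu).
  assert (I : forall z, Cmod z < 1 -> 1 - Cmod (h z) ^ 2 = 4 * Re (G z) / Cmod (G z + 1) ^ 2).
  { intros u Hu. unfold h. rewrite Cmod_div by (apply N, Hu). specialize (P u Hu).
    replace (4 * Re (G u)) with (Cmod (G u + 1) ^ 2 - Cmod (G u - 1) ^ 2).
    - field. lra.
    - rewrite !Cmod2_alt. destruct (G u) as [g1 g2]. unfold Re, Im; simpl. ring. }
  assert (S := schwarz_pick_sqr h).
  assert (Hh : hol h).
  { intros u Hu. apply Cdiffable_div; [| |apply N, Hu];
      [apply Cdiffable_minus | apply Cdiffable_plus]; try apply Cdiffable_const; apply HG, Hu. }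
  assert (Hs : forall z, Cmod z < 1 -> Cmod (h z) < 1).
  { intros u Hu. assert (E := I u Hu).
    assert (0 < 4 * Re (G u) / Cmod (G u + 1) ^ 2).
    { apply Rdiv_lt_0_compat; [specialize (Hpos u Hu); lra | apply pow_lt, P, Hu]. }
    generalize (Cmod_ge_0 (h u)). nra. }
  specialize (S Hh Hs z w Hz Hw).
  rewrite (I z Hz), (I w Hw) in S.
  assert (Pz := P z Hz). assert (Pw := P w Hw).
  replace (h z - h w)%C with (2 * (G z - G w) / ((G z + 1) * (G w + 1)))%C in S
    by (unfold h; field; split; apply N; trivial).
  rewrite Cmod_div, !Cmod_mult in S by (apply Cmult_neq_0; apply N; trivial).
  rewrite Cmod_R, Rabs_right in S by lra.
  assert (Pp : 0 < (Cmod (G z + 1) * Cmod (G w + 1)) ^ 2) by (apply pow_lt, Rmult_lt_0_compat; trivial).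
  apply (Rmult_le_compat_r ((Cmod (G z + 1) * Cmod (G w + 1)) ^ 2 / 4)) in S; [|lra].
  eapply Rle_trans; [|eapply Rle_trans; [exact S|]]; right; field; lra.
Qed.

(** Applied to [G + e] with [e] tending to 0. The closed half-plane is needed because the functions
    used later are only known to have nonnegative real part. *)
Lemma half_plane_schwarz_pick G z w : hol G -> (forall z, Cmod z < 1 -> 0 <= Re (G z)) ->
  Cmod z < 1 -> Cmod w < 1 ->
  Cmod (G z - G w) ^ 2 * ((1 - Cmod z ^ 2) * (1 - Cmod w ^ 2))
  <= 4 * Cmod (z - w) ^ 2 * (Re (G z) * Re (G w)).
Proof.
  intros HG Hpos Hz Hw.
  set (A := Cmod (G z - G w) ^ 2 * ((1 - Cmod z ^ 2) * (1 - Cmod w ^ 2))).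
  set (B := 4 * Cmod (z - w) ^ 2).
  assert (HB : 0 <= B) by (unfold B; generalize (pow2_ge_0 (Cmod (z - w))); lra).
  assert (Pz := Hpos z Hz). assert (Pw := Hpos w Hw).
  assert (K : forall e, 0 < e -> A <= B * ((Re (G z) + e) * (Re (G w) + e))).
  { intros e He.
    assert (S := half_plane_schwarz_pick_strict (fun u => (G u + RtoC e)%C) z w).
    cbv beta in S. rewrite !re_plus in S. simpl (Re (RtoC e)) in S.
    replace (G z + RtoC e - (G w + RtoC e))%C with (G z - G w)%C in S by ring.
    apply S; trivial.
    - intros u Hu. apply Cdiffable_plus; [apply HG, Hu | apply Cdiffable_const].
    - intros u Hu. rewrite re_plus. simpl. specialize (Hpos u Hu). lra. }
  apply le_epsilon. intros eps Heps.
  set (Q := B * (Re (G z) + Re (G w) + 1) + 1).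
  assert (HQ : 0 < Q) by (unfold Q; assert (0 <= B * (Re (G z) + Re (G w) + 1)) by (apply Rmult_le_pos; lra); lra).
  set (e := Rmin 1 (eps / Q)).
  assert (He : 0 < e) by (apply Rmin_pos; [lra | apply Rdiv_lt_0_compat; lra]).
  assert (He1 : e <= 1) by apply Rmin_l. assert (He2 : e <= eps / Q) by apply Rmin_r.
  assert (He3 : e * Q <= eps).
  { apply Rle_trans with (eps / Q * Q); [apply Rmult_le_compat_r; lra | right; field; lra]. }
  eapply Rle_trans; [apply (K e He)|].
  assert (B * ((Re (G z) + e) * (Re (G w) + e)) - B * (Re (G z) * Re (G w)) <= e * Q).
  { unfold Q. assert (0 <= B * e * (1 - e)) by (apply Rmult_le_pos; [apply Rmult_le_pos|]; lra). nra. }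
  lra.
Qed.

(** * Kernels and hyperbolic distance *)

Definition near_stolz (sigma : C) (M d : R) (z : C) : Prop :=
  stolz sigma M z /\ Cmod (z - sigma) < d.

Lemma stolz_filter_iff sigma M (P : C -> Prop) :
  stolz_filter sigma M P <-> exists d, 0 < d /\ forall z, near_stolz sigma M d z -> P z.
Proof.
  unfold stolz_filter, within. rewrite locally_C_iff. unfold near_stolz.
  split; intros [d [Hd H]]; exists d; (split; [exact Hd|]).
  - intros z [Hs Hz]; auto.
  - intros z Hz Hs; auto.
Qed.

Lemma angular_lim2_iff (f : C -> C -> R) sigma l :
  angular_lim2 f sigma l <->
  forall M eps, 1 < M -> 0 < eps -> exists d, 0 < d /\ forall z w,
    near_stolz sigma M d z -> near_stolz sigma M d w -> Rabs (f z w - l) < eps.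
Proof.
  unfold angular_lim2. split; intros H.
  - intros M eps HM He. specialize (H M HM).
    specialize (H _ (locally_ball (T := R_UniformSpace) l (mkposreal eps He))).
    destruct H as [P Q HP HQ H]. apply stolz_filter_iff in HP. apply stolz_filter_iff in HQ.
    destruct HP as [d1 [Hd1 HP]]. destruct HQ as [d2 [Hd2 HQ]].
    exists (Rmin d1 d2). split; [apply Rmin_pos; trivial|].
    intros z w [Hz1 Hz2] [Hw1 Hw2]. apply (H z w).
    + apply HP. split; trivial. apply Rlt_le_trans with (1 := Hz2), Rmin_l.
    + apply HQ. split; trivial. apply Rlt_le_trans with (1 := Hw2), Rmin_r.
  - intros M HM P [e He]. destruct (H M e HM (cond_pos e)) as [d [Hd K]].
    apply Filter_prod with (near_stolz sigma M d) (near_stolz sigma M d).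
    + apply stolz_filter_iff. exists d; auto.
    + apply stolz_filter_iff. exists d; auto.
    + intros z w Hz Hw. apply He. apply (K z w Hz Hw).
Qed.

Lemma angular_lim_iff (f : C -> C) sigma l :
  angular_lim (V := C_UniformSpace) f sigma l <->
  forall M eps, 1 < M -> 0 < eps -> exists d, 0 < d /\ forall z,
    near_stolz sigma M d z -> Cmod (f z - l) < eps.
Proof.
  unfold angular_lim. split; intros H.
  - intros M eps HM He. specialize (H M HM (fun w => Cmod (w - l) < eps)).
    apply stolz_filter_iff. apply H. apply locally_C_iff. exists eps; auto.
  - intros M HM P HP. apply locally_C_iff in HP. destruct HP as [e [He HP]].
    destruct (H M e HM He) as [d [Hd K]].
    apply stolz_filter_iff. exists d; split; auto.
Qed.

(* What the quotient in (c) becomes by the reproducing property. *)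
Definition kernel_cosine (phi : C -> C) (z w : C) : R :=
  Cmod (dbr_kernel phi w z) / (sqrt (Re (dbr_kernel phi z z)) * sqrt (Re (dbr_kernel phi w w))).

Lemma Cmod_one_minus_conj_comm a b : Cmod (1 - Cconj a * b) = Cmod (1 - Cconj b * a).
Proof.
  rewrite <- (Cmod_conj (1 - Cconj a * b)). f_equal.
  rewrite Cminus_conj, Cmult_conj, Cconj_conj.
  replace (Cconj 1) with (RtoC 1) by (unfold Cconj, RtoC; simpl; f_equal; ring). ring.
Qed.

Lemma dbr_kernel_diag phi z : Cmod z < 1 ->
  Re (dbr_kernel phi z z) = (1 - Cmod (phi z) ^ 2) / (1 - Cmod z ^ 2).
Proof.
  intros Hz. unfold dbr_kernel. rewrite !(Cmult_comm (Cconj _)), !Cmult_conj_Cmod.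
  assert (P := sqr_lt_1 _ (Cmod_ge_0 z) Hz).
  replace ((1 - RtoC (Cmod (phi z) ^ 2)) / (1 - RtoC (Cmod z ^ 2)))%C
    with (RtoC ((1 - Cmod (phi z) ^ 2) / (1 - Cmod z ^ 2))); [reflexivity|].
  rewrite RtoC_div, !RtoC_minus; [reflexivity|lra].
Qed.

(** The hypothesis on [Q] gives [D + 2 * ln Q = 2 * (ln (1 + rho) - ln (1 + s))], which lies between
    0 and [2 * (rho - s)]. Moreover [(rho - s)^2 <= rho^2 - s^2 = (1 - Q^2) * (1 - s^2)]. The
    logarithm of [Q] is compared with [Q - 1] and [/ Q - 1]. *)
Lemma hyp_dist_difference_bounds rho s Q : 0 <= s <= rho -> rho < 1 -> 0 < Q ->
  Q ^ 2 * (1 - s ^ 2) = 1 - rho ^ 2 ->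
  let D := ln ((1 + rho) / (1 - rho)) - ln ((1 + s) / (1 - s)) in
  Q <= 1 /\ 0 <= D /\ 1 - Q <= D / 2 /\ D <= 2 * sqrt (1 - Q ^ 2) + 2 * (/ Q - 1).
Proof.
  intros Hs Hr HQ E D.
  assert (P1 : 0 < 1 - s ^ 2) by nra.
  assert (P2 : 0 < 1 - rho ^ 2) by nra.
  assert (HQ1 : Q <= 1).
  { apply Rnot_lt_le. intro Hlt. assert (1 < Q ^ 2) by nra. assert (s ^ 2 <= rho ^ 2) by nra. nra. }
  assert (EQ : 2 * ln Q + ln (1 - s ^ 2) = ln (1 - rho ^ 2)).
  { rewrite <- E, ln_mult by (trivial; apply pow_lt, HQ).
    rewrite (ln_pow Q 2) by trivial. simpl INR. ring. }
  replace (1 - s ^ 2) with ((1 - s) * (1 + s)) in EQ by ring.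
  replace (1 - rho ^ 2) with ((1 - rho) * (1 + rho)) in EQ by ring.
  rewrite !ln_mult in EQ by lra.
  assert (ED : D + 2 * ln Q = 2 * (ln (1 + rho) - ln (1 + s))).
  { unfold D. rewrite !ln_div by lra. lra. }
  assert (L1 : ln (1 + s) <= ln (1 + rho)).
  { destruct (Req_dec s rho) as [->|N]; [lra|]. apply Rlt_le, ln_increasing; lra. }
  assert (Ll : forall x, 0 < x -> ln x <= x - 1).
  { intros x Hx. assert (T := exp_ineq1_le (ln x)). rewrite exp_ln in T by trivial. lra. }
  assert (L2 : ln (1 + rho) - ln (1 + s) <= rho - s).
  { rewrite <- ln_div by lra. eapply Rle_trans; [apply Ll; apply Rdiv_lt_0_compat; lra|].
    replace ((1 + rho) / (1 + s) - 1) with ((rho - s) / (1 + s)) by (field; lra).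
    apply Rle_div_l; nra. }
  assert (L3 := Ll Q HQ).
  assert (L4 : - ln Q <= / Q - 1).
  { rewrite <- ln_Rinv by trivial. apply Ll, Rinv_0_lt_compat, HQ. }
  assert (L5 : rho - s <= sqrt (1 - Q ^ 2)).
  { rewrite <- (sqrt_pow2 (rho - s)) by lra. apply sqrt_le_1_alt.
    assert (0 <= (1 - Q ^ 2) * s ^ 2) by (apply Rmult_le_pos; nra). nra. }
  repeat split; lra.
Qed.

Section Cosine.

Variable phi : C -> C.
Hypothesis Hphi : hol phi.
Hypothesis Hself : forall z, Cmod z < 1 -> Cmod (phi z) < 1.

Lemma kernel_cosine_pos z w : Cmod z < 1 -> Cmod w < 1 -> 0 < kernel_cosine phi z w.
Proof.
  intros Hz Hw. unfold kernel_cosine. rewrite !dbr_kernel_diag by trivial.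
  assert (Pz := sqr_lt_1 _ (Cmod_ge_0 z) Hz). assert (Pw := sqr_lt_1 _ (Cmod_ge_0 w) Hw).
  assert (Fz := sqr_lt_1 _ (Cmod_ge_0 _) (Hself z Hz)). assert (Fw := sqr_lt_1 _ (Cmod_ge_0 _) (Hself w Hw)).
  apply Rdiv_lt_0_compat.
  - apply Cmod_gt_0. unfold dbr_kernel. apply Cmult_neq_0.
    + apply mob_denominator; auto. apply Rlt_le; auto.
    + intro E. assert (N := mob_denominator z w Hz ltac:(lra)).
      apply Cmod_gt_0 in N. apply (f_equal Cmod) in E. rewrite Cmod_inv, Cmod_0 in E.
      * apply Rinv_0_lt_compat in N. lra.
      * apply Cmod_gt_0, N.
  - apply Rmult_lt_0_compat; apply sqrt_lt_R0, Rdiv_lt_0_compat; trivial.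
Qed.

Lemma kernel_cosine_sqr z w : Cmod z < 1 -> Cmod w < 1 ->
  kernel_cosine phi z w ^ 2 =
  Cmod (1 - Cconj (phi w) * phi z) ^ 2 * ((1 - Cmod z ^ 2) * (1 - Cmod w ^ 2))
  / (Cmod (1 - Cconj w * z) ^ 2 * ((1 - Cmod (phi z) ^ 2) * (1 - Cmod (phi w) ^ 2))).
Proof.
  intros Hz Hw. unfold kernel_cosine. rewrite !dbr_kernel_diag by trivial.
  assert (Pz := sqr_lt_1 _ (Cmod_ge_0 z) Hz). assert (Pw := sqr_lt_1 _ (Cmod_ge_0 w) Hw).
  assert (Fz := sqr_lt_1 _ (Cmod_ge_0 _) (Hself z Hz)). assert (Fw := sqr_lt_1 _ (Cmod_ge_0 _) (Hself w Hw)).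
  unfold dbr_kernel.
  assert (N := mob_denominator z w Hz ltac:(lra)).
  rewrite Cmod_div by trivial. apply Cmod_gt_0 in N.
  unfold Rdiv at 1. rewrite Rpow_mult_distr, pow_inv, Rpow_mult_distr.
  rewrite !pow2_sqrt by (apply Rlt_le, Rdiv_lt_0_compat; trivial).
  rewrite (Cmod_one_minus_conj_comm w z), (Cmod_one_minus_conj_comm (phi w) (phi z)).
  field. repeat split; lra.
Qed.

Lemma kernel_cosine_hyp_dist z w : Cmod z < 1 -> Cmod w < 1 ->
  let Q := kernel_cosine phi z w in
  let D := hyp_dist z w - hyp_dist (phi z) (phi w) in
  Q <= 1 /\ 0 <= D /\ 1 - Q <= D / 2 /\ D <= 2 * sqrt (1 - Q ^ 2) + 2 * (/ Q - 1).
Proof.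
  intros Hz Hw. apply hyp_dist_difference_bounds.
  - split; [apply Cmod_ge_0 | apply (schwarz_pick phi Hphi Hself z w Hz Hw)].
  - apply (mob_lt_1 w z Hw Hz).
  - apply kernel_cosine_pos; trivial.
  - rewrite kernel_cosine_sqr by trivial. unfold pseudo_hyp_dist.
    fold (mob w z). fold (mob (phi w) (phi z)).
    assert (Fz := Hself z Hz). assert (Fw := Hself w Hw).
    rewrite !Cmod_mob by (auto; apply Rlt_le; auto).
    assert (N := mob_denominator w z Hw ltac:(lra)). assert (N' := mob_denominator (phi w) (phi z) Fw ltac:(lra)).
    apply Cmod_gt_0 in N. apply Cmod_gt_0 in N'.
    assert (Pz := sqr_lt_1 _ (Cmod_ge_0 _) Fz). assert (Pw := sqr_lt_1 _ (Cmod_ge_0 _) Fw).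
    field. repeat split; lra.
Qed.

Lemma hyp_dist_preserved_iff_cosine sigma :
  hyp_dist_preserved_at phi sigma <-> angular_lim2 (kernel_cosine phi) sigma 1.
Proof.
  unfold hyp_dist_preserved_at. rewrite !angular_lim2_iff. split; intros H M eps HM He.
  - destruct (H M eps HM He) as [d [Hd K]]. exists d; split; trivial.
    intros z w Hz Hw. specialize (K z w Hz Hw).
    destruct (kernel_cosine_hyp_dist z w) as [H1 [H2 [H3 _]]]; [apply Hz | apply Hw|].
    rewrite Rminus_0_r, Rabs_right in K by lra. rewrite Rabs_left1 by lra. lra.
  (* If [1 - Q < eta], the square root is at most [eps / 4] and [/ Q - 1] at most
     [2 * eta <= eps / 8], so the upper bound for the distance difference is at most
     [3 / 4 * eps]. *)
  - set (eta := Rmin (1 / 2) (Rmin (eps ^ 2 / 32) (eps / 16))).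
    assert (He2 : 0 < eps ^ 2 / 32) by nra.
    assert (Heta : 0 < eta) by (repeat apply Rmin_pos; lra).
    assert (A1 : eta <= 1 / 2) by apply Rmin_l.
    assert (A2 : eta <= eps ^ 2 / 32) by (eapply Rle_trans; [apply Rmin_r | apply Rmin_l]).
    assert (A3 : eta <= eps / 16) by (eapply Rle_trans; [apply Rmin_r | apply Rmin_r]).
    destruct (H M eta HM Heta) as [d [Hd K]]. exists d; split; trivial.
    intros z w Hz Hw. specialize (K z w Hz Hw).
    assert (HQ := kernel_cosine_pos z w (proj1 (proj1 Hz)) (proj1 (proj1 Hw))).
    destruct (kernel_cosine_hyp_dist z w) as [H1 [H2 [_ H4]]]; [apply Hz | apply Hw|].
    rewrite Rminus_0_r, Rabs_right by lra.
    set (Q := kernel_cosine phi z w) in *.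
    rewrite Rabs_left1 in K by lra.
    eapply Rle_lt_trans; [exact H4|].
    assert (B1 : sqrt (1 - Q ^ 2) <= eps / 4).
    { rewrite <- (sqrt_pow2 (eps / 4)) by lra. apply sqrt_le_1_alt. nra. }
    assert (B2 : / Q - 1 <= 2 * eta).
    { replace (/ Q - 1) with ((1 - Q) / Q) by (field; lra). apply Rle_div_l; nra. }
    lra.
Qed.

Lemma kernel_norm (H : dbr_space phi) z : Cmod z < 1 ->
  rkhs_norm H (dbr_kernel_at phi z) = sqrt (Re (dbr_kernel phi z z)).
Proof.
  intros Hz. unfold rkhs_norm, inner_norm. f_equal. f_equal.
  exact (reproducing _ _ H _ (exist _ z Hz) (kernel_mem _ _ H (exist _ z Hz))).
Qed.

Lemma kernel_inner (H : dbr_space phi) z w : Cmod z < 1 -> Cmod w < 1 ->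
  inner H (dbr_kernel_at phi z) (dbr_kernel_at phi w) = dbr_kernel phi w z.
Proof.
  intros Hz Hw.
  exact (reproducing _ _ H _ (exist _ w Hw) (kernel_mem _ _ H (exist _ z Hz))).
Qed.

Lemma kernels_aligned_iff_cosine (H : dbr_space phi) sigma :
  kernels_aligned_at phi H sigma <-> angular_lim2 (kernel_cosine phi) sigma 1.
Proof.
  assert (E : forall z w, Cmod z < 1 -> Cmod w < 1 ->
     Cmod (inner H (dbr_kernel_at phi z) (dbr_kernel_at phi w))
       / (rkhs_norm H (dbr_kernel_at phi z) * rkhs_norm H (dbr_kernel_at phi w))
     = kernel_cosine phi z w).
  { intros z w Hz Hw. rewrite !kernel_norm, kernel_inner by trivial. reflexivity. }
  unfold kernels_aligned_at. rewrite !angular_lim2_iff.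
  split; intros K M eps HM He; destruct (K M eps HM He) as [d [Hd L]]; exists d;
    (split; [exact Hd|]); intros z w Hz Hw; specialize (L z w Hz Hw).
  - rewrite E in L; [exact L | apply Hz | apply Hw].
  - rewrite E; [exact L | apply Hz | apply Hw].
Qed.

End Cosine.

(** * Radial boundedness and Julia's inequality *)

(** Maps the disc onto the right half-plane and sends [om] to infinity; its real part is the Poisson
    kernel with pole [om]. *)
Definition cayley (om z : C) : C := ((om + z) / (om - z))%C.

Lemma unit_minus_neq_0 om z : Cmod om = 1 -> Cmod z < 1 -> (om - z)%C <> RtoC 0.
Proof. intros Ho Hz E. apply Cminus_eq_0 in E. subst z. lra. Qed.

Lemma Re_mult_RtoC z x : Re (z * RtoC x)%C = Re z * x.
Proof. destruct z as [a b]. unfold Re; simpl. ring. Qed.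

Lemma Re_cayley om z : Cmod om = 1 -> Cmod z < 1 ->
  Re (cayley om z) = (1 - Cmod z ^ 2) / Cmod (om - z) ^ 2.
Proof.
  intros Ho Hz. assert (N := unit_minus_neq_0 om z Ho Hz).
  assert (P := proj1 (Cmod_gt_0 _) N).
  assert (Hn : RtoC (Cmod (om - z) ^ 2) <> RtoC 0) by (apply RtoC_neq_0, pow_nonzero; lra).
  assert (Nc : Cconj (om - z) <> RtoC 0).
  { intro E. apply Hn. rewrite <- Cmult_conj_Cmod, E. ring. }
  assert (E : cayley om z = ((om + z) * Cconj (om - z) / RtoC (Cmod (om - z) ^ 2))%C).
  { rewrite <- Cmult_conj_Cmod. unfold cayley. field. split; trivial. }
  rewrite E. unfold Cdiv. rewrite <- RtoC_inv by (apply pow_nonzero; lra).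
  rewrite Re_mult_RtoC. unfold Rdiv. f_equal.
  replace (1 - Cmod z ^ 2) with (Cmod om ^ 2 - Cmod z ^ 2) by (rewrite Ho; ring).
  rewrite !Cmod2_alt. destruct om as [o1 o2], z as [z1 z2]. unfold Re, Im; simpl. ring.
Qed.

(** The half-plane form of the kernel denominator. Together with [Re_cayley] it expresses
    [kernel_cosine] through [F] and [Z] alone, the distances to the boundary points cancelling. *)
Lemma cayley_plus_conj om1 a b : Cmod om1 = 1 -> Cmod a < 1 -> Cmod b < 1 ->
  Cmod (cayley om1 a + Cconj (cayley om1 b)) =
  2 * Cmod (1 - Cconj b * a) / (Cmod (om1 - a) * Cmod (om1 - b)).
Proof.
  intros Ho Ha Hb.
  assert (Na := unit_minus_neq_0 om1 a Ho Ha). assert (Nb := unit_minus_neq_0 om1 b Ho Hb).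
  assert (Nc : (Cconj om1 - Cconj b)%C <> RtoC 0).
  { rewrite <- Cminus_conj. apply Cmod_gt_0. rewrite Cmod_conj. apply Cmod_gt_0, Nb. }
  assert (U : (om1 * Cconj om1)%C = RtoC 1) by (rewrite Cmult_conj_Cmod, Ho; f_equal; ring).
  replace (cayley om1 a + Cconj (cayley om1 b))%C
    with (RtoC 2 * (1 - Cconj b * a) / ((om1 - a) * Cconj (om1 - b)))%C.
  - rewrite Cmod_div, !Cmod_mult, Cmod_conj, Cmod_R, Rabs_right; trivial; try lra.
    apply Cmult_neq_0; trivial. rewrite Cminus_conj; exact Nc.
  - unfold cayley. rewrite Cdiv_conj by trivial. rewrite Cminus_conj, Cplus_conj.
    rewrite <- U. field. split; trivial.
Qed.

Lemma continuous_Cconj {T : UniformSpace} (f : T -> C) (x : T) :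
  continuous (U := C_UniformSpace) f x -> continuous (U := C_UniformSpace) (fun t => Cconj (f t)) x.
Proof.
  intros Hf. apply (continuous_pair (fun t => Re (f t)) (fun t => - Im (f t))).
  - apply continuous_Re, Hf.
  - apply (continuous_opp (V := R_NormedModule)), continuous_Im, Hf.
Qed.

Section Boundary.

Variables (phi : C -> C) (sigma : C).
Hypothesis Hphi : hol phi.
Hypothesis Hself : forall z, Cmod z < 1 -> Cmod (phi z) < 1.
Hypothesis Hsigma : Cmod sigma = 1.

Definition radially_julia : Prop :=
  exists K r0, 0 <= r0 < 1 /\ forall r, r0 <= r < 1 ->
    1 - Cmod (phi (RtoC r * sigma)) <= K * (1 - r).

Lemma Cmod_radius r : 0 <= r -> Cmod (RtoC r * sigma) = r.
Proof. intros Hr. rewrite Cmod_mult, Cmod_R, Rabs_right, Hsigma by lra. ring. Qed.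

Lemma Cmod_radius_minus r : r <= 1 -> Cmod (RtoC r * sigma - sigma) = 1 - r.
Proof.
  intros Hr. replace (RtoC r * sigma - sigma)%C with (RtoC (r - 1) * sigma)%C by (rewrite RtoC_minus; ring).
  rewrite Cmod_mult, Cmod_R, Rabs_left1, Hsigma by lra. ring.
Qed.

Lemma near_stolz_radius M d r : 1 < M -> 0 <= r < 1 -> 1 - r < d -> near_stolz sigma M d (RtoC r * sigma).
Proof.
  intros HM Hr Hd. unfold near_stolz, stolz.
  rewrite Cmod_radius, Cmod_radius_minus by lra. repeat split; try lra. nra.
Qed.

Lemma schwarz_pick_conj z w : Cmod z < 1 -> Cmod w < 1 ->
  Cmod (1 - Cconj (phi w) * phi z) ^ 2 * ((1 - Cmod z ^ 2) * (1 - Cmod w ^ 2))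
  <= Cmod (1 - Cconj w * z) ^ 2 * ((1 - Cmod (phi z) ^ 2) * (1 - Cmod (phi w) ^ 2)).
Proof.
  intros Hz Hw. assert (S := schwarz_pick_sqr phi Hphi Hself z w Hz Hw).
  assert (I1 := mob_identity w z). assert (I2 := mob_identity (phi w) (phi z)). nra.
Qed.

Lemma strongly_conformal_radially_julia : strongly_conformal_at phi sigma -> radially_julia.
Proof.
  intros [om [Hom [l Hl]]]. rewrite angular_lim_iff in Hl.
  destruct (Hl 2 1 ltac:(lra) ltac:(lra)) as [d [Hd K]].
  assert (Hm : Rmin 1 d <= 1) by apply Rmin_l. assert (Hm' : Rmin 1 d <= d) by apply Rmin_r.
  assert (Hm0 : 0 < Rmin 1 d) by (apply Rmin_pos; lra).
  exists (Cmod l + 1), (1 - Rmin 1 d / 2). split; [lra|].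
  intros r Hr. set (z := (RtoC r * sigma)%C).
  assert (Kz := K z ltac:(apply near_stolz_radius; lra)).
  assert (Hz : Cmod (z - sigma) = 1 - r) by (apply Cmod_radius_minus; lra).
  assert (Nz : (z - sigma)%C <> RtoC 0) by (apply Cmod_gt_0; lra).
  set (q := ((phi z - om) / (z - sigma))%C) in *.
  assert (Hq : Cmod q <= Cmod l + 1).
  { replace q with ((q - l) + l)%C by ring. eapply Rle_trans; [apply Cmod_triangle|]. lra. }
  assert (E : om = (phi z - q * (z - sigma))%C) by (unfold q; field; exact Nz).
  (* The bounded difference quotient puts [phi z] within [Cmod q * (1 - r)] of the unimodular
     [om]. *)
  assert (T : 1 <= Cmod (phi z) + Cmod q * (1 - r)).
  { rewrite <- Hz, <- Cmod_mult, <- Hom, E at 1. eapply Rle_trans; [apply Cmod_triangle|].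
    rewrite Cmod_opp. lra. }
  nra.
Qed.

Lemma cosine_radially_julia : angular_lim2 (kernel_cosine phi) sigma 1 -> radially_julia.
Proof.
  intros H. rewrite angular_lim2_iff in H.
  destruct (H 2 (1 / 2) ltac:(lra) ltac:(lra)) as [d [Hd K]].
  assert (Hm : Rmin 1 d <= 1) by apply Rmin_l. assert (Hm' : Rmin 1 d <= d) by apply Rmin_r.
  assert (Hm0 : 0 < Rmin 1 d) by (apply Rmin_pos; lra).
  set (r0 := 1 - Rmin 1 d / 2). set (w := (RtoC r0 * sigma)%C).
  assert (Hr0 : 0 <= r0 < 1) by (unfold r0; lra).
  assert (Ew : Cmod w = r0) by (apply Cmod_radius; lra).
  assert (Pw := sqr_lt_1 _ (Cmod_ge_0 w) ltac:(lra)).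
  assert (Fw := sqr_lt_1 _ (Cmod_ge_0 _) (Hself w ltac:(lra))).
  set (B := (1 - Cmod w) ^ 2 * (1 - Cmod (phi w) ^ 2)).
  assert (HB : 0 < B) by (apply Rmult_lt_0_compat; trivial; apply pow_lt; lra).
  (* 16 is the 4 from [Q^2 >= 1 / 4] times the bound [V^2 <= 4]; the 2 comes from
     [1 - r^2 <= 2 * (1 - r)]. [B] contains the lower bound [(1 - Cmod w)^2] for [U^2]. *)
  exists (2 * (16 * (1 - Cmod w ^ 2)) / B), r0. split; [lra|].
  intros r Hr. set (z := (RtoC r * sigma)%C).
  assert (Ez : Cmod z = r) by (apply Cmod_radius; lra).
  assert (Hz : Cmod z < 1) by lra. assert (Hw : Cmod w < 1) by lra.
  assert (Kz := K z w ltac:(apply near_stolz_radius; unfold r0 in *; lra)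
                      ltac:(apply near_stolz_radius; unfold r0 in *; lra)).
  apply Rabs_def2 in Kz.
  assert (S := kernel_cosine_sqr phi Hself z w Hz Hw).
  set (Q := kernel_cosine phi z w) in *.
  assert (HQ : 1 / 4 <= Q ^ 2) by nra.
  assert (Pz := sqr_lt_1 _ (Cmod_ge_0 z) Hz).
  assert (Fz := sqr_lt_1 _ (Cmod_ge_0 _) (Hself z Hz)).
  assert (N := mob_denominator w z Hw ltac:(lra)). apply Cmod_gt_0 in N.
  set (U := Cmod (1 - Cconj w * z)) in *. set (V := Cmod (1 - Cconj (phi w) * phi z)) in *.
  assert (HU : 1 - Cmod w <= U).
  { assert (T := Cmod_triangle (1 - Cconj w * z) (Cconj w * z)).
    replace (1 - Cconj w * z + Cconj w * z)%C with (RtoC 1) in T by ring.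
    rewrite Cmod_1, Cmod_mult, Cmod_conj in T. fold U in T.
    generalize (Cmod_ge_0 w) (Cmod_ge_0 z). nra. }
  assert (HV : V <= 2).
  { unfold V. eapply Rle_trans; [apply Cmod_triangle|]. rewrite Cmod_1, Cmod_opp, Cmod_mult, Cmod_conj.
    generalize (Hself z Hz) (Hself w Hw) (Cmod_ge_0 (phi z)) (Cmod_ge_0 (phi w)). nra. }
  assert (HV0 : 0 <= V) by apply Cmod_ge_0.
  assert (D : 0 < U ^ 2 * ((1 - Cmod (phi z) ^ 2) * (1 - Cmod (phi w) ^ 2))).
  { apply Rmult_lt_0_compat; [apply pow_lt; lra | apply Rmult_lt_0_compat; trivial]. }
  assert (S1 : 1 / 4 * (U ^ 2 * ((1 - Cmod (phi z) ^ 2) * (1 - Cmod (phi w) ^ 2)))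
               <= V ^ 2 * ((1 - Cmod z ^ 2) * (1 - Cmod w ^ 2))).
  { rewrite S in HQ. apply Rle_div_r in HQ; trivial. }
  assert (S2 : B * (1 - Cmod (phi z) ^ 2) <= 16 * (1 - Cmod w ^ 2) * (1 - Cmod z ^ 2)).
  { assert (T1 : (1 - Cmod w) ^ 2 <= U ^ 2) by (apply pow_incr; lra).
    assert (T2 : V ^ 2 <= 4) by nra.
    assert (T3 : (1 - Cmod w) ^ 2 * ((1 - Cmod (phi z) ^ 2) * (1 - Cmod (phi w) ^ 2))
        <= U ^ 2 * ((1 - Cmod (phi z) ^ 2) * (1 - Cmod (phi w) ^ 2))).
    { apply Rmult_le_compat_r; trivial. apply Rlt_le, Rmult_lt_0_compat; trivial. }
    assert (T4 : V ^ 2 * ((1 - Cmod z ^ 2) * (1 - Cmod w ^ 2)) <= 4 * ((1 - Cmod z ^ 2) * (1 - Cmod w ^ 2))).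
    { apply Rmult_le_compat_r; trivial. apply Rlt_le, Rmult_lt_0_compat; trivial. }
    unfold B. lra. }
  assert (Hfz := Hself z Hz). assert (Hfz0 := Cmod_ge_0 (phi z)).
  assert (S3 : B * (1 - Cmod (phi z)) <= 2 * (16 * (1 - Cmod w ^ 2)) * (1 - r)).
  { rewrite Ez in S2.
    assert (B * (1 - Cmod (phi z)) <= B * (1 - Cmod (phi z) ^ 2)) by (apply Rmult_le_compat_l; nra).
    assert (16 * (1 - Cmod w ^ 2) * (1 - r ^ 2) <= 16 * (1 - Cmod w ^ 2) * (2 * (1 - r))) by (apply Rmult_le_compat_l; nra).
    lra. }
  apply (Rmult_le_reg_l B); trivial. eapply Rle_trans; [exact S3|]. right. field. lra.
Qed.

(** On the radius, [1 - |phi|^2 <= K * (1 - r^2)] cancels the weights in Schwarz-Pick and makes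
    [phi] Lipschitz there, so [om] exists by completeness. Dividing [schwarz_pick_conj] at
    [w = r * sigma] by [1 - r^2] and letting [r] tend to 1 gives Julia's inequality. *)
Lemma radial_limit : radially_julia -> exists om K, Cmod om = 1 /\ 0 < K /\
  forall z, Cmod z < 1 ->
    (1 - Cmod z ^ 2) * Cmod (om - phi z) ^ 2 <= K * Cmod (sigma - z) ^ 2 * (1 - Cmod (phi z) ^ 2).
Proof.
  intros [K0 [r0 [Hr0 H0]]].
  (* 2 comes from [1 - f^2 <= 2 * (1 - f)]; [Rabs K0 + 1] makes the constant positive whatever [K0]
     is. *)
  set (K := 2 * (Rabs K0 + 1)).
  assert (HK : 0 < K) by (unfold K; generalize (Rabs_pos K0); lra).
  assert (H : forall r, r0 <= r < 1 -> 1 - Cmod (phi (RtoC r * sigma)) ^ 2 <= K * (1 - r ^ 2)).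
  { intros r Hr. specialize (H0 r Hr).
    assert (A := Hself (RtoC r * sigma)%C ltac:(rewrite Cmod_radius; lra)).
    assert (A0 := Cmod_ge_0 (phi (RtoC r * sigma))). set (f := Cmod (phi (RtoC r * sigma))) in *.
    assert (K0 * (1 - r) <= (Rabs K0 + 1) * (1 - r ^ 2)).
    { generalize (Rle_abs K0) (Rabs_pos K0). intros. apply Rle_trans with ((Rabs K0 + 1) * (1 - r)).
      - apply Rmult_le_compat_r; lra.
      - apply Rmult_le_compat_l; [lra | nra]. }
    unfold K. nra. }
  assert (L : forall r s, r0 <= r < 1 -> r0 <= s < 1 ->
     Cmod (phi (RtoC r * sigma) - phi (RtoC s * sigma)) <= K * Rabs (r - s)).
  { intros r s Hr Hs.
    assert (S := schwarz_pick_sqr phi Hphi Hself (RtoC r * sigma)%C (RtoC s * sigma)%C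
       ltac:(rewrite Cmod_radius; lra) ltac:(rewrite Cmod_radius; lra)).
    replace (RtoC r * sigma - RtoC s * sigma)%C with (RtoC (r - s) * sigma)%C in S by (rewrite RtoC_minus; ring).
    rewrite (Cmod_mult (RtoC (r - s))), Cmod_R, Hsigma, Rmult_1_r, !Cmod_radius in S by lra.
    assert (A := H r Hr). assert (B := H s Hs).
    assert (Ar := sqr_lt_1 _ (Cmod_ge_0 _) (Hself (RtoC r * sigma)%C ltac:(rewrite Cmod_radius; lra))).
    assert (As := sqr_lt_1 _ (Cmod_ge_0 _) (Hself (RtoC s * sigma)%C ltac:(rewrite Cmod_radius; lra))).
    set (D := Cmod (phi (RtoC r * sigma) - phi (RtoC s * sigma))) in *.
    assert (Pr : 0 < 1 - r ^ 2) by nra. assert (Ps : 0 < 1 - s ^ 2) by nra.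
    assert (HD : D ^ 2 <= (K * Rabs (r - s)) ^ 2).
    { apply (Rmult_le_reg_r ((1 - r ^ 2) * (1 - s ^ 2))); [apply Rmult_lt_0_compat; trivial|].
      eapply Rle_trans; [exact S|].
      replace ((K * Rabs (r - s)) ^ 2 * ((1 - r ^ 2) * (1 - s ^ 2)))
        with (Rabs (r - s) ^ 2 * ((K * (1 - r ^ 2)) * (K * (1 - s ^ 2)))) by ring.
      apply Rmult_le_compat_l; [apply pow2_ge_0|]. apply Rmult_le_compat; lra. }
    assert (0 <= K * Rabs (r - s)) by (apply Rmult_le_pos; [lra | apply Rabs_pos]).
    apply Rnot_lt_le. intro Hlt. assert (T : 0 <= D) by apply Cmod_ge_0. nra. }
  destruct (proj1 (filterlim_locally_cauchy (U := C_R_CompleteNormedModule) (F := at_left 1)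
     (fun r => phi (RtoC r * sigma)%C))) as [om Hom].
  { intros eps. set (d := Rmin (1 - r0) (eps / K)).
    assert (Hd : 0 < d) by (apply Rmin_pos; [lra | apply Rdiv_lt_0_compat; trivial; apply cond_pos]).
    assert (Hd1 : d <= 1 - r0) by apply Rmin_l. assert (Hd2 : d <= eps / K) by apply Rmin_r.
    exists (fun r => 1 - d < r < 1). split.
    - exists (mkposreal d Hd). intros r Hr Hr1. apply Rabs_def2 in Hr.
      unfold minus, plus, opp in Hr; simpl in Hr. lra.
    - intros u v Hu Hv. apply C_NormedModule_mixin_compat1.
      eapply Rle_lt_trans; [apply (L v u); lra|].
      apply Rlt_le_trans with (K * d).
      + apply Rmult_lt_compat_l; trivial. apply Rabs_def1; lra.
      + apply Rle_trans with (K * (eps / K)); [apply Rmult_le_compat_l; lra | right; field; lra]. }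
  exists om, K.
  assert (Hlim : forall (h : C -> R), continuous (T := C_UniformSpace) h om ->
     filterlim (fun r => h (phi (RtoC r * sigma)%C)) (at_left 1) (locally (h om))).
  { intros h Hh. eapply filterlim_comp; [exact Hom | exact Hh]. }
  assert (near1 : at_left 1 (fun r => r0 <= r < 1)).
  { exists (mkposreal (1 - r0) ltac:(lra)). intros r Hr Hr1. apply Rabs_def2 in Hr.
    unfold minus, plus, opp in Hr; simpl in Hr. lra. }
  assert (Hreal : forall h : R -> R, continuous h 1 -> filterlim h (at_left 1) (locally (h 1))).
  { intros h Hh. eapply filterlim_filter_le_1; [|exact Hh]. apply filter_le_within. }
  assert (Hom1 : Cmod om = 1).
  { apply Rle_antisym.
    - apply (filterlim_le (F := at_left 1) (fun r => Cmod (phi (RtoC r * sigma))) (fun _ => 1) (Cmod om) 1).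
      + revert near1. apply filter_imp. intros r Hr. apply Rlt_le, Hself. rewrite Cmod_radius; lra.
      + apply (Hlim Cmod), continuous_Cmod, continuous_id.
      + apply filterlim_const.
    - replace 1 with (1 - K0 * (1 - 1)) by ring.
      apply (filterlim_le (F := at_left 1) (fun r => 1 - K0 * (1 - r)) (fun r => Cmod (phi (RtoC r * sigma))) (1 - K0 * (1 - 1)) (Cmod om)).
      + revert near1. apply filter_imp. intros r Hr. specialize (H0 r Hr). lra.
      + apply (Hreal (fun r => 1 - K0 * (1 - r))).
        apply (ex_derive_continuous (V := R_NormedModule)). auto_derive; trivial.
      + apply (Hlim Cmod), continuous_Cmod, continuous_id. }
  split; [exact Hom1|]. split; [exact HK|]. intros z Hz.
  (* At the boundary the kernel denominator is a distance, so the kernel form, which passes to the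
     limit, yields the stated one. *)
  assert (unit_dist : forall a b, Cmod a = 1 -> Cmod (1 - Cconj a * b) = Cmod (a - b)).
  { intros a b Ha.
    replace (1 - Cconj a * b)%C with (Cconj a * (a - b))%C.
    - rewrite Cmod_mult, Cmod_conj, Ha. ring.
    - replace (RtoC 1) with (a * Cconj a)%C by (rewrite Cmult_conj_Cmod, Ha; f_equal; ring). ring. }
  rewrite <- (unit_dist om), <- (unit_dist sigma) by trivial.
  assert (Fz := sqr_lt_1 _ (Cmod_ge_0 _) (Hself z Hz)).
  apply (filterlim_le (F := at_left 1)
    (fun r => (1 - Cmod z ^ 2) * Cmod (1 - Cconj (phi (RtoC r * sigma)) * phi z) ^ 2)
    (fun r => K * Cmod (1 - Cconj (RtoC r * sigma) * z) ^ 2 * (1 - Cmod (phi z) ^ 2))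
    ((1 - Cmod z ^ 2) * Cmod (1 - Cconj om * phi z) ^ 2)
    (K * Cmod (1 - Cconj sigma * z) ^ 2 * (1 - Cmod (phi z) ^ 2))).
  - revert near1. apply filter_imp. intros r Hr.
    assert (S := schwarz_pick_conj z (RtoC r * sigma)%C Hz ltac:(rewrite Cmod_radius; lra)).
    rewrite (Cmod_radius r) in S by lra.
    assert (A := H r Hr). assert (Pr : 0 < 1 - r ^ 2) by nra.
    apply (Rmult_le_reg_r (1 - r ^ 2)); trivial.
    set (V := Cmod (1 - Cconj (phi (RtoC r * sigma)) * phi z)) in *.
    set (U := Cmod (1 - Cconj (RtoC r * sigma) * z)) in *.
    apply Rle_trans with (U ^ 2 * ((1 - Cmod (phi z) ^ 2) * (K * (1 - r ^ 2)))); [|right; ring].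
    eapply Rle_trans; [|eapply Rle_trans; [exact S|]]; [right; ring|].
    apply Rmult_le_compat_l; [apply pow2_ge_0|]. apply Rmult_le_compat_l; lra.
  - apply (Hlim (fun u => (1 - Cmod z ^ 2) * Cmod (1 - Cconj u * phi z) ^ 2)).
    apply continuous_Rmult; [apply continuous_const|].
    assert (Hc : continuous (T := C_UniformSpace) (fun u => Cmod (1 - Cconj u * phi z)) om).
    { apply continuous_Cmod, continuous_Cminus; [apply continuous_const|].
      apply continuous_Cmult; [|apply continuous_const]. apply continuous_Cconj, continuous_id. }
    apply continuous_sqr, Hc.
  - replace (Cmod (1 - Cconj sigma * z)) with (Cmod (1 - Cconj (RtoC 1 * sigma) * z)) by (do 4 f_equal; ring).
    apply (Hreal (fun r => K * Cmod (1 - Cconj (RtoC r * sigma) * z) ^ 2 * (1 - Cmod (phi z) ^ 2))).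
    assert (Hc : continuous (fun r : R => Cmod (1 - Cconj (RtoC r * sigma) * z)) 1).
    { apply continuous_Cmod, continuous_Cminus; [apply continuous_const|].
      apply continuous_Cmult; [|apply continuous_const].
      apply continuous_Cconj, continuous_Cmult; [|apply continuous_const]. apply continuous_RtoC, continuous_id. }
    apply continuous_Rmult; [|apply continuous_const]. apply continuous_Rmult; [apply continuous_const|].
    apply continuous_sqr, Hc.
Qed.

End Boundary.

(** * The Julia-Caratheodory theorem *)

Section JuliaCaratheodory.

Variables (phi : C -> C) (sigma : C).
Hypothesis Hphi : hol phi.
Hypothesis Hself : forall z, Cmod z < 1 -> Cmod (phi z) < 1.
Hypothesis Hsigma : Cmod sigma = 1.

Lemma Re_cayley_pos om z : Cmod om = 1 -> Cmod z < 1 -> 0 < Re (cayley om z).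
Proof.
  intros Ho Hz. rewrite Re_cayley by trivial. apply Rdiv_lt_0_compat.
  - apply sqr_lt_1; trivial; apply Cmod_ge_0.
  - apply pow_lt, Cmod_gt_0, unit_minus_neq_0; trivial.
Qed.

Lemma hol_cayley om f : Cmod om = 1 -> hol f -> (forall z, Cmod z < 1 -> Cmod (f z) < 1) ->
  hol (fun z => cayley om (f z)).
Proof.
  intros Ho Hf Hs z Hz. apply Cdiffable_div.
  - apply Cdiffable_plus; [apply Cdiffable_const | apply Hf, Hz].
  - apply Cdiffable_minus; [apply Cdiffable_const | apply Hf, Hz].
  - apply unit_minus_neq_0; auto.
Qed.

(** The last clause is [F / Z -> c] in Stolz regions with the division cleared: [|Z|] behaves like
    [2 / |sigma - z|] near [sigma]. *)
Definition julia_caratheodory_data (om : C) (c : R) : Prop :=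
  Cmod om = 1 /\ 0 < c /\
  (forall z, Cmod z < 1 -> c * Re (cayley sigma z) <= Re (cayley om (phi z))) /\
  forall M eta, 1 < M -> 0 < eta -> exists d, 0 < d /\ forall z, near_stolz sigma M d z ->
    Cmod (sigma - z) * Cmod (cayley om (phi z) - RtoC c * cayley sigma z) <= eta.

(** [c] is the supremum of the constants admissible in Julia's inequality: positive because [/ K] is
    admissible, finite because of the ratio at 0. Near-optimality at interior points is the only
    form in which maximality is used. *)
Lemma julia_constant : radially_julia phi sigma -> exists om c, Cmod om = 1 /\ 0 < c /\
  (forall z, Cmod z < 1 -> c * Re (cayley sigma z) <= Re (cayley om (phi z))) /\
  forall e, 0 < e -> exists z, Cmod z < 1 /\ Re (cayley om (phi z)) < (c + e) * Re (cayley sigma z).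
Proof.
  intros H. destruct (radial_limit phi sigma Hphi Hself Hsigma H) as [om [K [Hom [HK J]]]].
  assert (J' : forall z, Cmod z < 1 -> / K * Re (cayley sigma z) <= Re (cayley om (phi z))).
  { intros z Hz. rewrite !Re_cayley by auto. specialize (J z Hz).
    assert (A := proj1 (Cmod_gt_0 _) (unit_minus_neq_0 sigma z Hsigma Hz)).
    assert (B := proj1 (Cmod_gt_0 _) (unit_minus_neq_0 om (phi z) Hom (Hself z Hz))).
    apply (proj1 (Rle_div_r _ _ _ (pow_lt _ 2 B))).
    apply (Rmult_le_reg_l (K * Cmod (sigma - z) ^ 2)); [apply Rmult_lt_0_compat; [trivial | apply pow_lt, A]|].
    eapply Rle_trans; [|exact J]. right. field. split; lra. }
  destruct (completeness (fun x => forall z, Cmod z < 1 -> x * Re (cayley sigma z) <= Re (cayley om (phi z)))) as [c [Hc1 Hc2]].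
  - exists (Re (cayley om (phi (RtoC 0))) / Re (cayley sigma (RtoC 0))). intros x Hx.
    assert (H0 : Cmod (RtoC 0) < 1) by (rewrite Cmod_0; lra).
    apply Rle_div_r; [apply Re_cayley_pos; trivial | apply Hx, H0].
  - exists (/ K). exact J'.
  - exists om, c. split; [exact Hom|]. split.
    + apply Rlt_le_trans with (/ K); [apply Rinv_0_lt_compat, HK|]. apply Hc1. exact J'.
    + split.
      * intros z Hz. assert (P := Re_cayley_pos sigma z Hsigma Hz).
        apply Rle_div_r; trivial. apply Hc2. intros x Hx. apply Rle_div_r; trivial. apply Hx, Hz.
      * intros e He. apply Classical_Prop.NNPP. intros N.
        assert (c + e <= c); [|lra]. apply Hc1. intros z Hz. apply Rnot_lt_le. intro L.
        apply N. exists z; auto.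
Qed.

(* Schwarz-Pick for [G = F - c Z] between [z] and a point [z0] where [Re F / Re Z]
   is almost minimal. *)
Lemma julia_caratheodory : radially_julia phi sigma -> exists om c, julia_caratheodory_data om c.
Proof.
  intros H. destruct (julia_constant H) as [om [c [Hom [Hc [J I]]]]].
  exists om, c. split; [exact Hom|]. split; [exact Hc|]. split; [exact J|].
  intros M eta HM Heta.
  set (G := fun z => (cayley om (phi z) - RtoC c * cayley sigma z)%C).
  assert (HG : hol G).
  { intros z Hz. apply Cdiffable_minus; [apply (hol_cayley om phi); trivial|].
    apply Cdiffable_mult; [apply Cdiffable_const|].
    apply (hol_cayley sigma (fun z => z)); trivial. intros u _; apply Cdiffable_id. }
  assert (EG : forall z, Re (G z) = Re (cayley om (phi z)) - c * Re (cayley sigma z)).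
  { intros z. unfold G. rewrite (Cmult_comm (RtoC c)). unfold Cminus.
    rewrite re_plus, re_opp, Re_mult_RtoC. ring. }
  assert (PG : forall z, Cmod z < 1 -> 0 <= Re (G z)).
  { intros z Hz. rewrite EG. specialize (J z Hz). lra. }
  (* Below, [(X / 2)^2 * t <= 16 * e * M * X], hence [t * X <= 64 * e * M = eta]. *)
  set (e := eta / (64 * M)).
  assert (He : 0 < e) by (apply Rdiv_lt_0_compat; lra).
  destruct (I e He) as [z0 [Hz0 Hz0e]].
  assert (N0 := proj1 (Cmod_gt_0 _) (unit_minus_neq_0 sigma z0 Hsigma Hz0)).
  set (g0 := Cmod (G z0)). assert (Hg0 : 0 <= g0) by apply Cmod_ge_0.
  (* The first bound gives [|z - z0| <= 2 * |sigma - z0|]; the second settles the case where [G z]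
     is not much larger than [G z0]. *)
  set (d := Rmin (Cmod (sigma - z0)) (eta / (2 * (g0 + 1)))).
  assert (Hd2 : 0 < eta / (2 * (g0 + 1))) by (apply Rdiv_lt_0_compat; lra).
  assert (D1 : d <= Cmod (sigma - z0)) by apply Rmin_l.
  assert (D2 : d <= eta / (2 * (g0 + 1))) by apply Rmin_r.
  exists d. split; [apply Rmin_pos; trivial|].
  intros z [[Hz HS] Hzd]. fold (G z).
  assert (Nz := proj1 (Cmod_gt_0 _) (unit_minus_neq_0 sigma z Hsigma Hz)).
  replace (Cmod (z - sigma)) with (Cmod (sigma - z)) in HS, Hzd by (rewrite <- Cmod_opp; f_equal; ring).
  set (t := Cmod (sigma - z)) in *. set (X := Cmod (G z)).
  assert (HX : 0 <= X) by apply Cmod_ge_0.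
  assert (S := half_plane_schwarz_pick G z z0 HG PG Hz Hz0).
  assert (P0 := sqr_lt_1 _ (Cmod_ge_0 z0) Hz0).
  assert (A1 : Re (G z0) * Cmod (sigma - z0) ^ 2 <= e * (1 - Cmod z0 ^ 2)).
  { apply Rle_trans with (e * Re (cayley sigma z0) * Cmod (sigma - z0) ^ 2).
    - apply Rmult_le_compat_r; [apply pow2_ge_0|]. rewrite EG. lra.
    - right. rewrite Re_cayley by trivial. field. lra. }
  assert (A2 : Cmod (z - z0) <= 2 * Cmod (sigma - z0)).
  { replace (z - z0)%C with ((sigma - z0) + - (sigma - z))%C by ring.
    eapply Rle_trans; [apply Cmod_triangle|]. rewrite Cmod_opp. fold t. lra. }
  assert (A3 : Re (G z) <= X) by (eapply Rle_trans; [apply Rle_abs | apply re_le_Cmod]).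
  assert (A4 : (X - g0) ^ 2 <= Cmod (G z - G z0) ^ 2).
  { assert (T1 : X <= Cmod (G z - G z0) + g0).
    { unfold X. replace (G z) with ((G z - G z0) + G z0)%C at 1 by ring. apply Cmod_triangle. }
    assert (T2 : g0 <= Cmod (G z - G z0) + X).
    { unfold g0. replace (G z0) with (- (G z - G z0) + G z)%C at 1 by ring.
      eapply Rle_trans; [apply Cmod_triangle|]. rewrite Cmod_opp. apply Rle_refl. }
    rewrite <- (pow2_abs (X - g0)). apply pow_incr. split; [apply Rabs_pos|]. apply Rabs_le. lra. }
  assert (A5 : Cmod (z - z0) ^ 2 <= 4 * Cmod (sigma - z0) ^ 2).
  { replace (4 * Cmod (sigma - z0) ^ 2) with ((2 * Cmod (sigma - z0)) ^ 2) by ring.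
    apply pow_incr. split; [apply Cmod_ge_0 | exact A2]. }
  assert (A6 : t <= M * (1 - Cmod z ^ 2)).
  { assert (1 - Cmod z <= 1 - Cmod z ^ 2) by (generalize (Cmod_ge_0 z); nra).
    apply Rlt_le. eapply Rlt_le_trans; [exact HS|]. apply Rmult_le_compat_l; lra. }
  assert (B : (X - g0) ^ 2 * t <= 16 * e * M * X).
  { assert (B1 : Cmod (G z - G z0) ^ 2 * (1 - Cmod z ^ 2) * (1 - Cmod z0 ^ 2) <= 16 * X * e * (1 - Cmod z0 ^ 2)).
    { rewrite Rmult_assoc. eapply Rle_trans; [exact S|].
      assert (P00 := PG z0 Hz0). assert (Pz0 := PG z Hz).
      apply Rle_trans with (4 * (4 * Cmod (sigma - z0) ^ 2) * (X * Re (G z0))).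
      - apply Rmult_le_compat.
        + generalize (pow2_ge_0 (Cmod (z - z0))); lra.
        + apply Rmult_le_pos; trivial.
        + lra.
        + apply Rmult_le_compat_r; trivial.
      - replace (4 * (4 * Cmod (sigma - z0) ^ 2) * (X * Re (G z0)))
          with (16 * X * (Re (G z0) * Cmod (sigma - z0) ^ 2)) by ring.
        rewrite (Rmult_assoc (16 * X)). apply Rmult_le_compat_l; lra. }
    apply Rmult_le_reg_r in B1; trivial.
    apply Rle_trans with (Cmod (G z - G z0) ^ 2 * (M * (1 - Cmod z ^ 2))).
    - apply Rmult_le_compat; trivial; [apply pow2_ge_0 | lra].
    - replace (Cmod (G z - G z0) ^ 2 * (M * (1 - Cmod z ^ 2))) with (M * (Cmod (G z - G z0) ^ 2 * (1 - Cmod z ^ 2))) by ring.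
      replace (16 * e * M * X) with (M * (16 * X * e)) by ring. apply Rmult_le_compat_l; lra. }
  assert (Eg : t * (2 * (g0 + 1)) <= eta).
  { apply Rlt_le in Hzd. apply Rle_trans with (eta / (2 * (g0 + 1)) * (2 * (g0 + 1))).
    - apply Rmult_le_compat_r; lra.
    - right. field. lra. }
  assert (Ee : 64 * e * M = eta) by (unfold e; field; lra).
  (* Either [|G z|] is bounded by twice the fixed [|G z0|] and the factor [t] is small enough, or
     [X - g0 >= X / 2] and the quadratic inequality [B] bounds [t * X]. *)
  destruct (Rle_lt_dec X (2 * g0)) as [L|L].
  - apply Rle_trans with (t * (2 * (g0 + 1))); [apply Rmult_le_compat_l; lra | exact Eg].
  - assert (HX0 : 0 < X) by lra.
    assert (Q : (X / 2) ^ 2 <= (X - g0) ^ 2) by (apply pow_incr; lra).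
    apply (Rmult_le_reg_r (X / 4)); [lra|].
    apply Rle_trans with ((X / 2) ^ 2 * t); [right; field|].
    apply Rle_trans with ((X - g0) ^ 2 * t); [apply Rmult_le_compat_r; lra|].
    eapply Rle_trans; [exact B|]. right. rewrite <- Ee. field.
Qed.

Variables (om : C) (c : R).
Hypothesis data : julia_caratheodory_data om c.

Let Hom : Cmod om = 1 := proj1 data.
Let Hc : 0 < c := proj1 (proj2 data).

(** In a Stolz region [Re Z] is at least a multiple of [1 / |sigma - z|], so an error that is small
    against [1 / |sigma - z|] is small against [Re Z]. *)
Lemma stolz_Re_cayley M d z : 1 < M -> near_stolz sigma M d z ->
  1 <= M * (Cmod (sigma - z) * Re (cayley sigma z)).
Proof.
  intros HM [[Hz HS] _]. rewrite Re_cayley by trivial.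
  replace (Cmod (z - sigma)) with (Cmod (sigma - z)) in HS by (rewrite <- Cmod_opp; f_equal; ring).
  assert (Nz := proj1 (Cmod_gt_0 _) (unit_minus_neq_0 sigma z Hsigma Hz)).
  set (t := Cmod (sigma - z)) in *.
  replace (M * (t * ((1 - Cmod z ^ 2) / t ^ 2))) with (M * (1 - Cmod z ^ 2) / t) by (field; lra).
  apply Rle_div_r; trivial. rewrite Rmult_1_l.
  assert (1 - Cmod z <= 1 - Cmod z ^ 2) by (generalize (Cmod_ge_0 z); nra).
  apply Rlt_le. eapply Rlt_le_trans; [exact HS|]. apply Rmult_le_compat_l; lra.
Qed.

Lemma julia_caratheodory_strongly_conformal : strongly_conformal_at phi sigma.
Proof.
  destruct (proj2 (proj2 data)) as [J L].
  (* [F + 1 = 2 * om / (om - phi z)] and [Z + 1 = 2 * sigma / (sigma - z)], so [F / Z -> c] forces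
     this value of the limit. *)
  exists om. split; [exact Hom|]. exists (om / (sigma * RtoC c))%C.
  apply angular_lim_iff. intros M eps HM Heps.
  (* After multiplication by [t], the two terms of the numerator are at most [k] each, while [eps]
     times the denominator is at least [eps * c * (c / M) = 4 * k]. The bound [d'] takes care of the
     term with [c - 1]. *)
  set (k := c ^ 2 * / M * eps / 4).
  assert (Hk : 0 < k).
  { unfold k. apply Rdiv_lt_0_compat; [|lra]. apply Rmult_lt_0_compat; trivial.
    apply Rmult_lt_0_compat; [apply pow_lt, Hc | apply Rinv_0_lt_compat; lra]. }
  destruct (L M k HM Hk) as [d [Hd K]].
  set (d' := Rmin d (k / (Rabs (c - 1) + 1))).
  assert (Ha := Rabs_pos (c - 1)).
  exists d'. split; [apply Rmin_pos; trivial; apply Rdiv_lt_0_compat; lra|].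
  intros z [Hz Hzd].
  assert (Hz1 := Rlt_le_trans _ _ _ Hzd (Rmin_l _ _)). assert (Hz2 := Rlt_le_trans _ _ _ Hzd (Rmin_r _ _)).
  specialize (K z (conj Hz Hz1)).
  assert (SR := stolz_Re_cayley M d z HM (conj Hz Hz1)).
  assert (Hz0 : Cmod z < 1) by apply Hz.
  assert (Ns := unit_minus_neq_0 sigma z Hsigma Hz0).
  assert (No := unit_minus_neq_0 om (phi z) Hom (Hself z Hz0)).
  assert (Nsig : sigma <> RtoC 0) by (intro E; rewrite E, Cmod_0 in Hsigma; lra).
  assert (Nom : om <> RtoC 0) by (intro E; assert (T := Hom); rewrite E, Cmod_0 in T; lra).
  assert (Nc : RtoC c <> RtoC 0) by (apply RtoC_neq_0; lra).
  assert (Nz' : (z - sigma)%C <> RtoC 0).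
  { intro E. apply Ns. replace (sigma - z)%C with (- (z - sigma))%C by ring. rewrite E. ring. }
  replace (Cmod (z - sigma)) with (Cmod (sigma - z)) in Hz2 by (rewrite <- Cmod_opp; f_equal; ring).
  specialize (J z Hz0).
  set (F := cayley om (phi z)) in *. set (Z := cayley sigma z) in *. set (t := Cmod (sigma - z)) in *.
  assert (Ht : 0 < t) by (apply Cmod_gt_0, Ns).
  assert (HF : c / M <= t * Cmod (F + 1)).
  { apply Rle_trans with (t * (c * Re Z)).
    - apply Rle_div_l; [lra|]. replace (t * (c * Re Z) * M) with (c * (M * (t * Re Z))) by ring.
      rewrite <- (Rmult_1_r c) at 1. apply Rmult_le_compat_l; lra.
    - apply Rmult_le_compat_l; [lra|]. eapply Rle_trans; [exact J|].
      apply Rle_trans with (Re (F + 1)%C); [rewrite re_plus; simpl; lra|].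
      eapply Rle_trans; [apply Rle_abs | apply re_le_Cmod]. }
  assert (HcM : 0 < c / M) by (apply Rdiv_lt_0_compat; lra).
  assert (HF0 : 0 < Cmod (F + 1)).
  { apply Rnot_le_lt. intro Hle. assert (t * Cmod (F + 1) <= 0) by nra. lra. }
  assert (NF := proj2 (Cmod_gt_0 _) HF0).
  assert (E : ((phi z - om) / (z - sigma) - om / (sigma * RtoC c))%C =
     (om / sigma * (- (F - RtoC c * Z) + RtoC (c - 1)) / (RtoC c * (F + 1)))%C).
  { assert (E1 : (F + 1)%C = (2 * om / (om - phi z))%C) by (unfold F, cayley; field; exact No).
    assert (E2 : (F - RtoC c * Z)%C = (F + 1 - RtoC c * (2 * sigma / (sigma - z)) + RtoC (c - 1))%C).
    { unfold Z, cayley. rewrite RtoC_minus. field. exact Ns. }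
    rewrite E2, E1. field. repeat split; trivial. }
  rewrite E. rewrite Cmod_div, !Cmod_mult, Cmod_div, Hom, Hsigma, Cmod_R, (Rabs_right c) by (trivial; try lra; apply Cmult_neq_0; trivial).
  apply Rlt_div_l; [apply Rmult_lt_0_compat; trivial|].
  apply (Rmult_lt_reg_l t); trivial.
  apply Rle_lt_trans with (2 * k).
  - rewrite Rdiv_1_r, Rmult_1_l.
    apply Rle_trans with (t * (Cmod (F - RtoC c * Z) + Rabs (c - 1))).
    + apply Rmult_le_compat_l; [lra|]. eapply Rle_trans; [apply Cmod_triangle|]. rewrite Cmod_opp, Cmod_R. lra.
    + assert (t * Rabs (c - 1) <= k); [|lra].
      apply Rle_trans with (k / (Rabs (c - 1) + 1) * (Rabs (c - 1) + 1)).
      * apply Rmult_le_compat; lra.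
      * right. field. lra.
  - assert (T : eps * c * (c / M) <= eps * c * (t * Cmod (F + 1))) by (apply Rmult_le_compat_l; trivial; apply Rlt_le, Rmult_lt_0_compat; trivial).
    replace (eps * c * (c / M)) with (4 * k) in T by (unfold k; field; lra). lra.
Qed.

(** In half-plane coordinates [Q^2 = |F z + conj (F w)|^2 * Re Z * Re W / (|Z + conj W|^2 * Re (F z)
    * Re (F w))], where [Z] and [W] are the transforms of [z] and [w]. The errors [e * c * Re Z] and
    [e * c * Re W] are absorbed because [Re Z + Re W <= |Z + conj W|], whatever the relative
    position of [z] and [w]. *)
Lemma julia_caratheodory_cosine : angular_lim2 (kernel_cosine phi) sigma 1.
Proof.
  destruct (proj2 (proj2 data)) as [J L].
  apply angular_lim2_iff. intros M eps HM Heps.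
  (* The final estimate [1 - e <= Q * (1 + e)] with [Q <= 1] gives [1 - Q <= 2 * e <= eps / 2]. *)
  set (e := Rmin (1 / 2) (eps / 4)).
  assert (He : 0 < e) by (apply Rmin_pos; lra).
  assert (He1 : e <= 1 / 2) by apply Rmin_l. assert (He2 : e <= eps / 4) by apply Rmin_r.
  set (eta := e * c / M).
  assert (Heta : 0 < eta) by (apply Rdiv_lt_0_compat; [apply Rmult_lt_0_compat; trivial | lra]).
  destruct (L M eta HM Heta) as [d [Hd K]]. exists d. split; trivial.
  set (F := fun z => cayley om (phi z)). set (Z := cayley sigma).
  assert (B : forall z, near_stolz sigma M d z -> Cmod (F z - RtoC c * Z z) <= e * c * Re (Z z)).
  { intros z Hz. specialize (K z Hz). assert (SR := stolz_Re_cayley M d z HM Hz).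
    fold (F z) (Z z) in K. fold (Z z) in SR.
    assert (Ht := proj1 (Cmod_gt_0 _) (unit_minus_neq_0 sigma z Hsigma (proj1 (proj1 Hz)))).
    set (t := Cmod (sigma - z)) in *.
    apply (Rmult_le_reg_l t); trivial. eapply Rle_trans; [exact K|].
    unfold eta. apply Rle_div_l; [lra|].
    replace (t * (e * c * Re (Z z)) * M) with (e * c * (M * (t * Re (Z z)))) by ring.
    rewrite <- (Rmult_1_r (e * c)) at 1. apply Rmult_le_compat_l; trivial.
    apply Rlt_le, Rmult_lt_0_compat; trivial. }
  intros z w Hz Hw. assert (Bz := B z Hz). assert (Bw := B w Hw).
  assert (Hz0 : Cmod z < 1) by apply Hz. assert (Hw0 : Cmod w < 1) by apply Hw.
  assert (PZ := Re_cayley_pos sigma z Hsigma Hz0). assert (PW := Re_cayley_pos sigma w Hsigma Hw0).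
  assert (PFz := Re_cayley_pos om (phi z) Hom (Hself z Hz0)).
  assert (PFw := Re_cayley_pos om (phi w) Hom (Hself w Hw0)).
  fold (Z z) in PZ. fold (Z w) in PW. fold (F z) in PFz. fold (F w) in PFw.
  assert (U : forall u, Cmod (F u - RtoC c * Z u) <= e * c * Re (Z u) -> Re (F u) <= (1 + e) * c * Re (Z u)).
  { intros u Hu. assert (T := re_le_Cmod (F u - RtoC c * Z u)).
    assert (T' := Rle_abs (Re (F u - RtoC c * Z u)%C)).
    assert (E : Re (F u - RtoC c * Z u)%C = Re (F u) - c * Re (Z u)).
    { rewrite (Cmult_comm (RtoC c)). unfold Cminus. rewrite re_plus, re_opp, Re_mult_RtoC. ring. }
    lra. }
  assert (Uz := U z Bz). assert (Uw := U w Bw).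
  set (A := Cmod (F z + Cconj (F w))). set (D := Cmod (Z z + Cconj (Z w))).
  assert (HD : Re (Z z) + Re (Z w) <= D).
  { eapply Rle_trans; [|apply (Rle_trans _ _ _ (Rle_abs _) (re_le_Cmod _))].
    rewrite re_plus, re_conj. lra. }
  assert (HA : c * D <= A + e * c * (Re (Z z) + Re (Z w))).
  { replace (c * D) with (Cmod (RtoC c * (Z z + Cconj (Z w)))) by (rewrite Cmod_mult, Cmod_R, Rabs_right by lra; reflexivity).
    replace (RtoC c * (Z z + Cconj (Z w)))%C with
      ((F z + Cconj (F w)) + - ((F z - RtoC c * Z z) + Cconj (F w - RtoC c * Z w)))%C.
    - eapply Rle_trans; [apply Cmod_triangle|]. fold A. rewrite Cmod_opp.
      apply Rplus_le_compat_l. eapply Rle_trans; [apply Cmod_triangle|]. rewrite Cmod_conj. lra.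
    - rewrite Cminus_conj, Cmult_conj.
      replace (Cconj (RtoC c)) with (RtoC c) by (unfold Cconj, RtoC; simpl; f_equal; ring). ring. }
  assert (HA2 : (1 - e) * c * D <= A).
  { assert (e * c * (Re (Z z) + Re (Z w)) <= e * c * D) by (apply Rmult_le_compat_l; trivial; apply Rlt_le, Rmult_lt_0_compat; trivial). lra. }
  assert (HD0 : 0 < D) by lra.
  assert (S := kernel_cosine_sqr phi Hself z w Hz0 Hw0).
  destruct (kernel_cosine_hyp_dist phi Hphi Hself z w Hz0 Hw0) as [Q1 _].
  assert (Q0 := kernel_cosine_pos phi Hself z w Hz0 Hw0).
  set (Q := kernel_cosine phi z w) in *.
  assert (S' : Q ^ 2 * (Re (F z) * Re (F w)) * D ^ 2 = A ^ 2 * (Re (Z z) * Re (Z w))).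
  { rewrite S. unfold A, D, F, Z.
    rewrite !cayley_plus_conj, !Re_cayley by auto.
    assert (T1 := proj1 (Cmod_gt_0 _) (unit_minus_neq_0 sigma z Hsigma Hz0)).
    assert (T2 := proj1 (Cmod_gt_0 _) (unit_minus_neq_0 sigma w Hsigma Hw0)).
    assert (T3 := proj1 (Cmod_gt_0 _) (unit_minus_neq_0 om (phi z) Hom (Hself z Hz0))).
    assert (T4 := proj1 (Cmod_gt_0 _) (unit_minus_neq_0 om (phi w) Hom (Hself w Hw0))).
    assert (T5 := proj1 (Cmod_gt_0 _) (mob_denominator w z Hw0 ltac:(lra))).
    assert (T6 := sqr_lt_1 _ (Cmod_ge_0 _) (Hself z Hz0)).
    assert (T7 := sqr_lt_1 _ (Cmod_ge_0 _) (Hself w Hw0)).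
    field. repeat split; lra. }
  assert (Hlow : (1 - e) <= Q * (1 + e)).
  { apply Rnot_lt_le. intro Hlt.
    assert (C1 : (Q * (1 + e)) ^ 2 < (1 - e) ^ 2) by (assert (0 <= Q * (1 + e)) by nra; nra).
    assert (C2 : Re (F z) * Re (F w) <= ((1 + e) * c * Re (Z z)) * ((1 + e) * c * Re (Z w))) by (apply Rmult_le_compat; lra).
    assert (C3 : ((1 - e) * c * D) ^ 2 <= A ^ 2).
    { apply pow_incr. split; trivial. apply Rmult_le_pos; [apply Rmult_le_pos|]; lra. }
    assert (PZW : 0 < Re (Z z) * Re (Z w)) by (apply Rmult_lt_0_compat; trivial).
    assert (C4 : ((1 - e) * c * D) ^ 2 * (Re (Z z) * Re (Z w)) <= Q ^ 2 * (((1 + e) * c * Re (Z z)) * ((1 + e) * c * Re (Z w))) * D ^ 2).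
    { apply Rle_trans with (A ^ 2 * (Re (Z z) * Re (Z w))); [apply Rmult_le_compat_r; lra|].
      rewrite <- S'. apply Rmult_le_compat_r; [apply pow2_ge_0|]. apply Rmult_le_compat_l; [apply pow2_ge_0 | exact C2]. }
    assert (PP : 0 < c ^ 2 * D ^ 2 * (Re (Z z) * Re (Z w))).
    { apply Rmult_lt_0_compat; trivial. apply Rmult_lt_0_compat; apply pow_lt; trivial. }
    apply (Rmult_lt_compat_r _ _ _ PP) in C1. lra. }
  rewrite Rabs_left1 by lra. nra.
Qed.

End JuliaCaratheodory.

(** * The distortion integral *)

Section RadialIntegral.

Variables (psi : C -> C) (dpsi : R -> C).
Hypothesis Hpsi : hol psi.
Hypothesis Hself : forall z, Cmod z < 1 -> Cmod (psi z) < 1.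
Hypothesis Hd : forall r, Rabs r < 1 -> Cderiv psi (RtoC r) (dpsi r).

Definition radial_distortion (r : R) : R :=
  (1 - r ^ 2) * (Cmod (dpsi r) / (1 - Cmod (psi (RtoC r)) ^ 2)).

Definition distortion_defect (r : R) : R := (1 - radial_distortion r) * (2 / (1 - r ^ 2)).

Lemma Cmod_real_lt_1 r : Rabs r < 1 -> Cmod (RtoC r) < 1.
Proof. rewrite Cmod_R. trivial. Qed.

Lemma abs_lt_1_sqr r : Rabs r < 1 -> 0 < 1 - r ^ 2.
Proof. intros H. rewrite <- (pow2_abs r). apply sqr_lt_1; trivial; apply Rabs_pos. Qed.

Lemma self_sqr r : Rabs r < 1 -> 0 < 1 - Cmod (psi (RtoC r)) ^ 2.
Proof.
  intros H. apply sqr_lt_1; [apply Cmod_ge_0 | apply Hself, Cmod_real_lt_1, H].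
Qed.

Lemma dpsi_continuous r : Rabs r < 1 -> Rcontinuous dpsi r.
Proof.
  intros Hr. apply continuous_C_iff. intros eps He.
  set (rho := (Rabs r + 1) / 2).
  destruct (derivative_lipschitz psi rho Hpsi) as [K [HK L]].
  { intros z Hz. apply Rlt_le, Hself, Hz. }
  { unfold rho. lra. }
  assert (Hm : 0 < Rmin (rho - Rabs r) (eps / K)).
  { apply Rmin_pos; [unfold rho; lra | apply Rdiv_lt_0_compat; trivial]. }
  exists (mkposreal _ Hm). intros s Hs.
  unfold ball in Hs; simpl in Hs. unfold AbsRing_ball, abs, minus, plus, opp in Hs; simpl in Hs.
  assert (Hs1 := Rlt_le_trans _ _ _ Hs (Rmin_l _ _)). assert (Hs2 := Rlt_le_trans _ _ _ Hs (Rmin_r _ _)).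
  assert (Ts : Rabs s < rho).
  { replace s with ((s + - r) + r) by ring. eapply Rle_lt_trans; [apply Rabs_triang | lra]. }
  eapply Rle_lt_trans.
  - apply (L (RtoC s) (RtoC r) (dpsi s) (dpsi r)); rewrite ?Cmod_R; trivial.
    + unfold rho; lra.
    + apply Hd. unfold rho in Ts; lra.
    + apply Hd; lra.
  - rewrite <- RtoC_minus, Cmod_R. unfold Rminus.
    apply (Rmult_lt_compat_l K) in Hs2; trivial.
    replace (K * (eps / K)) with eps in Hs2 by (field; lra). exact Hs2.
Qed.

Lemma distortion_defect_continuous r : Rabs r < 1 -> continuous distortion_defect r.
Proof.
  intros Hr.
  assert (Hinv : forall f : R -> R, continuous f r -> f r <> 0 -> continuous (fun s => / f s) r).
  { intros f Hf Hn. apply (continuous_comp f Rinv); [exact Hf|].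
    apply (ex_derive_continuous (V := R_NormedModule)). auto_derive. exact Hn. }
  assert (Hsq : continuous (fun s : R => 1 - s ^ 2) r).
  { apply (ex_derive_continuous (V := R_NormedModule)). auto_derive. trivial. }
  assert (P1 := abs_lt_1_sqr r Hr). assert (P2 := self_sqr r Hr).
  apply continuous_Rmult.
  - apply (continuous_minus (V := R_NormedModule)); [apply continuous_const|].
    apply continuous_Rmult; [exact Hsq|].
    apply continuous_Rmult.
    + apply continuous_Cmod, dpsi_continuous, Hr.
    + apply Hinv; [|lra].
      assert (Hc : continuous (fun s => Cmod (psi (RtoC s))) r).
      { apply continuous_Cmod, (continuous_Rcomp RtoC psi).
        - apply continuous_RtoC, continuous_id.
        - apply hol_continuous; trivial. apply Cmod_real_lt_1, Hr. }
      apply (continuous_minus (V := R_NormedModule)); [apply continuous_const|].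
      apply continuous_sqr, Hc.
  - apply continuous_Rmult; [apply continuous_const|]. apply Hinv; [exact Hsq | lra].
Qed.

Lemma radial_distortion_le_1 r : Rabs r < 1 -> radial_distortion r <= 1.
Proof.
  intros Hr. unfold radial_distortion.
  assert (S := schwarz_pick_deriv_strict psi Hpsi Hself (RtoC r) (dpsi r) (Cmod_real_lt_1 r Hr) (Hd r Hr)).
  rewrite Cmod_R, pow2_abs in S. assert (P := self_sqr r Hr).
  replace ((1 - r ^ 2) * (Cmod (dpsi r) / (1 - Cmod (psi (RtoC r)) ^ 2)))
    with (Cmod (dpsi r) * (1 - r ^ 2) / (1 - Cmod (psi (RtoC r)) ^ 2)) by (field; lra).
  apply Rle_div_l; lra.
Qed.

Lemma distortion_defect_nonneg r : Rabs r < 1 -> 0 <= distortion_defect r.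
Proof.
  intros Hr. assert (D := radial_distortion_le_1 r Hr). assert (P := abs_lt_1_sqr r Hr).
  apply Rmult_le_pos; [lra|]. apply Rlt_le, Rdiv_lt_0_compat; lra.
Qed.

Definition defect_integral (b : R) : R := RInt distortion_defect 0 b.

Lemma ex_defect_integral b : Rabs b < 1 -> ex_RInt distortion_defect 0 b.
Proof.
  intros Hb. apply (ex_RInt_continuous (V := R_CompleteNormedModule)).
  intros x Hx. apply distortion_defect_continuous.
  apply Rabs_def2 in Hb. unfold Rmin, Rmax in Hx. destruct (Rle_dec 0 b); apply Rabs_def1; lra.
Qed.

Lemma is_derive_defect_integral b : Rabs b < 1 -> is_derive defect_integral b (distortion_defect b).
Proof.
  intros Hb. apply (is_derive_RInt (V := R_NormedModule) distortion_defect defect_integral 0).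
  - assert (Hp : 0 < 1 - Rabs b) by lra. exists (mkposreal _ Hp). intros c Hc.
    apply (RInt_correct (V := R_CompleteNormedModule)), ex_defect_integral.
    unfold ball in Hc; simpl in Hc. unfold AbsRing_ball, abs, minus, plus, opp in Hc; simpl in Hc.
    replace c with ((c + - b) + b) by ring. eapply Rle_lt_trans; [apply Rabs_triang | lra].
  - apply distortion_defect_continuous, Hb.
Qed.

Lemma nondecreasing_of_derive (f df : R -> R) a b : a <= b ->
  (forall x, a <= x <= b -> is_derive f x (df x)) -> (forall x, a <= x <= b -> 0 <= df x) -> f a <= f b.
Proof.
  intros Hab Hf Hdf. destruct (MVT_gen f a b df) as [c [Hc E]].
  - rewrite Rmin_left, Rmax_right by trivial. intros; apply Hf; lra.
  - rewrite Rmin_left, Rmax_right by trivial. intros. apply continuity_pt_filterlim.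
    apply (ex_derive_continuous (V := R_NormedModule)). exists (df x); apply Hf; lra.
  - rewrite Rmin_left, Rmax_right in Hc by trivial.
    assert (0 <= df c * (b - a)) by (apply Rmult_le_pos; [apply Hdf | ]; lra). lra.
Qed.

Lemma defect_integral_mono a b : 0 <= a <= b -> b < 1 -> defect_integral a <= defect_integral b.
Proof.
  intros Hab Hb. apply nondecreasing_of_derive with distortion_defect; [lra| |];
    intros x Hx; [apply is_derive_defect_integral | apply distortion_defect_nonneg]; apply Rabs_def1; lra.
Qed.

Lemma defect_integrable_of_bounded B : (forall b, 0 <= b < 1 -> defect_integral b <= B) ->
  ex_RInt_gen distortion_defect (at_point 0) (at_left 1).
Proof.
  intros HB.
  destruct (completeness (fun y => exists b, 0 <= b < 1 /\ y = defect_integral b)) as [L [HL1 HL2]].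
  - exists B. intros y [b [Hb ->]]. apply HB, Hb.
  - exists (defect_integral 0), 0. split; [lra | reflexivity].
  - exists L. intros P [e He].
    assert (X : exists b0, 0 <= b0 < 1 /\ L - e < defect_integral b0).
    { apply Classical_Prop.NNPP. intros N. assert (L <= L - e); [|generalize (cond_pos e); lra].
      apply HL2. intros y [b [Hb ->]]. apply Rnot_lt_le. intro Hlt. apply N. exists b; auto. }
    destruct X as [b0 [Hb0 Hlt]].
    apply Filter_prod with (fun a => a = 0) (fun b => b0 < b < 1).
    + reflexivity.
    + assert (Hp : 0 < 1 - b0) by lra. exists (mkposreal _ Hp). intros r Hr Hr1.
      unfold ball in Hr; simpl in Hr. unfold AbsRing_ball, abs, minus, plus, opp in Hr; simpl in Hr.
      apply Rabs_def2 in Hr. lra.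
    + intros a b -> Hb. exists (defect_integral b). simpl. split.
      * apply (RInt_correct (V := R_CompleteNormedModule)), ex_defect_integral, Rabs_def1; lra.
      * apply He. unfold ball; simpl. unfold AbsRing_ball, abs, minus, plus, opp; simpl.
        assert (M := defect_integral_mono b0 b ltac:(lra) ltac:(lra)).
        assert (U : defect_integral b <= L) by (apply HL1; exists b; split; [lra | reflexivity]).
        apply Rabs_def1; lra.
Qed.

Lemma defect_tail : ex_RInt_gen distortion_defect (at_point 0) (at_left 1) ->
  forall eps, 0 < eps -> exists s, 0 <= s < 1 /\
    forall a b, s <= a <= b -> b < 1 -> defect_integral b - defect_integral a < eps.
Proof.
  intros [L HL] eps He. assert (He2 : 0 < eps / 2) by lra.
  destruct (HL _ (locally_ball (T := R_UniformSpace) L (mkposreal _ He2))) as [P Q HP HQ H].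
  destruct HQ as [d HQ].
  set (s := Rmax 0 (1 - d / 2)).
  assert (S1 : 0 <= s) by apply Rmax_l. assert (S2 : 1 - d / 2 <= s) by apply Rmax_r.
  assert (S3 : s < 1) by (apply Rmax_lub_lt; generalize (cond_pos d); lra).
  assert (K : forall b, s <= b < 1 -> Rabs (defect_integral b - L) < eps / 2).
  { intros b Hb. assert (Qb : Q b).
    { apply HQ; [|lra]. unfold ball; simpl. unfold AbsRing_ball, abs, minus, plus, opp; simpl.
      generalize (cond_pos d); intro. apply Rabs_def1; lra. }
    destruct (H 0 b HP Qb) as [y [Hy Hb']]. simpl in Hy.
    apply (is_RInt_unique (V := R_CompleteNormedModule)) in Hy. unfold defect_integral. rewrite Hy.
    exact Hb'. }
  exists s. split; [lra|]. intros a b Hab Hb.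
  assert (K1 := K a ltac:(lra)). assert (K2 := K b ltac:(lra)).
  apply Rabs_def2 in K1. apply Rabs_def2 in K2. lra.
Qed.

(** On [[s, (1 + s) / 2]] the density is at least [1 / (1 - s)], so it has mass at least [1 / 2]
    there; a distortion defect of at least [kappa] throughout would cost [kappa / 2]. *)
Lemma defect_small_somewhere s kappa : 0 <= s < 1 -> 0 < kappa ->
  (forall b, s <= b < 1 -> defect_integral b - defect_integral s < kappa / 2) ->
  exists r, s <= r < 1 /\ 1 - radial_distortion r < kappa.
Proof.
  intros Hs Hk H. apply Classical_Prop.NNPP. intros N.
  assert (Hr : forall r, s <= r < 1 -> kappa <= 1 - radial_distortion r).
  { intros r Hr. apply Rnot_lt_le. intro Hlt. apply N. exists r; auto. }
  set (b := (1 + s) / 2).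
  assert (T : defect_integral s - kappa / (1 - s) * s <= defect_integral b - kappa / (1 - s) * b).
  { apply (nondecreasing_of_derive (fun r => defect_integral r - kappa / (1 - s) * r)
       (fun r => distortion_defect r - kappa / (1 - s))); [unfold b; lra| |].
    - intros x Hx. apply (is_derive_minus (V := R_NormedModule)).
      + apply is_derive_defect_integral, Rabs_def1; unfold b in Hx; lra.
      + auto_derive; trivial; ring.
    - intros x Hx. assert (Hx1 : x < 1) by (unfold b in Hx; lra).
      unfold distortion_defect.
      assert (A : / (1 - s) <= 2 / (1 - x ^ 2)).
      { apply Rle_div_r; [nra|]. apply Rle_trans with (/ (1 - s) * (2 * (1 - s))).
        - apply Rmult_le_compat_l; [apply Rlt_le, Rinv_0_lt_compat; lra | nra].
        - right; field; lra. }
      assert (kappa * / (1 - s) <= (1 - radial_distortion x) * (2 / (1 - x ^ 2))).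
      { apply Rmult_le_compat; try lra; [apply Rlt_le, Rinv_0_lt_compat; lra | apply Hr; lra]. }
      unfold Rdiv at 2. lra. }
  specialize (H b ltac:(unfold b; lra)).
  replace (kappa / (1 - s) * b) with (kappa / (1 - s) * s + kappa / 2) in T by (unfold b; field; lra).
  lra.
Qed.

(** * Dieudonne's estimate along the radius *)

Lemma Re_conj_mult (u v : C) : Re (Cconj u * v)%C = Re u * Re v + Im u * Im v.
Proof. destruct u, v. unfold Re, Im, Cconj; simpl. ring. Qed.

(* The quantity is [sinh(d/2)^2 / sinh(k/2)^2] for [d], [k] the hyperbolic
   distances from [0] to [x * g x] and to [x]. *)
Definition sinh_ratio (g : C -> C) (x : R) : R :=
  let a := Cmod (g (RtoC x)) ^ 2 in a * (1 - x ^ 2) / (1 - x ^ 2 * a).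

Lemma sinh_ratio_derive g x l : Cderiv g (RtoC x) l -> Rabs x < 1 -> Cmod (g (RtoC x)) <= 1 ->
  is_derive (sinh_ratio g) x
   ((2 * Re (Cconj (g (RtoC x)) * l)%C * (1 - x ^ 2)
     - 2 * x * Cmod (g (RtoC x)) ^ 2 * (1 - Cmod (g (RtoC x)) ^ 2))
    / (1 - x ^ 2 * Cmod (g (RtoC x)) ^ 2) ^ 2).
Proof.
  intros Hl Hx Hg.
  assert (D1 := Cderiv_Re_real _ _ _ Hl). assert (D2 := Cderiv_Im_real _ _ _ Hl).
  assert (P := abs_lt_1_sqr x Hx).
  assert (N : 1 - x ^ 2 * Cmod (g (RtoC x)) ^ 2 <> 0).
  { assert (Cmod (g (RtoC x)) ^ 2 <= 1) by (generalize (Cmod_ge_0 (g (RtoC x))); nra).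
    generalize (pow2_ge_0 x) (pow2_ge_0 (Cmod (g (RtoC x)))). nra. }
  set (u := fun s : R => Re (g (RtoC s))) in *. set (v := fun s : R => Im (g (RtoC s))) in *.
  apply (is_derive_ext (fun s => (u s ^ 2 + v s ^ 2) * (1 - s ^ 2) / (1 - s ^ 2 * (u s ^ 2 + v s ^ 2)))).
  { intro s. unfold sinh_ratio. rewrite Cmod2_alt. reflexivity. }
  rewrite Re_conj_mult, Cmod2_alt in *. fold (u x) (v x) in *.
  clearbody u v. auto_derive.
  - repeat split; try (eexists; eassumption). simpl in N. lra.
  - change (Derive (fun y => u y) x) with (Derive u x). change (Derive (fun y => v y) x) with (Derive v x).
    rewrite (is_derive_unique _ _ _ D1), (is_derive_unique _ _ _ D2). simpl in N. field. simpl. lra.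
Qed.

(** [t] is the hyperbolic translation along the real diameter that moves 0 to [s0]. *)
Lemma disc_shift_facts s0 x : 0 <= s0 < 1 -> 0 <= x < 1 ->
  let t := (x + s0) / (1 + s0 * x) in
  s0 <= t < 1 /\ mob (- RtoC s0) (RtoC x) = RtoC t /\
  1 - t ^ 2 = (1 - s0 ^ 2) * (1 - x ^ 2) / (1 + s0 * x) ^ 2.
Proof.
  intros Hs Hx t. assert (P : 0 < 1 + s0 * x) by nra.
  repeat split.
  - apply (proj1 (Rle_div_r _ _ _ P)).
    assert (0 <= x * (1 - s0 * s0)) by (apply Rmult_le_pos; nra). lra.
  - apply (proj2 (Rlt_div_l _ _ _ P)). nra.
  - unfold mob, t. replace (Cconj (- RtoC s0)) with (- RtoC s0)%C by (unfold Cconj, Copp, RtoC; simpl; f_equal; ring).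
    rewrite RtoC_div, !RtoC_plus, RtoC_mult by lra.
    assert (N := RtoC_neq_0 _ (Rgt_not_eq _ _ P)). rewrite RtoC_plus, RtoC_mult in N.
    replace (1 - - RtoC s0 * RtoC x)%C with (1 + RtoC s0 * RtoC x)%C by ring.
    replace (RtoC x - - RtoC s0)%C with (RtoC x + RtoC s0)%C by ring. reflexivity.
  - unfold t. field. lra.
Qed.

Section Normalized.

Variables (s0 : R) (g : C -> C).
Hypothesis Hs0 : 0 <= s0 < 1.
Hypothesis Hg : hol g.
Hypothesis Bg : forall z, Cmod z < 1 -> Cmod (g z) <= 1.
Hypothesis Eg : forall z, mob (psi (RtoC s0)) (psi (mob (- RtoC s0) z)) = (z * g z)%C.

Let t x := (x + s0) / (1 + s0 * x).

Lemma normalized_defect x : 0 <= x < 1 ->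
  1 - x ^ 2 * Cmod (g (RtoC x)) ^ 2 =
  (1 - Cmod (psi (RtoC s0)) ^ 2) * (1 - Cmod (psi (RtoC (t x))) ^ 2)
  / Cmod (1 - Cconj (psi (RtoC s0)) * psi (RtoC (t x))) ^ 2.
Proof.
  intros Hx. destruct (disc_shift_facts s0 x Hs0 Hx) as [T1 [T2 _]]. fold (t x) in T1, T2.
  assert (A := Hself (RtoC s0) (Cmod_real_lt_1 s0 ltac:(apply Rabs_def1; lra))).
  assert (B := Hself (RtoC (t x)) (Cmod_real_lt_1 (t x) ltac:(apply Rabs_def1; lra))).
  rewrite <- (Cmod_mob _ _ A (Rlt_le _ _ B)), <- T2, Eg, Cmod_mult, Cmod_R, Rpow_mult_distr, pow2_abs. reflexivity.
Qed.

(** Invariance of the hyperbolic distortion under disc automorphisms: the map [z * g z] has at [x]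
    the distortion of [psi] at the shifted point. *)
Lemma normalized_distortion x l : 0 <= x < 1 -> Cderiv g (RtoC x) l ->
  Cmod (g (RtoC x) + RtoC x * l) * (1 - x ^ 2) =
  radial_distortion (t x) * (1 - x ^ 2 * Cmod (g (RtoC x)) ^ 2).
Proof.
  intros Hx Hl. destruct (disc_shift_facts s0 x Hs0 Hx) as [T1 [T2 T3]]. fold (t x) in T1, T2, T3.
  assert (Ws : Cmod (RtoC s0) < 1) by (apply Cmod_real_lt_1, Rabs_def1; lra).
  assert (Ws' : Cmod (- RtoC s0)%C < 1) by (rewrite Cmod_opp; exact Ws).
  assert (Wx : Cmod (RtoC x) < 1) by (apply Cmod_real_lt_1, Rabs_def1; lra).
  assert (Wt : Rabs (t x) < 1) by (apply Rabs_def1; lra).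
  assert (A := Hself (RtoC s0) Ws). assert (B := Hself (RtoC (t x)) (Cmod_real_lt_1 _ Wt)).
  assert (D1 : Cderiv (fun z => (z * g z)%C) (RtoC x) (1 * g (RtoC x) + RtoC x * l)%C)
    by (apply (Cderiv_mult (fun z => z) g); [apply Cderiv_id | exact Hl]).
  assert (D2 := Cderiv_mob (- RtoC s0)%C (RtoC x) Ws' Wx).
  assert (D3 : Cderiv psi (mob (- RtoC s0) (RtoC x)) (dpsi (t x))) by (rewrite T2; apply Hd, Wt).
  assert (D4 := Cderiv_comp psi (mob (- RtoC s0)%C) _ _ _ D2 D3).
  assert (D5 := Cderiv_mob (psi (RtoC s0)) (psi (mob (- RtoC s0) (RtoC x))) A ltac:(rewrite T2; exact B)).
  assert (D6 := Cderiv_comp (mob (psi (RtoC s0))) (fun z => psi (mob (- RtoC s0)%C z)) _ _ _ D4 D5).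
  apply (Cderiv_ext _ _ _ _ Eg) in D6.
  assert (U := Cderiv_unique _ _ _ _ D1 D6). clear D1 D2 D3 D4 D5 D6.
  rewrite T2 in U. rewrite Cmult_1_l in U. rewrite U, normalized_defect by exact Hx.
  assert (NV := mob_denominator (psi (RtoC s0)) (psi (RtoC (t x))) A ltac:(lra)).
  assert (NS := mob_denominator (- RtoC s0)%C (RtoC x) Ws' ltac:(lra)).
  assert (ES : (1 - Cconj (- RtoC s0) * RtoC x)%C = RtoC (1 + s0 * x)).
  { rewrite RtoC_plus, RtoC_mult. replace (Cconj (- RtoC s0)) with (- RtoC s0)%C by (unfold Cconj, Copp, RtoC; simpl; f_equal; ring). ring. }
  rewrite ES in *.
  assert (P0 := sqr_lt_1 _ (Cmod_ge_0 _) A). assert (Pt := sqr_lt_1 _ (Cmod_ge_0 _) B).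
  assert (Ps := abs_lt_1_sqr s0 ltac:(apply Rabs_def1; lra)).
  assert (PP : 0 < 1 + s0 * x) by nra.
  rewrite !Cmod_mult, !Cmod_div, !Cmod_mult, Cmod_opp, !Cmod_R by (apply Cmult_neq_0; trivial).
  rewrite !pow2_abs. rewrite (Rabs_right (1 + s0 * x)) by lra.
  rewrite (Rabs_right (1 - s0 ^ 2)), (Rabs_right (1 - Cmod (psi (RtoC s0)) ^ 2)) by lra.
  apply Cmod_gt_0 in NV.
  unfold radial_distortion. rewrite T3. field. repeat split; lra.
Qed.

(* Dieudonne's form of the Schwarz lemma, [g'] being controlled by Schwarz-Pick. *)
Lemma sinh_ratio_derive_ge x l : 0 < x < 1 -> Cderiv g (RtoC x) l ->
  - (1 - radial_distortion (t x) ^ 2) / (1 - x ^ 2) <=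
  x * ((2 * Re (Cconj (g (RtoC x)) * l)%C * (1 - x ^ 2)
     - 2 * x * Cmod (g (RtoC x)) ^ 2 * (1 - Cmod (g (RtoC x)) ^ 2))
    / (1 - x ^ 2 * Cmod (g (RtoC x)) ^ 2) ^ 2).
Proof.
  intros Hx Hl.
  assert (E := normalized_distortion x l ltac:(lra) Hl).
  assert (Wx : Cmod (RtoC x) < 1) by (apply Cmod_real_lt_1, Rabs_def1; lra).
  assert (S := schwarz_pick_deriv g (RtoC x) l Hg Bg Wx Hl).
  rewrite Cmod_R, pow2_abs in S. assert (B := Bg (RtoC x) Wx).
  assert (Q : Cmod (g (RtoC x) + RtoC x * l) ^ 2 =
     Cmod (g (RtoC x)) ^ 2 + 2 * x * Re (Cconj (g (RtoC x)) * l)%C + x ^ 2 * Cmod l ^ 2).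
  { rewrite Re_conj_mult, !Cmod2_alt. destruct (g (RtoC x)), l. unfold Re, Im; simpl. ring. }
  assert (B0 := Cmod_ge_0 (g (RtoC x))).
  set (a := Cmod (g (RtoC x)) ^ 2) in *. set (A := radial_distortion (t x)) in *.
  set (rho := Re (Cconj (g (RtoC x)) * l)%C) in *. set (P := 1 - x ^ 2 * a) in *.
  set (N := Cmod (g (RtoC x) + RtoC x * l)) in *.
  assert (Ha : 0 <= a <= 1) by (unfold a; nra).
  assert (Hq : 0 < 1 - x ^ 2) by nra.
  assert (HP : 0 < P) by (unfold P; nra).
  set (q := 1 - x ^ 2) in *.
  assert (E2 : N ^ 2 * q ^ 2 = A ^ 2 * P ^ 2) by (rewrite <- !Rpow_mult_distr, E; reflexivity).
  assert (S2 : Cmod l ^ 2 * q ^ 2 <= (1 - a) ^ 2).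
  { rewrite <- Rpow_mult_distr. apply pow_incr. split; [apply Rmult_le_pos; [apply Cmod_ge_0 | lra] | exact S]. }
  assert (K : - (1 - A ^ 2) * P ^ 2 <= x * (2 * rho * q - 2 * x * a * (1 - a)) * q).
  { rewrite Q in E2.
    assert (S3 : x ^ 2 * (Cmod l ^ 2 * q ^ 2) <= x ^ 2 * (1 - a) ^ 2) by (apply Rmult_le_compat_l; [apply pow2_ge_0 | exact S2]).
    assert (S4 : 0 <= (1 - a) * q * P) by (apply Rmult_le_pos; [apply Rmult_le_pos|]; lra).
    (* Once [|l|^2 * q^2] is replaced by [(1 - a)^2], the terms to be subtracted from [A^2 * P^2]
       are the right side of [ID], which is [P^2] minus the nonnegative slack [S4]. *)
    assert (ID : P ^ 2 - (1 - a) * q * P = a * q ^ 2 + x ^ 2 * (1 - a) ^ 2 + 2 * x ^ 2 * a * (1 - a) * q)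
      by (unfold P, q; ring).
    assert (E3 : 2 * x * rho * q ^ 2 = A ^ 2 * P ^ 2 - a * q ^ 2 - x ^ 2 * (Cmod l ^ 2 * q ^ 2)) by lra.
    replace (x * (2 * rho * q - 2 * x * a * (1 - a)) * q)
      with (2 * x * rho * q ^ 2 - 2 * x ^ 2 * a * (1 - a) * q) by ring.
    rewrite E3. lra. }
  assert (HP2 : 0 < P ^ 2) by (apply pow_lt, HP).
  apply (Rmult_le_reg_r (P ^ 2 * q)); [apply Rmult_lt_0_compat; trivial|].
  apply Rle_trans with (- (1 - A ^ 2) * P ^ 2); [right; field; lra|].
  eapply Rle_trans; [exact K|]. right. field. lra.
Qed.

(** With [1 - A^2 <= 2 * (1 - A)] and [1 / u <= 2], the derivative of the ratio is at least
    [- 4 * (1 - A) / (1 - u^2)]. The density is invariant under the shift, so this is minus twice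
    the derivative of the transported integral. *)
Lemma sinh_ratio_decrease x y : 1 / 2 <= x <= y -> y < 1 ->
  sinh_ratio g x - 2 * (defect_integral (t y) - defect_integral (t x)) <= sinh_ratio g y.
Proof.
  intros Hxy Hy.
  assert (Hder : forall u, x <= u <= y -> exists l, Cderiv g (RtoC u) l).
  { intros u Hu. apply Hg, Cmod_real_lt_1, Rabs_def1; lra. }
  assert (Hdt : forall u, x <= u <= y ->
    is_derive (fun v => defect_integral (t v)) u (scal ((1 - s0 ^ 2) / (1 + s0 * u) ^ 2) (distortion_defect (t u)))).
  { intros u Hu. destruct (disc_shift_facts s0 u Hs0 ltac:(lra)) as [T1 _]. fold (t u) in T1.
    apply (is_derive_comp (K := R_AbsRing) (V := R_NormedModule) defect_integral t).
    - apply is_derive_defect_integral, Rabs_def1; lra.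
    - unfold t. auto_derive; [nra | field; nra]. }
  (* The derivative of [g] is only known to exist point by point; [Derive] gives a function of [u]
     without choosing it. *)
  assert (M : exists f', forall u, x <= u <= y ->
     is_derive (fun v => sinh_ratio g v + 2 * defect_integral (t v)) u (f' u) /\ 0 <= f' u).
  { exists (fun u => Derive (fun v => sinh_ratio g v + 2 * defect_integral (t v)) u).
    intros u Hu. destruct (Hder u Hu) as [l Hl].
    assert (Wu : Rabs u < 1) by (apply Rabs_def1; lra).
    assert (DS := sinh_ratio_derive g u l Hl Wu (Bg _ (Cmod_real_lt_1 u Wu))).
    assert (DI := is_derive_scal _ _ 2 _ (Hdt u Hu)).
    match type of DS with is_derive _ _ ?d1 => match type of DI with is_derive _ _ ?d2 =>
      assert (DD : is_derive (fun v : R => sinh_ratio g v + 2 * defect_integral (t v)) u (d1 + d2))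
        by exact (is_derive_plus (V := R_NormedModule) _ _ _ _ _ DS DI);
      assert (ED : Derive (fun v : R => sinh_ratio g v + 2 * defect_integral (t v)) u = d1 + d2)
        by exact (is_derive_unique _ _ _ DD) end end.
    rewrite ED. split; [exact DD|].
    assert (G := sinh_ratio_derive_ge u l ltac:(lra) Hl).
    destruct (disc_shift_facts s0 u Hs0 ltac:(lra)) as [T1 [_ T3]]. fold (t u) in T1, T3.
    assert (A1 := radial_distortion_le_1 (t u) ltac:(apply Rabs_def1; lra)).
    assert (A0 : 0 <= radial_distortion (t u)).
    { unfold radial_distortion. assert (W : Rabs (t u) < 1) by (apply Rabs_def1; lra).
      assert (X1 := abs_lt_1_sqr _ W). assert (X2 := self_sqr _ W).
      apply Rmult_le_pos; [lra|]. apply Rmult_le_pos; [apply Cmod_ge_0 | apply Rlt_le, Rinv_0_lt_compat, X2]. }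
    change scal with Rmult. unfold distortion_defect. rewrite T3.
    match type of DS with is_derive _ _ ?d => set (D := d) in *; clearbody D end.
    assert (PP : 0 < 1 + s0 * u) by nra. assert (Ps : 0 < 1 - s0 ^ 2) by nra. assert (Pu : 0 < 1 - u ^ 2) by nra.
    set (A := radial_distortion (t u)) in *.
    replace (2 * ((1 - s0 ^ 2) / (1 + s0 * u) ^ 2 * ((1 - A) * (2 / ((1 - s0 ^ 2) * (1 - u ^ 2) / (1 + s0 * u) ^ 2)))))
      with (4 * (1 - A) / (1 - u ^ 2)) by (field; lra).
    assert (G2 : - (2 * (1 - A)) / (1 - u ^ 2) <= u * D).
    { eapply Rle_trans; [|exact G]. apply Rmult_le_compat_r; [apply Rlt_le, Rinv_0_lt_compat; lra | nra]. }
    set (W := (1 - A) / (1 - u ^ 2)).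
    assert (HW : 0 <= W) by (apply Rmult_le_pos; [lra | apply Rlt_le, Rinv_0_lt_compat; lra]).
    replace (- (2 * (1 - A)) / (1 - u ^ 2)) with (- 2 * W) in G2 by (unfold W, Rdiv; ring).
    replace (4 * (1 - A) / (1 - u ^ 2)) with (4 * W) by (unfold W, Rdiv; ring).
    nra. }
  destruct M as [f' Hf'].
  assert (R := nondecreasing_of_derive (fun v => sinh_ratio g v + 2 * defect_integral (t v)) f' x y ltac:(lra)
    (fun u Hu => proj1 (Hf' u Hu)) (fun u Hu => proj2 (Hf' u Hu))).
  simpl in R. lra.
Qed.

(* Schwarz-Pick in the half-plane for [1 - conj (g 0) * g], whose real part at [0]
   is small. *)
Lemma sinh_ratio_half : 99 / 100 < Cmod (g (RtoC 0)) -> 2 / 5 <= sinh_ratio g (1 / 2).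
Proof.
  intros H0. set (g0 := g (RtoC 0)) in *.
  assert (Z0 : Cmod (RtoC 0) < 1) by (rewrite Cmod_0; lra).
  assert (Zh : Cmod (RtoC (1 / 2)) < 1) by (rewrite Cmod_R, Rabs_right; lra).
  assert (H1 : Cmod g0 <= 1) by (apply Bg, Z0).
  set (G := fun z => (1 - Cconj g0 * g z)%C).
  assert (HR : forall z, Cmod z < 1 -> Rabs (Re (Cconj g0 * g z)%C) <= 1).
  { intros z Hz. eapply Rle_trans; [apply re_le_Cmod|]. rewrite Cmod_mult, Cmod_conj.
    generalize (Bg z Hz) (Cmod_ge_0 (g z)) (Cmod_ge_0 g0). nra. }
  assert (RG : forall z, Re (G z) = 1 - Re (Cconj g0 * g z)%C).
  { intros z. unfold G, Cminus. rewrite re_plus, re_opp. reflexivity. }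
  assert (S := half_plane_schwarz_pick G (RtoC (1 / 2)) (RtoC 0)).
  assert (HG : hol G).
  { intros z Hz. apply Cdiffable_minus; [apply Cdiffable_const|].
    apply Cdiffable_mult; [apply Cdiffable_const | apply Hg, Hz]. }
  specialize (S HG).
  assert (PG : forall z, Cmod z < 1 -> 0 <= Re (G z)).
  { intros z Hz. rewrite RG. specialize (HR z Hz). apply Rabs_le_between in HR. lra. }
  specialize (S PG Zh Z0). rewrite Cmod_0 in S.
  replace (RtoC (1 / 2) - RtoC 0)%C with (RtoC (1 / 2)) in S by ring.
  rewrite Cmod_R, (Rabs_right (1 / 2)) in S by lra.
  replace (G (RtoC (1 / 2)) - G (RtoC 0))%C with (- (Cconj g0 * (g (RtoC (1 / 2)) - g0)))%C in S
    by (unfold G, g0; ring).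
  rewrite Cmod_opp, Cmod_mult, Cmod_conj in S.
  assert (U1 : Re (G (RtoC (1 / 2))) <= 2).
  { rewrite RG. specialize (HR _ Zh). apply Rabs_le_between in HR. lra. }
  assert (U2 : Re (G (RtoC 0)) <= 2 / 100).
  { rewrite RG. fold g0. rewrite (Cmult_comm (Cconj g0)), Cmult_conj_Cmod. simpl. nra. }
  assert (V1 := PG _ Zh). assert (V2 := PG _ Z0).
  set (d := Cmod (g (RtoC (1 / 2)) - g0)) in *.
  assert (Hd0 : 0 <= d) by apply Cmod_ge_0.
  (* The right side of [S] is at most [2 * (2 / 100)], and its left side carries the factor [3 / 4].
     Hence [d <= 24 / 100] and the modulus at [1 / 2] is at least [75 / 100], whose square exceeds
     the [1 / 2] needed below. *)
  assert (W : (Cmod g0 * d) ^ 2 <= 16 / 300) by nra.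
  assert (W2 : d <= 24 / 100).
  { apply Rnot_lt_le. intro Hlt. assert (99 / 100 * (24 / 100) <= Cmod g0 * d) by nra. nra. }
  assert (W3 : 75 / 100 <= Cmod (g (RtoC (1 / 2)))).
  { assert (T := Cmod_triangle (- (g (RtoC (1 / 2)) - g0)) (g (RtoC (1 / 2)))).
    replace (- (g (RtoC (1 / 2)) - g0) + g (RtoC (1 / 2)))%C with g0 in T by ring.
    rewrite Cmod_opp in T. fold d in T. lra. }
  assert (W4 := Bg _ Zh).
  unfold sinh_ratio. set (b := Cmod (g (RtoC (1 / 2)))) in *. simpl.
  assert (HB : 1 / 2 <= b * (b * 1)) by nra. assert (HB' : b * (b * 1) <= 1) by nra.
  set (a := b * (b * 1)) in *. clearbody a.
  assert (HP : 0 < 1 - 1 / 2 * (1 / 2 * 1) * a) by lra.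
  apply (proj1 (Rle_div_r (2 / 5) _ _ HP)). lra.
Qed.

End Normalized.

Lemma defect_integrable_radial_bound :
  ex_RInt_gen distortion_defect (at_point 0) (at_left 1) ->
  exists K r0, 0 <= r0 < 1 /\ forall r, r0 <= r < 1 -> 1 - Cmod (psi (RtoC r)) ^ 2 <= K * (1 - r ^ 2).
Proof.
  (* One tail bound serves twice: it is half of [1 / 100], giving a base point with distortion above
     [99 / 100], and twice it is the most the ratio can lose, so that [2 / 5 - 1 / 100 >= 1 / 3]
     remains. *)
  intros HI. destruct (defect_tail HI (1 / 200) ltac:(lra)) as [s [Hs Ht]].
  destruct (defect_small_somewhere s (1 / 100) Hs ltac:(lra)) as [s0 [Hs0 Hk]].
  { intros b Hb. specialize (Ht s b ltac:(lra) ltac:(lra)). lra. }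
  assert (Ws : Cmod (RtoC s0) < 1) by (apply Cmod_real_lt_1, Rabs_def1; lra).
  destruct (schwarz_pick_normalized psi Hpsi Hself (RtoC s0) Ws) as [g [Hg [Bg Eg]]].
  assert (Hs0' : 0 <= s0 < 1) by lra.
  assert (G0 : 99 / 100 < Cmod (g (RtoC 0))).
  { destruct (Hg (RtoC 0) ltac:(rewrite Cmod_0; lra)) as [l Hl].
    assert (N := normalized_distortion s0 g Hs0' Eg 0 l ltac:(lra) Hl).
    replace (g (RtoC 0) + RtoC 0 * l)%C with (g (RtoC 0)) in N by ring.
    cbv beta zeta in N. replace ((0 + s0) / (1 + s0 * 0)) with s0 in N by field.
    simpl in N. lra. }
  assert (Gh := sinh_ratio_half g Hg Bg G0).
  assert (F0 := self_sqr s0 ltac:(apply Rabs_def1; lra)). assert (Ps : 0 < 1 - s0 ^ 2) by nra.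
  set (r0 := (1 / 2 + s0) / (1 + s0 * (1 / 2))).
  destruct (disc_shift_facts s0 (1 / 2) Hs0' ltac:(lra)) as [T0 _]. fold r0 in T0.
  (* The factors are 3 from the ratio being at least [1 / 3], 4 from [V^2 <= 4], and 4 from
     [(1 + s0 * x)^2 <= 4]. *)
  exists (48 / ((1 - Cmod (psi (RtoC s0)) ^ 2) * (1 - s0 ^ 2))), r0. split; [lra|].
  intros r Hr.
  assert (P1 : 0 < 1 - s0 * r) by nra.
  (* The point shifted to [r]; [r0] is the shift of [1 / 2], so [r >= r0] means [x >= 1 / 2]. *)
  set (x := (r - s0) / (1 - s0 * r)).
  assert (X1 : 1 / 2 <= x).
  { apply (proj1 (Rle_div_r (1 / 2) _ _ P1)). destruct Hr as [Hr _].
    assert (P2 : 0 < 1 + s0 * (1 / 2)) by lra.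
    apply (proj1 (Rle_div_l _ _ _ P2)) in Hr. lra. }
  assert (X2 : x < 1) by (apply (proj2 (Rlt_div_l _ _ _ P1)); nra).
  assert (Ex : (x + s0) / (1 + s0 * x) = r).
  { unfold x. field. split; nra. }
  destruct (disc_shift_facts s0 x Hs0' ltac:(lra)) as [_ [_ T3]]. rewrite Ex in T3.
  assert (M := sinh_ratio_decrease s0 g Hs0' Hg Bg Eg (1 / 2) x ltac:(lra) X2).
  cbv beta zeta in M. rewrite Ex in M. fold r0 in M.
  specialize (Ht r0 r ltac:(lra) ltac:(lra)).
  assert (SR : 1 / 3 <= sinh_ratio g x) by lra.
  assert (N := normalized_defect s0 g Hs0' Eg x ltac:(lra)). cbv beta zeta in N. rewrite Ex in N.
  assert (Wr : Rabs r < 1) by (apply Rabs_def1; lra).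
  assert (Wx : Rabs x < 1) by (apply Rabs_def1; lra).
  assert (Fr := self_sqr r Wr).
  assert (NV := mob_denominator (psi (RtoC s0)) (psi (RtoC r)) (Hself _ Ws) (Rlt_le _ _ (Hself _ (Cmod_real_lt_1 r Wr)))).
  assert (HV : Cmod (1 - Cconj (psi (RtoC s0)) * psi (RtoC r)) <= 2).
  { eapply Rle_trans; [apply Cmod_triangle|]. rewrite Cmod_1, Cmod_opp, Cmod_mult, Cmod_conj.
    generalize (Hself _ Ws) (Hself _ (Cmod_real_lt_1 r Wr)) (Cmod_ge_0 (psi (RtoC s0))) (Cmod_ge_0 (psi (RtoC r))). nra. }
  apply Cmod_gt_0 in NV. set (V := Cmod (1 - Cconj (psi (RtoC s0)) * psi (RtoC r))) in *.
  assert (Bx := Bg _ (Cmod_real_lt_1 x Wx)). assert (Bx0 := Cmod_ge_0 (g (RtoC x))).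
  unfold sinh_ratio in SR. set (a := Cmod (g (RtoC x)) ^ 2) in *.
  assert (Ha : 0 <= a <= 1) by (unfold a; nra).
  assert (Pq : 0 < 1 - x ^ 2) by nra. assert (PP : 0 < 1 - x ^ 2 * a) by nra.
  apply (proj2 (Rle_div_r (1 / 3) _ _ PP)) in SR.
  assert (SR2 : 1 - x ^ 2 * a <= 3 * (1 - x ^ 2)) by nra.
  set (f0 := 1 - Cmod (psi (RtoC s0)) ^ 2) in *. set (fr := 1 - Cmod (psi (RtoC r)) ^ 2) in *.
  assert (N2 : f0 * fr = (1 - x ^ 2 * a) * V ^ 2) by (rewrite N; field; lra).
  assert (PS : 0 < 1 + s0 * x) by nra.
  assert (T4 : (1 - r ^ 2) * (1 + s0 * x) ^ 2 = (1 - s0 ^ 2) * (1 - x ^ 2)) by (rewrite T3; field; lra).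
  assert (V2 : V ^ 2 <= 4) by nra.
  assert (S2 : (1 + s0 * x) ^ 2 <= 4) by nra.
  assert (Q1 : f0 * fr <= 12 * (1 - x ^ 2)).
  { rewrite N2. apply Rle_trans with ((3 * (1 - x ^ 2)) * 4); [|lra].
    apply Rmult_le_compat; try lra. apply pow2_ge_0. }
  assert (Q2 : (1 - s0 ^ 2) * (1 - x ^ 2) <= (1 - r ^ 2) * 4).
  { rewrite <- T4. apply Rmult_le_compat_l; nra. }
  apply (Rmult_le_reg_l (f0 * (1 - s0 ^ 2))); [apply Rmult_lt_0_compat; trivial|].
  replace (f0 * (1 - s0 ^ 2) * (48 / (f0 * (1 - s0 ^ 2)) * (1 - r ^ 2))) with (48 * (1 - r ^ 2)) by (field; lra).
  replace (f0 * (1 - s0 ^ 2) * fr) with ((1 - s0 ^ 2) * (f0 * fr)) by ring.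
  apply Rle_trans with ((1 - s0 ^ 2) * (12 * (1 - x ^ 2))); [apply Rmult_le_compat_l; lra | lra].
Qed.

(** * From Julia's inequality to the integral *)

Lemma Cderiv_cayley om v : Cmod om = 1 -> Cmod v < 1 ->
  Cderiv (cayley om) v (RtoC 2 * om / ((om - v) * (om - v)))%C.
Proof.
  intros Ho Hv. assert (N := unit_minus_neq_0 om v Ho Hv).
  replace (RtoC 2 * om / ((om - v) * (om - v)))%C
    with ((0 + 1) * / (om - v) + (om + v) * (- (0 - 1) / ((om - v) * (om - v))))%C by (field; exact N).
  apply (Cderiv_mult (fun v => (om + v)%C) (fun v => (/ (om - v))%C)).
  - apply Cderiv_plus; [apply Cderiv_const | apply Cderiv_id].
  - apply (Cderiv_inv (fun v => (om - v)%C)); trivial.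
    apply Cderiv_minus; [apply Cderiv_const | apply Cderiv_id].
Qed.

(** [|u'| <= |F'|], and [|F'| / Re F] is exactly [2 * |psi'| / (1 - |psi|^2)], the hyperbolic
    density of the half-plane pulled back to the disc. Integrating the resulting inequality leaves a
    logarithm that Julia's inequality bounds by [- ln c] at the right end. *)
Lemma defect_integrable_of_julia om c : Cmod om = 1 -> 0 < c ->
  (forall r, 0 <= r < 1 -> c * ((1 + r) / (1 - r)) <= Re (cayley om (psi (RtoC r)))) ->
  ex_RInt_gen distortion_defect (at_point 0) (at_left 1).
Proof.
  intros Ho Hc J.
  set (u := fun r => Re (cayley om (psi (RtoC r)))) in *.
  apply defect_integrable_of_bounded with (ln (u 0) - ln c). intros b Hb.
  assert (Pu : forall r, Rabs r < 1 -> 0 < u r).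
  { intros r Hr. apply Re_cayley_pos; trivial. apply Hself, Cmod_real_lt_1, Hr. }
  set (l := fun r => (RtoC 2 * om / ((om - psi (RtoC r)) * (om - psi (RtoC r))) * dpsi r)%C).
  assert (Du : forall r, Rabs r < 1 -> is_derive u r (Re (l r))).
  { intros r Hr. apply (Cderiv_Re_real (fun z => cayley om (psi z))).
    apply (Cderiv_comp (cayley om) psi); [apply Hd, Hr|].
    apply Cderiv_cayley; trivial. apply Hself, Cmod_real_lt_1, Hr. }
  assert (R : ln (1 + 0) - ln (1 - 0) - ln (u 0) - defect_integral 0 <= ln (1 + b) - ln (1 - b) - ln (u b) - defect_integral b).
  { apply (nondecreasing_of_derive (fun r => ln (1 + r) - ln (1 - r) - ln (u r) - defect_integral r)
      (fun r => (2 / (1 - r ^ 2) - Re (l r) / u r) - distortion_defect r)); [lra| |]; intros r Hr;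
      assert (Wr : Rabs r < 1) by (apply Rabs_def1; lra).
    - apply (is_derive_minus (V := R_NormedModule)); [|apply is_derive_defect_integral, Wr].
      specialize (Du r Wr). specialize (Pu r Wr). clearbody u.
      auto_derive.
      + repeat split; try lra. eexists; exact Du.
      + change (Derive (fun y => u y) r) with (Derive u r). rewrite (is_derive_unique _ _ _ Du). field.
        repeat split; nra.
    - assert (L : Re (l r) / u r <= 2 * Cmod (dpsi r) / (1 - Cmod (psi (RtoC r)) ^ 2)).
      { assert (F := self_sqr r Wr). specialize (Pu r Wr).
        assert (Wp := Hself _ (Cmod_real_lt_1 r Wr)).
        assert (N := unit_minus_neq_0 om _ Ho Wp). assert (NP := proj1 (Cmod_gt_0 _) N).
        apply Rle_div_l; trivial. eapply Rle_trans; [apply Rle_abs|]. eapply Rle_trans; [apply re_le_Cmod|].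
        unfold u, l. rewrite Re_cayley by trivial.
        rewrite !Cmod_mult, Cmod_div, !Cmod_mult, Ho, Cmod_R, Rabs_right by (try lra; apply Cmult_neq_0; trivial).
        right. field. lra. }
      unfold distortion_defect, radial_distortion. assert (Pr := abs_lt_1_sqr r Wr). assert (F := self_sqr r Wr).
      replace ((1 - (1 - r ^ 2) * (Cmod (dpsi r) / (1 - Cmod (psi (RtoC r)) ^ 2))) * (2 / (1 - r ^ 2)))
        with (2 / (1 - r ^ 2) - 2 * Cmod (dpsi r) / (1 - Cmod (psi (RtoC r)) ^ 2)) by (field; lra).
      lra. }
  unfold defect_integral at 1 in R. rewrite (RInt_point (V := R_CompleteNormedModule)) in R.
  unfold zero in R; simpl in R.
  replace (1 + 0) with 1 in R by ring. replace (1 - 0) with 1 in R by ring. rewrite ln_1 in R.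
  assert (Jb := J b Hb).
  assert (Pb : 0 < (1 + b) / (1 - b)) by (apply Rdiv_lt_0_compat; lra).
  assert (Lb : ln (c * ((1 + b) / (1 - b))) <= ln (u b)).
  { apply ln_le; [apply Rmult_lt_0_compat; trivial | exact Jb]. }
  rewrite ln_mult, ln_div in Lb by (trivial; lra). lra.
Qed.

End RadialIntegral.

(** * The equivalences *)

Section Main.

Variables (phi : C -> C) (sigma : C).
Hypothesis hphi : holomorphic_self_map phi.
Hypothesis hsigma : Cmod sigma = 1.

Lemma self_map_lt_1 z : Cmod z < 1 -> Cmod (phi z) < 1.
Proof. apply hphi. Qed.

Lemma self_map_Cderiv z : Cmod z < 1 -> Cderiv phi z (C_derive phi z).
Proof.
  intros Hz. apply is_derive_Cderiv. apply C_derive_correct; [exact z | apply hphi, Hz].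
Qed.

Lemma self_map_hol : hol phi.
Proof. intros z Hz. eexists. apply self_map_Cderiv, Hz. Qed.

(** Rotated so that the radius to [sigma] becomes the real segment [[0, 1)], where one-variable
    calculus applies. *)
Let psi (z : C) : C := phi (z * sigma)%C.
Let dpsi (r : R) : C := (C_derive phi (RtoC r * sigma) * sigma)%C.

Let Cmod_rotate z : Cmod (z * sigma) = Cmod z.
Proof. rewrite Cmod_mult, hsigma. ring. Qed.

Let rotate_deriv z : Cderiv (fun z => (z * sigma)%C) z sigma.
Proof.
  assert (D : Cderiv (fun z => (z * sigma)%C) z (1 * sigma + z * 0)%C)
    by (apply (Cderiv_mult (fun z => z) (fun _ => sigma)); [apply Cderiv_id | apply Cderiv_const]).
  replace (1 * sigma + z * 0)%C with sigma in D by ring. exact D.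
Qed.

Let psi_hol : hol psi.
Proof.
  intros z Hz. apply (Cdiffable_comp phi (fun z => (z * sigma)%C)).
  - eexists; apply rotate_deriv.
  - apply self_map_hol. rewrite Cmod_rotate. exact Hz.
Qed.

Let psi_self z : Cmod z < 1 -> Cmod (psi z) < 1.
Proof. intros Hz. apply self_map_lt_1. rewrite Cmod_rotate. exact Hz. Qed.

Let psi_deriv r : Rabs r < 1 -> Cderiv psi (RtoC r) (dpsi r).
Proof.
  intros Hr. apply (Cderiv_comp phi (fun z => (z * sigma)%C)).
  - apply rotate_deriv.
  - apply self_map_Cderiv. rewrite Cmod_rotate, Cmod_R. exact Hr.
Qed.

Lemma distortion_integrand_eq r :
  (1 - hyp_distortion phi (RtoC r * sigma)) * hyp_density (RtoC r * sigma)
  = distortion_defect psi dpsi r.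
Proof.
  unfold hyp_distortion, hyp_density, distortion_defect, radial_distortion, psi, dpsi.
  rewrite Cmod_rotate, (Cmod_mult _ sigma), hsigma, Rmult_1_r, Cmod_R, pow2_abs. reflexivity.
Qed.

Lemma distortion_integral_iff :
  distortion_integral_finite phi sigma <->
  ex_RInt_gen (distortion_defect psi dpsi) (at_point 0) (at_left 1).
Proof.
  unfold distortion_integral_finite.
  split; apply ex_RInt_gen_ext_eq; intro r; [|symmetry]; apply distortion_integrand_eq.
Qed.

Lemma distortion_integral_radially_julia :
  distortion_integral_finite phi sigma -> radially_julia phi sigma.
Proof.
  intros H. apply distortion_integral_iff in H.
  destruct (defect_integrable_radial_bound psi dpsi psi_hol psi_self psi_deriv H) as [K [r0 [Hr0 B]]].
  exists (2 * Rabs K), r0. split; [exact Hr0|]. intros r Hr. specialize (B r Hr).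
  assert (S := psi_self (RtoC r) ltac:(rewrite Cmod_R, Rabs_right; lra)). unfold psi in B, S.
  assert (S0 := Cmod_ge_0 (phi (RtoC r * sigma))).
  assert (1 - r ^ 2 <= 2 * (1 - r)) by nra.
  assert (K * (1 - r ^ 2) <= Rabs K * (1 - r ^ 2)) by (apply Rmult_le_compat_r; [nra | apply Rle_abs]).
  assert (Rabs K * (1 - r ^ 2) <= Rabs K * (2 * (1 - r))) by (apply Rmult_le_compat_l; [apply Rabs_pos | lra]).
  nra.
Qed.

Lemma julia_caratheodory_distortion_integral om c :
  julia_caratheodory_data phi sigma om c -> distortion_integral_finite phi sigma.
Proof.
  intros [Ho [Hc [J _]]]. apply distortion_integral_iff.
  apply (defect_integrable_of_julia psi dpsi psi_hol psi_self psi_deriv om c Ho Hc).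
  intros r Hr. assert (W : Cmod (RtoC r * sigma) < 1) by (rewrite Cmod_rotate, Cmod_R, Rabs_right; lra).
  eapply Rle_trans; [|exact (J _ W)]. right. f_equal.
  rewrite Re_cayley by trivial.
  replace (sigma - RtoC r * sigma)%C with (RtoC (1 - r) * sigma)%C by (rewrite RtoC_minus; ring).
  rewrite !Cmod_rotate, !Cmod_R, !Rabs_right by lra. field. lra.
Qed.

(** Condition (c) enters through [kernel_cosine], which mentions no Hilbert space, so the
    equivalence of the other three requires no realization of the de Branges-Rovnyak space. *)
Lemma equivalences_core :
  (distortion_integral_finite phi sigma <-> radially_julia phi sigma) /\
  (hyp_dist_preserved_at phi sigma <-> radially_julia phi sigma) /\
  (strongly_conformal_at phi sigma <-> radially_julia phi sigma) /\
  (angular_lim2 (kernel_cosine phi) sigma 1 <-> radially_julia phi sigma).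
Proof.
  assert (Hh := self_map_hol). assert (Hs := self_map_lt_1).
  assert (X : angular_lim2 (kernel_cosine phi) sigma 1 <-> radially_julia phi sigma).
  { split; [apply cosine_radially_julia; trivial|]. intros H.
    destruct (julia_caratheodory phi sigma Hh Hs hsigma H) as [om [c D]].
    apply (julia_caratheodory_cosine phi sigma Hh Hs hsigma om c D). }
  split; [|split; [|split; [|exact X]]].
  - split; [apply distortion_integral_radially_julia|]. intros H.
    destruct (julia_caratheodory phi sigma Hh Hs hsigma H) as [om [c D]].
    apply (julia_caratheodory_distortion_integral om c D).
  - rewrite (hyp_dist_preserved_iff_cosine phi Hh Hs sigma). exact X.
  - split; [apply strongly_conformal_radially_julia; trivial|]. intros H.
    destruct (julia_caratheodory phi sigma Hh Hs hsigma H) as [om [c D]].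
    apply (julia_caratheodory_strongly_conformal phi sigma Hs hsigma om c D).
Qed.

End Main.

Lemma forall_pairs_iff (Q : Prop) (l : list Prop) :
  (forall P, In P l -> (P <-> Q)) -> ForallPairs iff l.
Proof. intros H P1 P2 H1 H2. rewrite (H P1 H1), (H P2 H2). reflexivity. Qed.

Theorem theorem2 (phi : C -> C) (sigma : C)
    (hphi : holomorphic_self_map phi) (hsigma : Cmod sigma = 1) :
  ForallPairs iff
    [ distortion_integral_finite phi sigma;
      hyp_dist_preserved_at phi sigma;
      strongly_conformal_at phi sigma ]
  /\ forall H : dbr_space phi,
       ForallPairs iff
         [ distortion_integral_finite phi sigma;
           hyp_dist_preserved_at phi sigma;
           kernels_aligned_at phi H sigma;
           strongly_conformal_at phi sigma ].
Proof.
  destruct (equivalences_core phi sigma hphi hsigma) as [Ea [Eb [Ed Ec]]].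
  split; [|intro H]; apply (forall_pairs_iff (radially_julia phi sigma)).
  - intros P [<-|[<-|[<-|[]]]]; assumption.
  - assert (Ec' : kernels_aligned_at phi H sigma <-> radially_julia phi sigma).
    { rewrite (kernels_aligned_iff_cosine phi H sigma). exact Ec. }
    intros P [<-|[<-|[<-|[<-|[]]]]]; assumption.
Qed.
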